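(* For $d\geq 2$, the escape rate function $$G_F(z,w)=\lim_{n\to\infty}\frac{1}{d^n}\log\|F^n(z,w)\|$$ exists for each degenerate $f\in\overline{\mathrm{Rat}}_d$ with $f\notin I(d)$, where $F:\mathbf{C}^2\to\mathbf{C}^2$ is a homogeneous polynomial lift of $f$, and it satisfies $\pi^*\mu_f=dd^cG_F$.
   Context: $\mathbf{P}^1$ is the complex projective line and $\pi:\mathbf{C}^2\setminus\{0\}\to\mathbf{P}^1$ the canonical projection. For $d\ge 1$, $\mathrm{Rat}_d$ is the space of holomorphic maps $\mathbf{P}^1\to\mathbf{P}^1$ of degree $d$. A point of $\overline{\mathrm{Rat}}_d\simeq\mathbf{P}^{2d+1}$ is a pair $f=(P:Q)$ of homogeneous polynomials of degree $d$ in $(z,w)$ with complex coefficients, not both zero, up to a common scalar; $\mathrm{Rat}_d$ is the open subset where $P,Q$ have no common factor. Points of $\overline{\mathrm{Rat}}_d$ not in $\mathrm{Rat}_d$ are called degenerate. Every $f\in\overline{\mathrm{Rat}}_d$ is written $f=H\phi_f$, with $H=\gcd(P,Q)$ and $\phi_f=(P/H:Q/H)$ a holomorphic self-map of $\mathbf{P}^1$ of degree $d-\deg H$. The zeros of $H$ in $\mathbf{P}^1$ are the holes of $f$; the multiplicity of such a zero is the depth of the hole. $I(d)\subset\overline{\mathrm{Rat}}_d$ is the set of degenerate $f=H\phi_f$ such that $\phi_f$ is constant and its value is one of the holes of $f$. A lift of $f=(P:Q)$ is the polynomial map $F=(P,Q)$ of $\mathbf{C}^2$ obtained by expressing $f$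 in homogeneous coordinates (determined up to a non-zero scalar), so that $\pi\circ F=f\circ\pi$ where defined; $F^n$ is its $n$-fold composition; $\|\cdot\|$ is any norm on $\mathbf{C}^2$. In the expression $dd^c$, the operators are $d=\partial+\bar\partial$ and $d^c=i(\bar\partial-\partial)/2\pi$. Measure $\mu_f$ of a degenerate $f$: if $\phi_f$ is non-constant, $\mu_f=\sum_{n=0}^\infty \frac{1}{d^{n+1}}\sum_i\sum_{\phi_f^n(z)=h_i}\delta_z$, where the holes $h_i$ and all preimages by $\phi_f$ are counted with multiplicity (a hole being counted as many times as its depth); if $\phi_f$ is constant, $\mu_f=\frac1d\sum_i\delta_{h_i}$, where the holes are again counted with multiplicity. *)

(* Defs.v *)
From HB Require Import structures.
(* The notations of mpoly clash with those of mathcomp-analysis, and some of its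
   names shadow those of ssrbool. *)
From mathcomp Require Import -(notations) mpoly.
From mathcomp Require Import all_boot all_order all_algebra.
From mathcomp Require Import generic_quotient.
From mathcomp Require Import all_classical all_reals all_analysis.
From mathcomp Require Import complex.

Set Implicit Arguments.
Unset Strict Implicit.
Unset Printing Implicit Defensive.
Import Order.TTheory GRing.Theory Num.Theory.
Import numFieldNormedType.Exports.

Local Open Scope classical_set_scope.
Local Open Scope complex_scope.
Local Open Scope ring_scope.

Notation "''C2' R" := 'rV[R[i]]_2 (at level 8, R at level 2) : type_scope.
Notation "''poly2' R" := (mpoly 2 R[i]) (at level 8, R at level 2) : type_scope.
Notation "''lift' R" := (2.-tuple (mpoly 2 R[i]))
  (at level 8, R at level 2) : type_scope.
Notation "''R4' R" := ((R * R) * (R * R))%type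
  (at level 8, R at level 2) : type_scope.

Section RealCoordinates.
Variable R : realType.

Definition toC2 (x : 'R4 R) : 'C2 R :=
  \row_j (if j == 0 then x.1.1 +i* x.1.2 else x.2.1 +i* x.2.2).

Definition ofC2 (v : 'C2 R) : 'R4 R :=
  ((complex.Re (v 0 0), complex.Im (v 0 0)),
   (complex.Re (v 0 1), complex.Im (v 0 1))).

End RealCoordinates.

Section ProjectiveLine.
Variable R : realType.

Definition C2nz : Type := {v : 'C2 R | v != 0}.
HB.instance Definition _ := SubChoice.on C2nz.

Definition same_line (u v : C2nz) : bool :=
  `[< exists c : R[i], c != 0 /\ val u = c *: val v >].

Lemma same_line_refl : reflexive same_line.
Proof. by move=> u; apply/asboolP; exists 1; rewrite oner_neq0 scale1r. Qed.

Lemma same_line_sym : symmetric same_line.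
Proof.
move=> u v; apply/asboolP/asboolP => -[c [c0 e]]; exists c^-1;
  by rewrite invr_eq0 e scalerA mulVf// scale1r.
Qed.

Lemma same_line_trans : transitive same_line.
Proof.
move=> v u w /asboolP[c [c0 e]] /asboolP[b [b0 e']]; apply/asboolP.
by exists (c * b); rewrite mulf_neq0// e e' scalerA.
Qed.

Canonical same_line_equiv :=
  EquivRel same_line same_line_refl same_line_sym same_line_trans.

Definition P1 : Type := {eq_quot same_line_equiv}%qT.
HB.instance Definition _ := Choice.on P1.
HB.instance Definition _ := Quotient.on P1.

Lemma axis_neq0 : delta_mx 0 0 != 0 :> 'C2 R.
Proof.
by apply/eqP => /matrixP/(_ 0 0)/eqP; rewrite !mxE !eqxx oner_eq0.
Qed.

Definition axis : C2nz :=
  exist (fun v : 'C2 R => is_true (v != 0)) (delta_mx 0 0) axis_neq0.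

(* The canonical projection; its value at 0 is irrelevant. *)
Definition proj (v : 'C2 R) : P1 := (\pi_P1 (insubd axis v))%qT.

Definition vec (x : P1) : 'C2 R := val (repr x).

HB.instance Definition _ := isPointed.Build P1 (proj 0).

(* U is open for the quotient topology. *)
Definition P1_open : set (set P1) :=
  [set U | open [set x : 'R4 R | toC2 x != 0 /\ U (proj (toC2 x))]].

Definition P1_borel := g_sigma_algebraType P1_open.
HB.instance Definition _ := Measurable.on P1_borel.

End ProjectiveLine.

(* The sum of a family of measures indexed by a set of arbitrary cardinality. *)
Section SumOfMeasures.
Context d (T : measurableType d) (R : realType) (I : choiceType).
Variables (D : set I) (m : I -> {measure set T -> \bar R}).
Local Open Scope ereal_scope.

Definition esum_measure (S : set T) : \bar R := \esum_(i in D) m i S.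

Let esum_measure0 : esum_measure set0 = 0.
Proof. by apply: esum1 => i _; rewrite measure0. Qed.

Let esum_measure_ge0 S : 0 <= esum_measure S.
Proof. by apply: esum_ge0 => i _; exact: measure_ge0. Qed.

Let esum_measure_sigma_additive : semi_sigma_additive esum_measure.
Proof.
move=> F mF tF mUF.
have -> : esum_measure (\bigcup_n F n) =
    \sum_(0 <= n <oo) esum_measure (F n).
  rewrite nneseries_esumT; last by move=> n; exact: esum_measure_ge0.
  rewrite /esum_measure esum_esum; last by move=> *; exact: measure_ge0.
  transitivity (\esum_(i in D) \esum_(n in [set: nat]) m i (F n)).
    apply: eq_esum => i _; rewrite -nneseries_esumT//.
    exact: measure_semi_bigcup.
  rewrite esum_esum; last by move=> *; exact: measure_ge0.
  rewrite (reindex_esum [set x | True /\ D x.2] _ (fun x => (x.2, x.1)))//.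
  split; first by move=> [n i] [].
  - by move=> [n i] [n' i'] _ _ [-> ->].
  - by move=> [i n] [? _]; exists (n, i).
apply: is_cvg_nneseries => n _ _; exact: esum_measure_ge0.
Qed.

HB.instance Definition _ := isMeasure.Build _ _ _ esum_measure
  esum_measure0 esum_measure_ge0 esum_measure_sigma_additive.

End SumOfMeasures.

Section Maps.
Variable R : realType.
Implicit Types (F G : 'lift R) (p q D H : 'poly2 R) (x z h : P1 R).

Definition is_lift (d : nat) F : Prop :=
  (forall j, tnth F j \is ishomog1 d mdeg) /\ (exists j, tnth F j != 0).

Definition lift_map F (v : 'C2 R) : 'C2 R := \row_j meval (v 0) (tnth F j).

Definition mdvd D p : Prop := exists q, p = D * q.

Definition degenerate F : Prop :=
  exists D, (1 < msize D)%N /\ forall j, mdvd D (tnth F j).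

Definition is_gcd F H : Prop :=
  (forall j, mdvd H (tnth F j)) /\
  (forall D, (forall j, mdvd D (tnth F j)) -> mdvd D H).

(* A greatest common divisor of the components of F, chosen among the non-zero
   scalar multiples of each other. *)
Definition hgcd F : 'poly2 R := xget 0 [set H | is_gcd F H].

Definition reduced F : 'lift R :=
  xget F [set G : 'lift R | forall j, tnth F j = hgcd F * tnth G j].

Definition phi F x : P1 R := proj (lift_map (reduced F) (vec x)).

Definition lift_comp F G : 'lift R := [tuple comp_mpoly G (tnth F j) | j < 2].

Definition lift_id : 'lift R := [tuple mpolyX R[i] (mnm1 j) | j < 2].

Definition lift_iter F n : 'lift R := iter n (lift_comp F) lift_id.

(* The linear form v_1 X_0 - v_0 X_1, whose only zero in P^1 is [v_0 : v_1]. *)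
Definition lform (v : 'C2 R) : 'poly2 R :=
  v 0 1 *: mpolyX R[i] (mnm1 (0 : 'I_2)) - v 0 0 *: mpolyX R[i] (mnm1 (1 : 'I_2)).

(* The multiplicity of x as a zero of a non-zero homogeneous polynomial p. *)
Definition zero_mult p x : nat :=
  \max_(k < msize p | `[< mdvd (lform (vec x) ^+ k) p >]) k.

Definition holes F : set (P1 R) := [set h | meval (vec h 0) (hgcd F) = 0].

Definition depth F h : nat := zero_mult (hgcd F) h.

(* With (A, B) a lift of phi^n and h = [h_0 : h_1], the equation phi^n(z) = h
   reads h_1 A - h_0 B = 0, and z is counted with its multiplicity as a zero of
   this polynomial. *)
Definition preim_mult F n h z : nat :=
  let AB := lift_iter (reduced F) n in
  zero_mult (vec h 0 1 *: tnth AB 0 - vec h 0 0 *: tnth AB 1) z.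

Definition phi_constant F : Prop := exists c, forall x, phi F x = c.

Definition in_I F : Prop :=
  degenerate F /\ exists c, (forall x, phi F x = c) /\ holes F c.

Definition hole_preimages F n : {measure set (P1_borel R) -> \bar R} :=
  esum_measure (holes F) (fun h : P1 R =>
    esum_measure [set z : P1 R | iter n (phi F) z = h] (fun z : P1 R =>
      mscale (depth F h * preim_mult F n h z)%N%:R%:nng
        (dirac (z : P1_borel R)))).

Definition mu_nonconstant (d : nat) F : {measure set (P1_borel R) -> \bar R} :=
  mseries (fun n => mscale ((d%:R^-1) ^+ n.+1)%:nng (hole_preimages F n)) 0.

Definition mu_constant (d : nat) F : {measure set (P1_borel R) -> \bar R} :=
  mscale (d%:R^-1)%:nng
    (esum_measure (holes F) (fun h : P1 R =>
       mscale (depth F h)%:R%:nng (dirac (h : P1_borel R)))).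

Definition mu (d : nat) F : {measure set (P1_borel R) -> \bar R} :=
  if `[< phi_constant F >] then mu_constant d F else mu_nonconstant d F.

Definition is_norm (N : 'C2 R -> R) : Prop :=
  [/\ forall u v, N (u + v) <= N u + N v,
      forall (c : R[i]) v, N (c *: v) = Normc.normc c * N v
    & forall v, N v = 0 -> v = 0].

(* lne 0 = -oo, so this is -oo at the points where F^n vanishes. *)
Definition escape_seq (N : 'C2 R -> R) (d : nat) F (v : 'C2 R) : (\bar R)^nat :=
  fun n => ((d%:R ^- n)%:E * lne (N (iter n (lift_map F) v))%:E)%E.

Definition escape_rate (N : 'C2 R -> R) (d : nat) F (v : 'C2 R) : \bar R :=
  limn (escape_seq N d F v).

End Maps.

Section Currents.
Variable R : realType.

(* A differential form sum_I f_I dzeta_I on C^2 is given by its coefficients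
   f_I, where (zeta_0, ..., zeta_3) = (z_0, z_1, conj z_0, conj z_1) and dzeta_I
   is the wedge product of the dzeta_i, i in I, in increasing order. *)
Definition diff_form : Type := {set 'I_(2 + 2)} -> 'R4 R -> R[i].

Definition e_x (k : 'I_2) : 'R4 R :=
  if k == 0 then ((1, 0), (0, 0)) else ((0, 0), (1, 0)).
Definition e_y (k : 'I_2) : 'R4 R :=
  if k == 0 then ((0, 1), (0, 0)) else ((0, 0), (0, 1)).

Definition cderive (u : 'R4 R) (f : 'R4 R -> R[i]) (x : 'R4 R) : R[i] :=
  ('D_u (fun y => complex.Re (f y)) x) +i* ('D_u (fun y => complex.Im (f y)) x).

Definition dz (k : 'I_2) (f : 'R4 R -> R[i]) (x : 'R4 R) : R[i] :=
  (cderive (e_x k) f x - 'i%C * cderive (e_y k) f x) / 2%:R.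
Definition dzbar (k : 'I_2) (f : 'R4 R -> R[i]) (x : 'R4 R) : R[i] :=
  (cderive (e_x k) f x + 'i%C * cderive (e_y k) f x) / 2%:R.

(* The form dzeta_j /\ w. *)
Definition wedge1 (j : 'I_(2 + 2)) (w : diff_form) : diff_form := fun J x =>
  if j \in J then (-1) ^+ #|[set i in J | (i < j)%N]%SET| * w (J :\ j)%SET x else 0.

Definition del (w : diff_form) : diff_form := fun J x =>
  \sum_(k < 2) wedge1 (lshift 2 k) (fun I => dz k (w I)) J x.
Definition delbar (w : diff_form) : diff_form := fun J x =>
  \sum_(k < 2) wedge1 (rshift 2 k) (fun I => dzbar k (w I)) J x.

Definition dform (w : diff_form) : diff_form := fun J x => del w J x + delbar w J x.
Definition dcform (w : diff_form) : diff_form := fun J x =>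
  'i%C * (delbar w J x - del w J x) / (2%:R * pi%:C).

Definition smooth (f : 'R4 R -> R) : Prop :=
  forall us : seq ('R4 R),
    let g := foldr (fun u g x => 'D_u g x) f us in
    continuous g /\ forall x u, derivable g x u.

(* Smooth k-forms with compact support in C^2 minus the origin. *)
Definition test_form (k : nat) (w : diff_form) : Prop :=
  [/\ forall (I : {set 'I_(2 + 2)}) x, #|I| != k -> w I x = 0,
      forall I, smooth (fun x => complex.Re (w I x)) /\
                smooth (fun x => complex.Im (w I x))
    & exists K : set ('R4 R), [/\ compact K, ~ K 0 &
        forall I x, ~ K x -> w I x = 0]].

Definition leb2 : set (R * R) -> \bar R :=
  (@lebesgue_measure R \x @lebesgue_measure R)%E.
Definition leb4 : set ('R4 R) -> \bar R :=
  ((@lebesgue_measure R \x @lebesgue_measure R) \x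
   (@lebesgue_measure R \x @lebesgue_measure R))%E.

Definition cintegral d (T : measurableType d) (m : set T -> \bar R)
    (f : T -> R[i]) : R[i] :=
  (fine (\int[m]_(x in setT) (complex.Re (f x))%:E)) +i*
  (fine (\int[m]_(x in setT) (complex.Im (f x))%:E)).

(* Local integrability on C^2 minus the origin. *)
Definition loc_integrable (g : 'R4 R -> \bar R) : Prop :=
  forall K : set ('R4 R), compact K -> ~ K 0 -> leb4.-integrable K g.

Definition current : Type := diff_form -> R[i].

(* The current w |-> int g w of a function g, w of degree 4. The factor 4 comes
   from dz_0 /\ dz_1 /\ dconj(z_0) /\ dconj(z_1) = 4 dx_0 dy_0 dx_1 dy_1 for the
   complex orientation. *)
Definition current_of (g : 'R4 R -> \bar R) : current := fun w =>
  4%:R *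
  ((fine (\int[leb4]_(x in setT) (g x * (complex.Re (w [set: _]%SET x))%:E)%E))
   +i* (fine (\int[leb4]_(x in setT) (g x * (complex.Im (w [set: _]%SET x))%:E)%E))).

(* Since T has degree 0, no sign appears in <dd^c T, w> = <T, dd^c w>. *)
Definition ddc (T : current) : current := fun w => T (dform (dcform w)).

(* The integral of a 2-form over the fibre pi^-1(x), parametrized by t |-> t v.
   The form dz_j /\ dconj(z_k) pulls back to
   v_j conj(v_k) dt /\ dconj(t) = - 2i v_j conj(v_k) ds dr with t = s + i r, the
   forms dz_0 /\ dz_1 and dconj(z_0) /\ dconj(z_1) to 0. *)
Definition fibre_integral (w : diff_form) (x : P1 R) : R[i] :=
  let v := vec x in
  cintegral leb2 (fun t : R * R =>
    - (2%:R * 'i%C) * \sum_(j < 2) \sum_(k < 2)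
      v 0 j * conjc (v 0 k) *
      w [set lshift 2 j; rshift 2 k]%SET (ofC2 ((t.1 +i* t.2) *: v))).

(* The pullback by pi of a measure on P^1, as a current of bidegree (1, 1) on
   C^2 minus the origin: dual to integration along the fibres of pi. *)
Definition pullback (m : set (P1_borel R) -> \bar R) : current := fun w =>
  cintegral m (fun x : P1_borel R => fibre_integral w x).

End Currents.

(* Main.v *)
From HB Require Import structures.
From mathcomp Require Import -(notations) mpoly.
From mathcomp Require Import all_boot all_order all_algebra.
From mathcomp Require Import generic_quotient.
From mathcomp Require Import all_classical all_reals all_analysis.
From mathcomp Require Import measurable_realfun complex ring lra zify.
Require Import Defs.

Set Implicit Arguments.
Unset Strict Implicit.
Unset Printing Implicit Defensive.
Import Order.TTheory GRing.Theory Num.Theory.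
Import numFieldNormedType.Exports.

Local Open Scope classical_set_scope.
Local Open Scope complex_scope.
Local Open Scope ring_scope.

(** Write F = H Phi, where H is the greatest common divisor of the two components, of degree h,
    and Phi is the reduced lift, of degree e = d - h < d and without common zero outside 0.
    By homogeneity F^n v is the product of Phi^n v by the scalars H(Phi^k v)^(d^(n-1-k)), k < n,
    so that
      d^(-n) log |F^n v| = sum_(k < n) d^(-k-1) log |H(Phi^k v)| + d^(-n) log |Phi^n v|.
    Both claims are about this series.

    Pointwise convergence.  By compactness of the unit sphere, |log |Phi v| - e log |v|| is
    bounded, and as e < d the numbers log |Phi^k v| are O(rho^k) for some rho < d
    (orbit_growth).  The last term thus tends to 0, and the terms of the series are bounded above
    by a summable sequence, so that the series converges in [-oo, +oo); it is stationary at -oo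
    if the orbit of v meets the zeros of H (escape_rate_limit).

    The current of one term.  The form H o Phi^k is a product of linear forms; its zeros in P^1
    are, with multiplicities, the point masses of the k-th term of the measure.  If the reduced
    map is constant, then f outside I(d) means that H o Phi^k is a non-zero constant for k > 0,
    and only the holes remain (degenerate_data).  For one linear form L the current
    dd^c log |L| is integration over the line L = 0 (fibre_integralE).  To see this, log |L| is
    replaced by log (|L|^2 + eps^2) / 2; two integrations by parts (reg_log_ibp) carry dd^c over to
    this smooth function, and produce the kernel eps^2 / (|L|^2 + eps^2)^2, which after division
    by pi is an approximate identity along the line (kappa_limit).

    Summation.  The local L^1 norm of log |H o Phi^k| is O(rho^k) (orbit_log_bound): it consists
    of h e^k logarithms of linear forms, each bounded uniformly once the form is normalized
    (lognorm_bound), and of a normalizing constant.  The constant is bounded above by integrating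
    over a cube the upper bound for log |H(Phi^k v)|, and below by evaluating at a point v
    with Phi^k v on the line of a fixed w, H(w) <> 0.  Since rho < d, dominated convergence
    integrates the series term by term (escape_rate_integral).  On the side of the measure, the
    fibre integrals of a test form are bounded on P^1 (potential_bounded), and a measure carried by
    countably many points integrates every bounded function to the sum of its values
    (integral_atomic).  The coefficient of dd^c w has integral zero, so the constant factors of
    H o Phi^k do not matter and the two series agree term by term (integral_mu). *)

(** * Binary forms *)

Section BinaryForms.
Variable R : realType.
Local Notation C := R[i].
Implicit Types (p q : 'poly2 R) (v : 'C2 R) (P : {poly C}).

Local Notation "p \is_form m" := (p \is ishomog1 m mdeg) (at level 70).
Local Notation "''Y_' j" := (mpolyX C (mnm1 (j : 'I_2))) (at level 8, j at level 2).

Definition mnm2 (i j : nat) : multinom 2 := Multinom [tuple i; j].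

(** Homogenization in degree m, the inverse of the substitution of 1 for the second variable. *)
Definition form_of_poly (m : nat) (P : {poly C}) : 'poly2 R :=
  \sum_(i < m.+1) P`_i *: mpolyX C (mnm2 i (m - i)).

Definition poly_of_form (m : nat) (p : 'poly2 R) : {poly C} :=
  \poly_(i < m.+1) mcoeff (mnm2 i (m - i)) p.

Lemma mdeg2E (k : multinom 2) : mdeg k = (k (0%R : 'I_2) + k (1%R : 'I_2))%N.
Proof. by rewrite mdegE !big_ord_recl big_ord0 addn0; congr (k _ + k _)%N; apply/val_inj. Qed.

Lemma mnm2E (k : multinom 2) : k = mnm2 (k (0%R : 'I_2)) (k (1%R : 'I_2)).
Proof.
apply/mnmP => i; rewrite multinomE (tnth_nth 0%N).
by case: i => [[|[|//]] hi] /=; congr (k _); apply/val_inj.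
Qed.

Lemma mnm2_0 i j : mnm2 i j (0%R : 'I_2) = i. Proof. by rewrite multinomE (tnth_nth 0%N). Qed.
Lemma mnm2_1 i j : mnm2 i j (1%R : 'I_2) = j. Proof. by rewrite multinomE (tnth_nth 0%N). Qed.

Lemma poly_of_formK m p : p \is_form m -> form_of_poly m (poly_of_form m p) = p.
Proof.
move=> hp; apply/mpolyP => k; rewrite raddf_sum /=.
have [km|km] := eqVneq (mdeg k) m; last first.
  rewrite (dhomog_nemf_coeff hp km) big1 // => i _.
  rewrite mcoeffZ mcoeffX; case: eqP => [e|]; last by rewrite mulr0.
  by case/eqP: km; rewrite -e mdeg2E mnm2_0 mnm2_1 subnKC // -ltnS.
have k0 : (k (0%R : 'I_2) < m.+1)%N by rewrite ltnS -km mdeg2E leq_addr.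
rewrite (bigD1 (Ordinal k0)) //= mcoeffZ mcoeffX coef_poly k0.
have ek : mnm2 (k (0%R : 'I_2)) (m - k (0%R : 'I_2)) = k by rewrite -km mdeg2E addKn -mnm2E.
rewrite ek eqxx mulr1 big1 ?addr0 // => i /eqP ik.
rewrite mcoeffZ mcoeffX; case: eqP => [e|]; last by rewrite mulr0.
by case: ik; apply/val_inj; rewrite /= -e mnm2_0.
Qed.

Lemma form_of_poly_homog m P : form_of_poly m P \is_form m.
Proof.
apply: rpred_sum => i _; apply: rpredZ; change (mpolyX C (mnm2 i (m - i)) \is_form m).
by rewrite dhomogX /= mdeg2E mnm2_0 mnm2_1 subnKC // -ltnS.
Qed.

Lemma meval_form_of_poly m P v :
  meval (v 0) (form_of_poly m P) = \sum_(i < m.+1) P`_i * (v 0 0 ^+ i * v 0 1 ^+ (m - i)).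
Proof.
rewrite raddf_sum /=; apply: eq_bigr => i _; rewrite mevalZ mevalX.
rewrite !big_ord_recl big_ord0 mulr1.
have -> : lift ord0 ord0 = 1 :> 'I_2 by apply/val_inj.
by rewrite mnm2_0 mnm2_1.
Qed.

Lemma form_of_polyB m P Q : form_of_poly m (P - Q) = form_of_poly m P - form_of_poly m Q.
Proof. by rewrite -sumrB; apply: eq_bigr => i _; rewrite coefB scalerBl. Qed.

Lemma form_of_polyZ m c P : form_of_poly m (c *: P) = c *: form_of_poly m P.
Proof. by rewrite scaler_sumr; apply: eq_bigr => i _; rewrite coefZ scalerA. Qed.

Lemma mnm2_addX i j : mpolyX C (mnm2 i.+1 j) = 'Y_0 * mpolyX C (mnm2 i j).
Proof.
rewrite -mpolyXD; congr mpolyX; apply/mnmP => k; rewrite mnmDE mnmE !multinomE !(tnth_nth 0%N).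
by case: k => [[|[|//]] hk].
Qed.

Lemma mnm2_addY i j : mpolyX C (mnm2 i j.+1) = 'Y_1 * mpolyX C (mnm2 i j).
Proof.
rewrite -mpolyXD; congr mpolyX; apply/mnmP => k; rewrite mnmDE mnmE !multinomE !(tnth_nth 0%N).
by case: k => [[|[|//]] hk].
Qed.

Lemma form_of_polyMX m P : form_of_poly m.+1 (P * 'X) = 'Y_0 * form_of_poly m P.
Proof.
rewrite /form_of_poly big_ord_recl coefMX /= scale0r add0r mulr_sumr.
apply: eq_bigr => i _; rewrite coefMX /= /bump /= add1n subSS mnm2_addX.
by rewrite scalerAr.
Qed.

Lemma form_of_polyS m P : (size P <= m.+1)%N ->
  form_of_poly m.+1 P = 'Y_1 * form_of_poly m P.
Proof.
move=> sP; rewrite /form_of_poly big_ord_recr /= nth_default // scale0r addr0 mulr_sumr.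
apply: eq_bigr => i _; rewrite subSn -1?ltnS// mnm2_addY.
by rewrite scalerAr.
Qed.

Lemma meval_homog m p (c : C) v : p \is_form m ->
  meval ((c *: v) 0) p = c ^+ m * meval (v 0) p.
Proof.
move=> hp; rewrite !mevalE mulr_sumr; apply: eq_big_seq => k kp.
rewrite mulrCA; congr (_ * _); rewrite -(dhomog_mf hp kp) /= mdegE.
rewrite -prodrXr -big_split /=; apply: eq_bigr => i _.
by rewrite mxE exprMn.
Qed.

Lemma size_poly_of_form m p : (size (poly_of_form m p) <= m.+1)%N.
Proof. exact: size_poly. Qed.

Lemma horner_poly_of_form m p a : p \is_form m ->
  (poly_of_form m p).[a] = meval ((\row_j (if j == 0 then a else 1) : 'C2 R) 0) p.
Proof.
move=> hp; rewrite -{2}(poly_of_formK hp) meval_form_of_poly !mxE /=.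
rewrite (horner_coef_wide _ (size_poly_of_form m p)).
by apply: eq_bigr => i _; rewrite expr1n mulr1.
Qed.

Lemma eq_row2 (u v : 'C2 R) : u 0 0 = v 0 0 -> u 0 1 = v 0 1 -> u = v.
Proof.
move=> e0 e1; apply/rowP => j; case: j => [[|[|//]] hj].
  by have -> : Ordinal hj = 0 by apply/val_inj.
by have -> : Ordinal hj = 1 by apply/val_inj.
Qed.

Lemma meval_lform v (x : 'C2 R) : meval (x 0) (lform v) = v 0 1 * x 0 0 - v 0 0 * x 0 1.
Proof. by rewrite mevalB !mevalZ !mevalXU. Qed.

Lemma lform_homog v : lform v \is_form 1.
Proof. by apply: rpredB; apply: rpredZ; change ('Y_0 \is_form 1) || change ('Y_1 \is_form 1);
  rewrite dhomogX /= mdeg1. Qed.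

(** Dehomogenizing at whichever coordinate of the zero does not vanish reduces
    the claim to the factor theorem in one variable. *)
Lemma lform_dvd_form m p v : p \is_form m.+1 -> v != 0 -> meval (v 0) p = 0 ->
  exists2 q, q \is_form m & p = lform v * q.
Proof.
move=> hp v0 pv; have [v10|v10] := eqVneq (v 0 1) 0.
  have v00 : v 0 0 != 0.
    by apply: contraNneq v0 => v00; apply/eqP/eq_row2; rewrite ?v00 ?v10 mxE.
  have sP : (size (poly_of_form m.+1 p) <= m.+1)%N.
    have /= := size_poly_of_form m.+1 p; rewrite leq_eqVlt => /predU1P[sz|//].
    move: pv; rewrite -{1}(poly_of_formK hp) meval_form_of_poly v10 big_ord_recr /= subnn.
    rewrite big1 ?add0r ?mulr1 => [/eqP|i _]; last first.
      by rewrite subSn -1?ltnS// exprS mul0r !mulr0.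
    rewrite mulf_eq0 expf_eq0 (negbTE v00) andbF orbF => /eqP c0.
    by move: (size_poly_of_form m.+1 p); rewrite leq_eqVlt sz eqxx; move=> _;
      have := lead_coefE (poly_of_form m.+1 p); rewrite sz /= c0 => /eqP;
      rewrite lead_coef_eq0 -size_poly_eq0 sz.
  exists (- (v 0 0)^-1 *: form_of_poly m (poly_of_form m.+1 p)).
    by rewrite rpredZ// form_of_poly_homog.
  rewrite -{1}(poly_of_formK hp) (form_of_polyS sP) /lform v10 scale0r sub0r.
  by rewrite -scalerAr scaleNr mulNr scalerN opprK -scalerAl scalerA mulVf// scale1r.
pose a := v 0 0 / v 0 1.
have Pa : root (poly_of_form m.+1 p) a.
  apply/rootP; rewrite (horner_poly_of_form _ hp).
  have -> : \row_j (if j == 0 then a else 1) = (v 0 1)^-1 *: v.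
    by apply: eq_row2; rewrite !mxE //= ?mulVf// mulrC.
  by rewrite (meval_homog _ _ hp) pv mulr0.
have [Q eQ] := factor_theorem _ _ Pa.
have sQ : (size Q <= m.+1)%N.
  have := size_poly_of_form m.+1 p; rewrite eQ.
  have [->|Q0] := eqVneq Q 0; first by rewrite size_poly0.
  by rewrite size_Mmonic ?monicXsubC// size_XsubC addn2.
exists ((v 0 1)^-1 *: form_of_poly m Q).
  by rewrite rpredZ// form_of_poly_homog.
rewrite -{1}(poly_of_formK hp) eQ mulrBr form_of_polyB form_of_polyMX.
rewrite [Q * _]mulrC mul_polyC form_of_polyZ (form_of_polyS sQ) /lform.
rewrite -scalerAr mulrBl -2!scalerAl -/(form_of_poly m Q) [LHS](_ : _ = 'Y_0 * form_of_poly m Q - a *: ('Y_1 * form_of_poly m Q)) //.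
rewrite scalerBr; congr (_ - _); rewrite scalerA; last by rewrite [_^-1 * _]mulrC.
by rewrite mulVf// scale1r.
Qed.

(** A form of positive degree either has its point at infinity as a zero, namely if its
    dehomogenization is constant, or has an affine zero since C is algebraically closed. *)
Lemma form_has_zero m p : p \is_form m.+1 -> exists2 v : 'C2 R, v != 0 & meval (v 0) p = 0.
Proof.
move=> hp; have [s1|s1] := eqVneq (size (poly_of_form m.+1 p)) 1.
  exists (\row_j (if j == 0 then 1 else 0)).
    by apply/eqP => /rowP/(_ 0)/eqP; rewrite !mxE oner_eq0.
  rewrite -(poly_of_formK hp) meval_form_of_poly !mxE /=.
  rewrite big_ord_recr /= subnn [_`_m.+1]nth_default ?s1// mul0r addr0 big1 // => i _.
  by rewrite subSn -1?ltnS// exprS mul0r !mulr0.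
have /closed_rootP[a /rootP Pa] := s1.
exists (\row_j (if j == 0 then a else 1)).
  by apply/eqP => /rowP/(_ 1)/eqP; rewrite !mxE oner_eq0.
by rewrite -(horner_poly_of_form _ hp).
Qed.

Lemma form0 p : p \is_form 0 -> exists c, p = mpolyC 2 c.
Proof.
move=> hp; exists (mcoeff (@mnm0 2) p); apply/mpolyP => k; rewrite mcoeffC.
case: (eqVneq (@mnm0 2) k) => [<-|k0]; first by rewrite mulr1.
by rewrite mulr0 (dhomog_nemf_coeff hp)//= mdeg_eq0 eq_sym.
Qed.

Lemma formM m n p q : p \is_form m -> q \is_form n -> p * q \is_form (m + n).
Proof. exact: dhomogM. Qed.

Lemma formZ m (c : C) p : p \is_form m -> c *: p \is_form m.
Proof. exact: rpredZ. Qed.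

Lemma msize_form m p : p \is_form m -> p != 0 -> mmeasure mdeg p = m.+1.
Proof.
move=> hp p0; have := dhomog_msize hp; move/(dhomog_uniq p0 hp) => ->.
by rewrite prednK// lt0n mmeasure_poly_eq0.
Qed.

Lemma lform_neq0 v : v != 0 -> lform v != 0.
Proof.
move=> v0; apply: contraNneq v0 => l0; apply/eqP/eq_row2; rewrite mxE.
  have := meval_lform v (delta_mx 0 1); rewrite l0 meval0 !mxE /= mulr0 mulr1 sub0r.
  by move/eqP; rewrite eq_sym oppr_eq0 => /eqP.
have := meval_lform v (delta_mx 0 0); rewrite l0 meval0 !mxE /= mulr0 mulr1 subr0.
by move/eqP; rewrite eq_sym => /eqP.
Qed.

End BinaryForms.

(** * Factorization of binary forms over the points of the projective line *)

Section ProjectivePoints.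
Variable R : realType.
Local Notation C := R[i].
Implicit Types (u v : 'C2 R) (x y : P1 R).

(** The value at u of the linear form of v; it vanishes exactly if u is on the line of v. *)
Definition det2 (u v : 'C2 R) : C := v 0 1 * u 0 0 - v 0 0 * u 0 1.

Lemma vec_neq0 x : vec x != 0.
Proof. exact: (valP (repr x)). Qed.

Lemma vecK x : proj (vec x) = x.
Proof.
rewrite /proj /vec; have -> : insubd (axis R) (val (repr x)) = repr x.
  by rewrite valKd.
exact: reprK.
Qed.

Lemma proj_eqP u v : u != 0 -> v != 0 ->
  proj u = proj v <-> exists c : C, c != 0 /\ u = c *: v.
Proof.
move=> u0 v0; rewrite /proj; split.
  move/eqmodP => /= /asboolP[c [c0]]; rewrite !val_insubd u0 v0 => e.
  by exists c.
case=> c [c0 e]; apply/eqmodP/asboolP; exists c.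
by rewrite !val_insubd u0 v0.
Qed.

Lemma projZ (c : C) v : c != 0 -> v != 0 -> proj (c *: v) = proj v.
Proof.
by move=> c0 v0; apply/proj_eqP => //; [rewrite scaler_eq0 negb_or c0|exists c].
Qed.

Lemma vec_proj v : v != 0 -> exists c : C, c != 0 /\ vec (proj v) = c *: v.
Proof. by move=> v0; apply/proj_eqP => //; rewrite ?vec_neq0 ?vecK. Qed.

Lemma det2_eq0 u v : v != 0 -> det2 u v = 0 -> exists c : C, u = c *: v.
Proof.
move=> v0 /eqP; rewrite subr_eq0 => /eqP e.
have [v1|v1] := eqVneq (v 0 1) 0.
  have v00 : v 0 0 != 0.
    by apply: contraNneq v0 => v00; apply/eqP/eq_row2; rewrite ?v00 ?v1 mxE.
  exists (u 0 0 / v 0 0); apply: eq_row2; rewrite !mxE ?divfK// v1 mulr0.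
  by move/esym/eqP: e; rewrite v1 mul0r mulf_eq0 (negbTE v00) => /eqP.
exists (u 0 1 / v 0 1); apply: eq_row2; rewrite !mxE ?divfK//.
by rewrite mulrAC [u 0 1 * _]mulrC -e mulrAC divff// mul1r.
Qed.

Lemma det2_proj u x : u != 0 -> (det2 u (vec x) == 0) = (proj u == x).
Proof.
move=> u0; apply/eqP/eqP => [/(det2_eq0 (vec_neq0 x))[c e]|<-].
  rewrite e projZ ?vec_neq0 ?vecK//; apply: contraNneq u0 => c0.
  by rewrite e c0 scale0r.
have [c [c0 ->]] := vec_proj u0; rewrite /det2 !mxE; ring.
Qed.

Lemma det2Zr (c : C) u v : det2 u (c *: v) = c * det2 u v.
Proof. by rewrite /det2 !mxE; ring. Qed.

Lemma meval_lformE u v : meval (u 0) (lform v) = det2 u v.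
Proof. by rewrite meval_lform. Qed.

End ProjectivePoints.

Section Factorization.
Variable R : realType.
Local Notation C := R[i].
Implicit Types (p q : 'poly2 R) (v : 'C2 R) (x y : P1 R).
Local Notation "p \is_form m" := (p \is ishomog1 m mdeg) (at level 70).

Definition prod_lform (xs : seq (P1 R)) : 'poly2 R := \prod_(x <- xs) lform (vec x).

Lemma prod_lform_homog xs : prod_lform xs \is_form size xs.
Proof.
rewrite /prod_lform; elim: xs => [|x xs IH]; first by rewrite big_nil dhomog1.
by rewrite big_cons; apply: (@formM _ 1 (size xs)) => //; exact: lform_homog.
Qed.

Lemma prod_lform_neq0 xs : prod_lform xs != 0.
Proof. by rewrite prodf_seq_neq0; apply/allP => x _; rewrite lform_neq0 ?vec_neq0. Qed.

Lemma meval_prod_lform xs v : meval (v 0) (prod_lform xs) = \prod_(x <- xs) det2 v (vec x).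
Proof. by rewrite /prod_lform (rmorph_prod (meval (v 0))) /=; apply: eq_bigr => x _; rewrite meval_lformE. Qed.

Lemma meval_form_vec m p v : p \is_form m -> v != 0 ->
  (meval (vec (proj v) 0) p == 0) = (meval (v 0) p == 0).
Proof.
move=> hp v0; have [c [c0 ->]] := vec_proj v0.
by rewrite (meval_homog _ _ hp) mulf_eq0 expf_eq0 (negbTE c0) andbF.
Qed.

(** Dividing out the linear form of one zero at a time. *)
Lemma form_factor m p : p \is_form m -> p != 0 ->
  exists c xs, [/\ c != 0, size xs = m & p = c *: prod_lform xs].
Proof.
elim: m p => [|m IH] p hp p0.
  have [c e] := form0 hp; exists c, [::]; split => //.
    by apply: contraNneq p0 => c0; rewrite e c0 mpolyC0.
  by rewrite /prod_lform big_nil e -mul_mpolyC mulr1.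
have [v v0 pv] := form_has_zero hp.
have pv' : meval (vec (proj v) 0) p = 0.
  by apply/eqP; rewrite (meval_form_vec hp v0) pv.
have [q hq e] := lform_dvd_form hp (vec_neq0 _) pv'.
have q0 : q != 0 by apply: contraNneq p0 => q0; rewrite e q0 mulr0.
have [c [xs [c0 sx eq]]] := IH _ hq q0.
exists c, (proj v :: xs); split; rewrite /= ?sx//.
by rewrite e eq /prod_lform big_cons scalerAr.
Qed.

Lemma meval_factor c xs v : meval (v 0) (c *: prod_lform xs) = c * \prod_(x <- xs) det2 v (vec x).
Proof. by rewrite mevalZ meval_prod_lform. Qed.

Lemma mem_zeros c xs x : c != 0 -> (x \in xs) = (meval (vec x 0) (c *: prod_lform xs) == 0).
Proof.
move=> c0; rewrite meval_factor mulf_eq0 (negbTE c0) /= prodf_seq_eq0.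
apply/idP/hasP => [xx|[y yy /=]].
  by exists x => //=; rewrite det2_proj ?vec_neq0 // vecK.
by rewrite det2_proj ?vec_neq0 // vecK => /eqP ->.
Qed.

(** Split off the power of the linear form of x: the cofactor does not vanish at x, which
    bounds the exponent. *)
Lemma zero_mult_factor c xs x : c != 0 ->
  zero_mult (c *: prod_lform xs) x = count_mem x xs.
Proof.
move=> c0; set p := c *: _; have p0 : p != 0 by rewrite scaler_eq0 negb_or c0 prod_lform_neq0.
have sp : mmeasure mdeg p = (size xs).+1.
  by rewrite (@msize_form R (size xs)) // formZ// prod_lform_homog.
set l := lform (vec x).
pose r := c *: prod_lform [seq y <- xs | y != x].
have ep : p = l ^+ count_mem x xs * r.
  rewrite /p /r -scalerAr; congr (_ *: _).
  rewrite /prod_lform (bigID (pred1 x)) /= big_filter; congr (_ * _).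
  under eq_bigr => y /eqP -> do rewrite -/l.
  by rewrite big_const_seq iter_mulr mulr1.
have rx : meval (vec x 0) r != 0.
  by rewrite -mem_zeros// mem_filter eqxx.
have lx : meval (vec x 0) l = 0.
  by apply/eqP; rewrite meval_lformE det2_proj ?vec_neq0// vecK.
have l0 : l != 0 by rewrite lform_neq0 ?vec_neq0.
have dvdP k : mdvd (l ^+ k) p <-> (k <= count_mem x xs)%N.
  split => [[q]|kc]; last first.
    by exists (l ^+ (count_mem x xs - k) * r); rewrite mulrA -exprD subnKC.
  case: leqP => // ck; rewrite ep -(subnK (ltnW ck)) addnC exprD -mulrA.
  move/(mulfI (expf_neq0 _ l0)) => e.
  by move: rx; rewrite e mevalM -(prednK (_ : 0 < k - _)%N) ?subn_gt0// exprS mevalM lx !mul0r eqxx.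
rewrite /zero_mult; apply/eqP; rewrite eqn_leq; apply/andP; split.
  by apply/bigmax_leqP => k /asboolP /dvdP.
have cs : (count_mem x xs < mmeasure mdeg p)%N by rewrite sp ltnS count_size.
rewrite (@leq_bigmax_cond _ (fun k : 'I_(mmeasure mdeg p) => `[< mdvd (l ^+ k) p >]) (fun k => nat_of_ord k) (Ordinal cs))//.
by apply/asboolP/dvdP.
Qed.

End Factorization.

(** * Common factors of two binary forms *)

Section GreatestCommonDivisor.
Variable R : realType.
Local Notation C := R[i].
Implicit Types (p q A B D : 'poly2 R) (v : 'C2 R) (x y : P1 R) (F G : 'lift R).
Local Notation "p \is_form m" := (p \is ishomog1 m mdeg) (at level 70).

Definition no_common_zero G := forall v, v != 0 -> lift_map G v != 0.

Lemma lift_map_eq0 G v : (lift_map G v == 0) =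
  (meval (v 0) (tnth G 0) == 0) && (meval (v 0) (tnth G 1) == 0).
Proof.
apply/eqP/andP => [/rowP e|[/eqP e0 /eqP e1]].
  by split; apply/eqP; [have := e 0|have := e 1]; rewrite !mxE.
by apply: eq_row2; rewrite !mxE.
Qed.

Lemma forall_I2 (P : 'I_2 -> Prop) : P 0 -> P 1 -> forall j, P j.
Proof.
move=> P0 P1 [[|[|//]] hj]; first by rewrite (_ : Ordinal hj = 0)//; exact/val_inj.
by rewrite (_ : Ordinal hj = 1)//; exact/val_inj.
Qed.

Lemma poly_eq0_nz (P : {poly C}) : (forall t : C, t != 0 -> P.[t] = 0) -> P = 0.
Proof.
move=> Pt; apply/eqP/negPn/negP => P0.
have := @max_poly_roots _ P [seq n.+1%:R : C | n <- iota 0 (size P)] P0.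
rewrite size_map size_iota ltnn => H; suff: false by [].
apply: H; first by apply/allP => _ /mapP[n _ ->]; apply/rootP/Pt; rewrite pnatr_eq0.
by rewrite map_inj_uniq ?iota_uniq// => m n /eqP; rewrite eqr_nat eqSS => /eqP.
Qed.

(** Restricting to the line through [v], the kernel of the restriction being
    the ideal of the linear form: a product vanishing on the line has a factor
    vanishing on it.  The homogeneous components of [A] are separated by the
    powers of the parameter of the line. *)
Lemma lform_gauss v m A q : v != 0 -> q \is_form m -> meval (v 0) q != 0 ->
  mdvd (lform v) (A * q) -> mdvd (lform v) A.
Proof.
move=> v0 hq qv [B eB].
have lv : meval (v 0) (lform v) = 0 by rewrite meval_lform; ring.
pose P := \poly_(d < mmeasure mdeg A) meval (v 0) (pihomog mdeg d A).
have eA := pihomog_partitionE (leqnn (mmeasure mdeg A)).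
have Pt t : P.[t] = meval ((t *: v) 0) A.
  rewrite horner_poly [in RHS]eA raddf_sum /=; apply: eq_bigr => d _.
  by rewrite (meval_homog _ _ (pihomogP _ _ _)) mulrC.
have P0 : P = 0.
  apply: poly_eq0_nz => t t0; rewrite Pt.
  have /eqP : meval ((t *: v) 0) (A * q) = 0.
    by rewrite eB mevalM (meval_homog _ _ (lform_homog v)) lv mulr0 mul0r.
  rewrite mevalM mulf_eq0 (meval_homog _ _ hq) mulf_eq0 expf_eq0 (negbTE t0) andbF.
  by rewrite (negbTE qv) !orbF => /eqP.
have Av (d : 'I_(mmeasure mdeg A)) : mdvd (lform v) (pihomog mdeg d A).
  have : P`_d = 0 by rewrite P0 coef0.
  rewrite coef_poly ltn_ord; move: (pihomogP mdeg d A); case: (nat_of_ord d) => [|n] hA Ad.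
    have [c e] := form0 hA; exists 0; move: Ad; rewrite mulr0 e mevalC => ->.
    by rewrite mpolyC0.
  by have [r _ e] := lform_dvd_form hA v0 Ad; exists r.
exists (\sum_d sval (cid (Av d))); rewrite {1}eA mulr_sumr.
by apply: eq_bigr => d _; case: cid.
Qed.

(** The linear factors, taken with multiplicity, pass one at a time from one side to the other. *)
Lemma coprime_dvd m ys A B q : q \is_form m ->
  {in ys, forall y : P1 R, meval (vec y 0) q != 0} ->
  A * q = B * prod_lform ys -> mdvd (prod_lform ys) A.
Proof.
move=> hq; elim: ys A B => [|y ys IH] A B qy e.
  by exists A; rewrite /prod_lform big_nil mul1r.
have [|A' eA] := @lform_gauss (vec y) m A q (vec_neq0 y) hq (qy _ (mem_head _ _)).
  by exists (B * prod_lform ys); rewrite e /prod_lform big_cons mulrCA.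
have [||r er] := IH A' B.
- by move=> z zy; apply: qy; rewrite inE zy orbT.
- apply: (mulfI (lform_neq0 (vec_neq0 y))).
  by rewrite mulrA -eA e /prod_lform big_cons mulrCA.
- by exists r; rewrite eA er /prod_lform big_cons mulrA.
Qed.

(** As long as there is a common zero, its linear form divides both components. *)
Lemma common_factor d F : is_lift d F ->
  exists xs G e, [/\ (size xs + e = d)%N, forall j, tnth G j \is_form e,
    no_common_zero G & forall j, tnth F j = prod_lform xs * tnth G j].
Proof.
elim: d F => [|d IH] F [hF [j0 Fj0]].
  exists [::], F, 0%N; split => // [v v0|j]; last by rewrite /prod_lform big_nil mul1r.
  rewrite lift_map_eq0; apply: contra Fj0 => /andP[e0 e1].
  have [c e] := form0 (hF j0).
  suff: meval (v 0) (tnth F j0) == 0 by rewrite e mevalC => /eqP ->; rewrite mpolyC0.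
  by move: j0 {e}; apply: forall_I2.
have [nz|] := pselect (no_common_zero F).
  exists [::], F, d.+1; split => // j; by rewrite /prod_lform big_nil mul1r.
move=> /existsNP[v /not_implyP[v0 /negP/negPn]]; rewrite lift_map_eq0 => /andP[z0 z1].
have Fv j : meval (vec (proj v) 0) (tnth F j) = 0.
  apply/eqP; rewrite (meval_form_vec (hF j) v0).
  by move: j; apply: forall_I2.
have Fq j : exists q, q \is_form d /\ tnth F j = lform (vec (proj v)) * q.
  by have [q hq e] := lform_dvd_form (hF j) (vec_neq0 _) (Fv j); exists q.
pose F' := [tuple sval (cid (Fq j)) | j < 2].
have F'E j : tnth F' j \is_form d /\ tnth F j = lform (vec (proj v)) * tnth F' j.
  by rewrite tnth_mktuple; case: cid.
have [|xs [G [e [s hG nG eG]]]] := IH F'.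
  split => [j|]; first by have [] := F'E j.
  exists j0; apply: contraNneq Fj0 => z.
  by have [_ ->] := F'E j0; rewrite z mulr0.
exists (proj v :: xs), G, e; split => //; first by rewrite -s.
by move=> j; have [_ ->] := F'E j; rewrite eG /prod_lform big_cons mulrA.
Qed.

(** If D divides both components of H G, with quotients q_j and q_k, then q_j G_k = q_k G_j;
    as G_j and G_k have no common zero, G_j divides q_j, and hence D divides H. *)
Lemma is_gcd_common_factor F xs G e : (forall j, tnth G j \is_form e) ->
  no_common_zero G -> (forall j, tnth F j = prod_lform xs * tnth G j) ->
  is_gcd F (prod_lform xs).
Proof.
move=> hG nG eF; split => [j|D hD]; first by exists (tnth G j).
have H0 := prod_lform_neq0 xs.
have [j Gj] : exists j, tnth G j != 0.
  apply: contrapT => /forallNP G0.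
  have := nG (delta_mx 0 0); rewrite lift_map_eq0.
  have Gz k : tnth G k = 0 by apply/eqP/negPn/negP/G0.
  rewrite !Gz meval0 eqxx => /(_ _)/negP; apply => //.
  by apply/eqP => /rowP/(_ 0)/eqP; rewrite !mxE oner_eq0.
pose k : 'I_2 := if j == 0 then 1 else 0.
have [qj ej] := hD j; have [qk ek] := hD k.
have D0 : D != 0.
  by apply: contraTneq (mulf_neq0 H0 Gj) => D0; rewrite -eF ej D0 mul0r eqxx.
have cross : qj * tnth G k = qk * tnth G j.
  apply: (mulfI D0); rewrite !mulrA -ej -ek !eF; ring.
have [c [ys [c0 sy ey]]] := form_factor (hG j) Gj.
have zy : {in ys, forall y, meval (vec y 0) (tnth G k) != 0}.
  move=> y yy; have : meval (vec y 0) (tnth G j) == 0 by rewrite ey -mem_zeros.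
  have := nG _ (vec_neq0 y); rewrite lift_map_eq0 /k.
  move: j {ej ek ey Gj cross k qj qk}; apply: forall_I2 => /= nz /eqP z; move: nz;
    by rewrite z eqxx ?andbT.
have [|r er] := @coprime_dvd e ys qj (c *: qk) (tnth G k) (hG k) zy.
  by rewrite cross ey -scalerAl scalerAr.
exists (c^-1 *: r).
have pj0 : prod_lform ys != 0 := prod_lform_neq0 ys.
apply: (mulIf (_ : c *: prod_lform ys != 0)); first by rewrite scaler_eq0 negb_or c0.
rewrite -ey -eF ej er ey -!scalerAr -!scalerAl scalerA divff// scale1r.
by rewrite mulrA -mulrA [_ * r]mulrC mulrA.
Qed.

Lemma gcd_associate F D E : is_gcd F D -> is_gcd F E -> D != 0 ->
  exists2 c : C, c != 0 & D = c *: E.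
Proof.
move=> [dD gD] [dE gE] D0.
have [u eu] := gD _ dE; have [w ew] := gE _ dD.
have uw : u * w = 1.
  by apply: (mulfI D0); rewrite mulr1 mulrCA -ew mulrC.
have u0 : u != 0 by apply: contra_eq_neq uw => ->; rewrite mul0r eq_sym oner_eq0.
have w0 : w != 0 by apply: contra_eq_neq uw => ->; rewrite mulr0 eq_sym oner_eq0.
have := msizeM u0 w0; rewrite uw msize1.
have := mmeasure_poly_eq0 mdeg u; have := mmeasure_poly_eq0 mdeg w.
rewrite (negbTE u0) (negbTE w0) => mw mu e.
have {}mu : (mmeasure mdeg u == 1)%N.
  by move: mw mu e; move: (mmeasure _ w) (mmeasure _ u) => a b; lia.
have [c c0 ec] := msize_poly1P _ mu.
by exists c => //; rewrite -mul_mpolyC -ec mulrC.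
Qed.

(** The common factor found by splitting off zeros is a greatest common divisor, and such
    divisors are unique up to a scalar; so the chosen divisor and the chosen quotient have the
    same form. *)
Lemma hgcd_structure d F : is_lift d F -> degenerate F ->
  exists xs c e, [/\ (size xs + e = d)%N, (0 < size xs)%N, c != 0,
    hgcd F = c *: prod_lform xs &
    [/\ forall j, tnth (reduced F) j \is_form e, no_common_zero (reduced F) &
    forall j, tnth F j = hgcd F * tnth (reduced F) j]].
Proof.
move=> hF [D [sD dD]].
have [xs [G [e [s hG nG eG]]]] := common_factor hF.
have gP := is_gcd_common_factor hG nG eG.
have gH : is_gcd F (hgcd F) by apply: (xgetPex _ (ex_intro _ _ gP)).
have [c c0 ec] := gcd_associate gP gH (prod_lform_neq0 xs).
have eH : hgcd F = c^-1 *: prod_lform xs by rewrite ec scalerA mulVf// scale1r.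
have H0 : hgcd F != 0 by rewrite eH scaler_eq0 negb_or invr_eq0 c0 prod_lform_neq0.
have eR j : tnth F j = hgcd F * tnth (reduced F) j.
  move: j; rewrite /reduced.
  apply: (@xgetPex _ F [set G : 'lift R | forall j, tnth F j = hgcd F * tnth G j]).
  exists [tuple c *: tnth G j | j < 2] => j /=.
  by rewrite eG eH tnth_mktuple -scalerAr -scalerAl scalerA divff// scale1r.
have RG j : tnth (reduced F) j = c *: tnth G j.
  apply: (mulfI H0); rewrite -eR eG eH -scalerAr -scalerAl scalerA divff//.
  by rewrite scale1r.
exists xs, c^-1, e; split => //; last split => //; rewrite ?invr_eq0//.
- have [q eq] : mdvd D (hgcd F) by case: gH => _; apply.
  move: H0 (eH); rewrite eq mulf_eq0 negb_or => /andP[D0 q0] e'.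
  have := msizeM D0 q0; rewrite e' (@msize_form R (size xs)); first last.
  + by rewrite scaler_eq0 negb_or invr_eq0 c0 prod_lform_neq0.
  + by rewrite formZ// prod_lform_homog.
  have := mmeasure_poly_eq0 mdeg q; rewrite (negbTE q0).
  by move: sD; move: (mmeasure _ q) (mmeasure _ D) => a b; lia.
- by move=> j; rewrite RG formZ.
- move=> v v0; move: (nG v v0); rewrite !lift_map_eq0 !RG !mevalZ !mulf_eq0.
  by rewrite (negbTE c0).
Qed.

End GreatestCommonDivisor.

(** * Iterates of the reduced map and the measure as a sum of point masses *)

Section Iterates.
Variable R : realType.
Local Notation C := R[i].
Implicit Types (p q : 'poly2 R) (u v w : 'C2 R) (x y z h : P1 R) (F G : 'lift R).
Local Notation "p \is_form m" := (p \is ishomog1 m mdeg) (at level 70).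

Lemma form_exp m p k : p \is_form m -> p ^+ k \is_form (m * k).
Proof. exact: dhomogMn. Qed.

Lemma comp_form e m G p : (forall j, tnth G j \is_form e) -> p \is_form m ->
  comp_mpoly G p \is_form (e * m).
Proof.
move=> hG hp; rewrite comp_mpolyEX big_seq; apply: rpred_sum => k kp.
apply: formZ; rewrite comp_mpolyX -(dhomog_mf hp kp) /= mdeg2E mulnDr.
rewrite !big_ord_recl big_ord0 mulr1; apply: formM; first exact: form_exp.
have -> : lift ord0 ord0 = 1 :> 'I_2 by apply/val_inj.
exact: form_exp.
Qed.

Lemma lift_map_comp G F v : lift_map (lift_comp F G) v = lift_map F (lift_map G v).
Proof.
apply/rowP => j; rewrite !mxE tnth_mktuple comp_mpoly_meval.
by apply: meval_eq => k; rewrite mxE.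
Qed.

Lemma lift_map_id v : lift_map (lift_id R) v = v.
Proof. by apply/rowP => j; rewrite mxE tnth_mktuple mevalXU. Qed.

Lemma lift_map_iter G n v : lift_map (lift_iter G n) v = iter n (lift_map G) v.
Proof.
elim: n => [|n IH]; first exact: lift_map_id.
by rewrite /lift_iter iterS lift_map_comp IH -iterS.
Qed.

Lemma lift_iter_form e G n : (forall j, tnth G j \is_form e) ->
  forall j, tnth (lift_iter G n) j \is_form (e ^ n).
Proof.
move=> hG; elim: n => [|n IH] j; first by rewrite tnth_mktuple dhomogX /= mdeg1.
by rewrite /lift_iter iterS tnth_mktuple expnSr; apply: comp_form.
Qed.

Lemma lift_iter_nz G n : no_common_zero G -> no_common_zero (lift_iter G n).
Proof.
by move=> nG v v0; rewrite lift_map_iter; elim: n => // n IH; rewrite iterS; exact: nG.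
Qed.

Lemma lift_mapZ e G (c : C) v : (forall j, tnth G j \is_form e) ->
  lift_map G (c *: v) = c ^+ e *: lift_map G v.
Proof. by move=> hG; apply/rowP => j; rewrite !mxE (meval_homog _ _ (hG j)). Qed.

(** The form whose zeros are the preimages by G of the point of w. *)
Definition fibre_form G w : 'poly2 R := w 0 1 *: tnth G 0 - w 0 0 *: tnth G 1.

Lemma fibre_form_homog e G w : (forall j, tnth G j \is_form e) -> fibre_form G w \is_form e.
Proof. by move=> hG; apply: rpredB; apply: rpredZ; exact: hG. Qed.

Lemma meval_fibre_form G w v : meval (v 0) (fibre_form G w) = det2 (lift_map G v) w.
Proof. by rewrite mevalB !mevalZ /det2 !mxE. Qed.

Lemma fibre_form_neq0 e G w : (forall j, tnth G j \is_form e) -> (0 < e)%N ->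
  no_common_zero G -> w != 0 -> fibre_form G w != 0.
Proof.
move=> hG e0 nG w0; apply/eqP => z.
have nz0 v : det2 (lift_map G v) w = 0 by rewrite -meval_fibre_form z meval0.
pose j : 'I_2 := if w 0 1 == 0 then 0 else 1.
have := hG j; rewrite -(prednK e0) => /form_has_zero[v v0 vj].
have [c e1] := det2_eq0 w0 (nz0 v).
have := nG _ v0; rewrite e1 scaler_eq0 negb_or w0 andbT => c0.
have : lift_map G v 0 j = 0 by rewrite mxE vj.
rewrite e1 mxE /j => /eqP; rewrite mulf_eq0 (negbTE c0) /=; case: ifPn => [/eqP w1 /eqP w2|w1]; last by rewrite (negbTE w1).
by move/eqP: w0; apply; apply: eq_row2; rewrite mxE.
Qed.

Lemma preim_exists e G w : (forall j, tnth G j \is_form e) -> (0 < e)%N ->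
  no_common_zero G -> w != 0 -> exists v (c : C), v != 0 /\ lift_map G v = c *: w.
Proof.
move=> hG e0 nG w0; have := fibre_form_homog w hG; rewrite -(prednK e0).
move=> /form_has_zero[v v0]; rewrite meval_fibre_form => /(det2_eq0 w0)[c ec].
by exists v, c.
Qed.

Lemma proj_lift_map e G u v : (forall j, tnth G j \is_form e) -> no_common_zero G ->
  u != 0 -> v != 0 -> proj u = proj v -> proj (lift_map G u) = proj (lift_map G v).
Proof.
move=> hG nG u0 v0 /(proj_eqP u0 v0)[c [c0 ->]]; rewrite (lift_mapZ _ _ hG).
by rewrite projZ ?expf_neq0// nG.
Qed.

Lemma iter_neq0 G n v : no_common_zero G -> v != 0 -> iter n (lift_map G) v != 0.
Proof. by move=> nG v0; rewrite -lift_map_iter; exact: lift_iter_nz. Qed.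

End Iterates.

Section EsumCount.
Local Open Scope ereal_scope.

Lemma mscale_apply d (T : measurableType d) (R : realType) (r : {nonneg R})
    (m : {measure set T -> \bar R}) A : mscale r m A = r%:num%:E * m A.
Proof. by []. Qed.

(** A sequence with repetitions as a set with multiplicities. *)
Lemma esum_count (R : realType) (T : choiceType) (s : seq T) (f : T -> \bar R) : (forall x, 0 <= f x) ->
  \esum_(x in [set` s]) ((count_mem x s)%:R%:E * f x) = \sum_(x <- s) f x.
Proof.
move=> f0; have -> : [set` s] = [set` undup s].
  by apply/seteqP; split => x /=; rewrite mem_undup.
rewrite esum_fset//; last by move=> x _; rewrite mule_ge0// lee_fin.
rewrite -fsbig_seq ?undup_uniq// -(big_undup_iterop_count _ s predT f).
apply: eq_bigr => x _; rewrite Monoid.iteropE; elim: (count_mem x s) => [|n IH].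
  by rewrite mul0e.
by rewrite iterS /= -IH -natr1 EFinD ge0_muleDl ?lee_fin// mul1e addeC.
Qed.

End EsumCount.

Section HolesAndPreimages.
Variable R : realType.
Local Notation C := R[i].
Implicit Types (p q : 'poly2 R) (u v w : 'C2 R) (x y z h : P1 R).
Local Notation "p \is_form m" := (p \is ishomog1 m mdeg) (at level 70).
Variables (e : nat) (F : 'lift R) (hs : seq (P1 R)) (c0 : C).
Hypotheses (nz_c0 : c0 != 0)
  (eH : hgcd F = c0 *: prod_lform hs)
  (hG : forall j, tnth (reduced F) j \is_form e) (nG : no_common_zero (reduced F)).
Local Notation G := (reduced F).

Lemma iter_phi n x : iter n (phi F) x = proj (iter n (lift_map G) (vec x)).
Proof.
elim: n => [|n IH] /=; first by rewrite vecK.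
rewrite IH /phi; have nz := iter_neq0 n nG (vec_neq0 x).
by apply: (proj_lift_map hG nG) => //; rewrite ?vec_neq0 ?vecK.
Qed.

(** In positive degree the map is onto, by preim_exists. *)
Lemma phi_constantP : phi_constant F <-> e = 0%N.
Proof.
split=> [[c hc]|e0].
  case: (posnP e) => // e0; suff : forall y, y = c.
    move=> H; have := H (proj (delta_mx 0 0)); rewrite -(H (proj (delta_mx 0 1))).
    have n0 : delta_mx 0 0 != 0 :> 'C2 R := axis_neq0 R.
    have n1 : delta_mx 0 1 != 0 :> 'C2 R.
      by apply/eqP => /rowP/(_ 1)/eqP; rewrite !mxE oner_eq0.
    move=> /(proj_eqP n0 n1)[a [a0 /rowP/(_ 0)/eqP]].
    by rewrite !mxE /= mulr0 oner_eq0.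
  move=> y; have [v [a [v0 ev]]] := preim_exists hG e0 nG (vec_neq0 y).
  have a0 : a != 0.
    by apply: contraNneq (nG v0) => a0; rewrite ev a0 scale0r.
  rewrite -(hc (proj v)) /phi.
  rewrite (@proj_lift_map _ e G (vec (proj v)) v) ?vec_neq0 ?vecK//.
  by rewrite ev projZ ?vec_neq0 ?vecK.
exists (phi F (proj 0)) => x; rewrite /phi; congr proj.
apply/rowP => j; have := hG j; rewrite e0 => /form0[a ea].
by rewrite !mxE ea !mevalC.
Qed.

Lemma preimages_of_hole n h : (0 < e)%N -> exists zs (c : C),
  [/\ c != 0, size zs = (e ^ n)%N,
   forall v, det2 (iter n (lift_map G) v) (vec h) = c * \prod_(z <- zs) det2 v (vec z),
   forall z, preim_mult F n h z = count_mem z zs &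
   [set z | iter n (phi F) z = h] = [set` zs]].
Proof.
move=> e0; have en0 : (0 < e ^ n)%N by rewrite expn_gt0 e0.
have hn := lift_iter_form n hG; have nn := lift_iter_nz n nG.
have p0 := fibre_form_neq0 hn en0 nn (vec_neq0 h).
have [c [zs [cn0 sz ep]]] := form_factor (fibre_form_homog (vec h) hn) p0.
have ev v : det2 (iter n (lift_map G) v) (vec h) = c * \prod_(z <- zs) det2 v (vec z).
  by rewrite -lift_map_iter -meval_fibre_form ep meval_factor.
exists zs, c; split => // [z|].
  by rewrite /preim_mult -/(fibre_form _ _) ep zero_mult_factor.
apply/seteqP; split => z /=; rewrite (mem_zeros zs z cn0) meval_factor -ev.
  by rewrite iter_phi => <-; rewrite det2_proj ?iter_neq0 ?vec_neq0.
by rewrite det2_proj ?iter_neq0 ?vec_neq0// -iter_phi => /eqP.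
Qed.

Local Open Scope ereal_scope.

Lemma holesE : holes F = [set` hs].
Proof. by apply/seteqP; split => x /=; rewrite (mem_zeros hs x nz_c0) -eH => /eqP. Qed.

(** H o Phi^n is the product over the holes h of the forms det2 (Phi^n v) (vec h), each of which
    splits over the n-th preimages of h. *)
Lemma hole_preimagesE n : (0 < e)%N -> exists zs (c : C),
  [/\ c != 0%R, size zs = (size hs * e ^ n)%N,
   forall v, meval (iter n (lift_map G) v 0%R) (hgcd F) = (c * \prod_(z <- zs) det2 v (vec z))%R &
   forall A : set (P1 R), hole_preimages F n A = \sum_(z <- zs) dirac (z : P1_borel R) A].
Proof.
move=> e0.
pose zs h := sval (cid (preimages_of_hole n h e0)).
pose cs h := sval (cid (svalP (cid (preimages_of_hole n h e0)))).
have P h : [/\ cs h != 0%R, size (zs h) = (e ^ n)%N,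
   forall v, det2 (iter n (lift_map G) v) (vec h) = (cs h * \prod_(z <- zs h) det2 v (vec z))%R,
   forall z, preim_mult F n h z = count_mem z (zs h) &
   [set z | iter n (phi F) z = h] = [set` zs h]].
  exact: (svalP (cid (svalP (cid (preimages_of_hole n h e0))))).
exists (flatten [seq zs h | h <- hs]), (c0 * \prod_(h <- hs) cs h)%R; split.
- rewrite mulf_neq0// prodf_seq_neq0; apply/allP => h _ /=.
  by have [] := P h.
- rewrite size_flatten /shape -map_comp (eq_map (g := fun=> (e ^ n)%N)); last first.
    by move=> h /=; have [] := P h.
  by rewrite sumnE big_map big_const_seq count_predT iter_addn_0 mulnC.
- move=> v; rewrite eH meval_factor -mulrA; congr (_ * _)%R.
  rewrite big_flatten /= big_map -big_split /=; apply: eq_bigr => h _.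
  by have [_ _ ->] := P h.
- move=> A; rewrite /hole_preimages /= /esum_measure holesE.
  rewrite big_flatten /= big_map -esum_count; last first.
    by move=> h; apply: sume_ge0 => z _; exact: measure_ge0.
  apply: eq_esum => h hh; have [_ _ _ pm pE] := P h.
  rewrite pE ge0_sume_distrr//.
  rewrite -esum_count; last by move=> z; rewrite mule_ge0// lee_fin.
  apply: eq_esum => z zz; rewrite [LHS]mscale_apply /= pm /depth eH zero_mult_factor//.
  by rewrite natrM EFinM muleCA muleA.
Qed.

Lemma hole_measure (m : P1 R -> \bar R) : (forall h, 0 <= m h) ->
  \esum_(h in holes F) ((depth F h)%:R%:E * m h) = \sum_(h <- hs) m h.
Proof.
move=> m0; rewrite holesE -esum_count//; apply: eq_esum => h _.
by rewrite /depth eH zero_mult_factor.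
Qed.

End HolesAndPreimages.

Section PotentialData.
Variable R : realType.
Local Notation C := R[i].

(** The point masses of the k-th term of mu sit at the zeros of H o Phi^k, counted with
    multiplicity: this ties the measure to the escape rate.  When the reduced map is constant,
    Phi is itself constant, as a form of degree 0, and H o Phi^k is for k > 0 the constant
    H(Phi), non-zero exactly because f is not in I(d); hence only the holes contribute. *)
Lemma degenerate_data (d : nat) (F : 'lift R) : (2 <= d)%N -> is_lift d F ->
  degenerate F -> ~ in_I F -> exists (h e : nat) (zs : nat -> seq (P1 R)) (cs : nat -> C),
  [/\ (e < d)%N /\ (forall n, size (zs n) = (h * e ^ n)%N),
   [/\ forall j, tnth (reduced F) j \is ishomog1 e mdeg, no_common_zero (reduced F),
    forall j, tnth F j = hgcd F * tnth (reduced F) j,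
    (hgcd F \is ishomog1 h mdeg) & hgcd F != 0],
   (h + e)%N = d,
   forall n, cs n != 0 /\ forall v, meval (iter n (lift_map (reduced F)) v 0) (hgcd F) =
      cs n * \prod_(z <- zs n) det2 v (vec z) &
   forall A : set (P1 R), (mu d F A =
     \sum_(0 <= n <oo) ((d%:R^-1 ^+ n.+1)%:E * \sum_(z <- zs n) dirac (z : P1_borel R) A))%E].
Proof.
move=> d2 hF dF nI.
have [hs [c0 [e [hd h0 nz eH [hG nG eF]]]]] := hgcd_structure hF dF.
have hH : hgcd F \is ishomog1 (size hs) mdeg by rewrite eH formZ// prod_lform_homog.
have H0 : hgcd F != 0 by rewrite eH scaler_eq0 negb_or nz prod_lform_neq0.
have ed : (e < d)%N by rewrite -hd; lia.
case: (posnP e) => [e0|e0].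
  have pc : phi_constant F by apply/(phi_constantP hG nG).
  pose u := lift_map (reduced F) (delta_mx 0 0).
  have uE v : lift_map (reduced F) v = u.
    apply/rowP => j; have := hG j; rewrite e0 => /form0[a ea].
    by rewrite !mxE ea !mevalC.
  have u0 : u != 0 by apply: nG; exact: axis_neq0.
  have Hu : meval (u 0) (hgcd F) != 0.
    apply/eqP => Hu; apply: nI; split => //; exists (proj u); split.
      by move=> x; rewrite /phi uE.
    by apply/eqP; rewrite /holes /= (meval_form_vec hH u0) Hu.
  exists (size hs), e, (fun n => if n is 0 then hs else [::]),
    (fun n => if n is 0 then c0 else meval (u 0) (hgcd F)).
  split => //.
  - split => // -[|n]; first by rewrite expn0 muln1.
    by rewrite e0 exp0n// muln0.
  - by move=> [|n] /=; split => // v; rewrite ?eH ?meval_factor// uE big_nil mulr1.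
  - move=> A; rewrite /mu asboolT//.
    rewrite nneseries_recl//; last first.
      by move=> n _; apply: mule_ge0; [rewrite lee_fin exprn_ge0|apply: sume_ge0 => z _; exact: measure_ge0].
    rewrite eseries0 ?adde0; last by case=> // n _ _; rewrite big_nil mule0.
    rewrite /mu_constant /= /mscale /= expr1; congr (_ * _)%E.
    by rewrite /esum_measure -(hole_measure nz eH).
pose P n := hole_preimagesE nz eH hG nG n e0.
exists (size hs), e, (fun n => sval (cid (P n))),
  (fun n => sval (cid (svalP (cid (P n))))).
have Q n : let zs := sval (cid (P n)) in let c := sval (cid (svalP (cid (P n)))) in
  [/\ c != 0, size zs = (size hs * e ^ n)%N,
   forall v, meval (iter n (lift_map (reduced F)) v 0) (hgcd F) = (c * \prod_(z <- zs) det2 v (vec z))%R &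
   forall A : set (P1 R), (hole_preimages F n A = \sum_(z <- zs) dirac (z : P1_borel R) A)%E].
  exact: (svalP (cid (svalP (cid (P n))))).
split => //.
- by split => // n; have [] := Q n.
- by move=> n; have [] := Q n.
- move=> A; rewrite /mu asboolF; last by move/(phi_constantP hG nG) => e00; move: (e0); rewrite e00.
  rewrite /mu_nonconstant /= /mseries; apply: eq_eseriesr => n _.
  by rewrite [LHS]mscale_apply /=; have [_ _ _ ->] := Q n.
Qed.

End PotentialData.

(** * Borel sets and linear substitutions in product spaces *)

Section ProductBorel.

(** A countable basis of measurable sets, a property that passes to products,
    makes the open sets of a product measurable for the product sigma-algebra. *)
Definition measurable_basis d (T : measurableType d) (nb : T -> set (set T)) : Prop :=
  exists (B : nat -> set T), (forall n, measurable (B n)) /\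
    (forall U x, nb x U -> exists n, B n x /\ B n `<=` U).

Lemma measurable_basis_open d (T : measurableType d) (nb : T -> set (set T)) (U : set T) :
  measurable_basis nb -> (forall x, U x -> nb x U) -> measurable U.
Proof.
move=> [B [mB BU]] oU.
have -> : U = \bigcup_(n in [set n | B n `<=` U]) B n.
  apply/seteqP; split => [x Ux|x [n /= BnU Bnx]]; last exact: BnU.
  by have [n [Bnx BnU]] := BU U x (oU x Ux); exists n.
by apply: bigcup_measurable => n _; exact: mB.
Qed.

Lemma measurable_basis_real (R : realType) : measurable_basis (@nbhs R R).
Proof.
pose I (p : rat * rat) : set R := `]ratr p.1, ratr p.2[%classic.
exists (fun n => if @unpickle (rat * rat)%type n is Some p then I p else set0); split.
  move=> n; case: unpickle => [p|]; last exact: measurable0.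
  exact: measurable_itv.
move=> U x /nbhs_ballP[e /= e0 xU].
have /rat_in_itvoo[a] : x - e < x by rewrite ltrBlDr ltrDl.
have /rat_in_itvoo[b] : x < x + e by rewrite ltrDl.
rewrite !in_itv /= => /andP[xb be] /andP[ea ax].
exists (pickle (a, b)); rewrite pickleK /I /=; split; first by rewrite in_itv /= ax.
move=> y /=; rewrite in_itv /= => /andP[ay yb]; apply: xU => /=.
by rewrite /ball /= ltr_distlC (lt_trans ea ay) (lt_trans yb be).
Qed.

Lemma measurable_basis_prod d1 d2 (T1 : measurableType d1) (T2 : measurableType d2)
    (nb1 : T1 -> set (set T1)) (nb2 : T2 -> set (set T2)) :
  measurable_basis nb1 -> measurable_basis nb2 ->
  measurable_basis (fun x : T1 * T2 => filter_prod (nb1 x.1) (nb2 x.2)).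
Proof.
move=> [B [mB BU]] [B' [mB' BU']].
exists (fun n => if @unpickle (nat * nat)%type n is Some p then B p.1 `*` B' p.2 else set0).
split => [n|U [x y] /= [[P Q] /= [Px Qy] PQU]].
  by case: unpickle => [p|]; [exact: measurableX|exact: measurable0].
have [m [Bm BmP]] := BU _ _ Px; have [n [Bn BnQ]] := BU' _ _ Qy.
exists (pickle (m, n)); rewrite pickleK; split => // -[a b] [/= /BmP Pa /BnQ Qb].
exact: PQU.
Qed.

Variable R : realType.

Lemma measurable_basis2 : measurable_basis (@nbhs (R * R)%type (R * R)%type).
Proof. by have := measurable_basis_prod (measurable_basis_real R) (measurable_basis_real R). Qed.

Lemma measurable_basis4 : measurable_basis (@nbhs ('R4 R) ('R4 R)).
Proof. by have := measurable_basis_prod measurable_basis2 measurable_basis2. Qed.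

Lemma open_measurable2 (U : set (R * R)) : open U -> measurable U.
Proof.
move=> oU; apply: (measurable_basis_open measurable_basis2) => x Ux.
exact: open_nbhs_nbhs.
Qed.

Lemma open_measurable4 (U : set ('R4 R)) : open U -> measurable U.
Proof.
move=> oU; apply: (measurable_basis_open measurable_basis4) => x Ux.
exact: open_nbhs_nbhs.
Qed.

Lemma continuous_measurable4 (f : 'R4 R -> R) : continuous f -> measurable_fun setT f.
Proof.
move=> /continuousP cf; apply: (measurability _ (RGenOpens.measurableE R)).
move=> _ [_ [a [b ->] <-]]; rewrite setTI; apply: open_measurable4.
exact/cf/interval_open.
Qed.

Lemma continuous_measurable2 (f : R * R -> R) : continuous f -> measurable_fun setT f.
Proof.
move=> /continuousP cf; apply: (measurability _ (RGenOpens.measurableE R)).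
move=> _ [_ [a [b ->] <-]]; rewrite setTI; apply: open_measurable2.
exact/cf/interval_open.
Qed.

Lemma compact_measurable4 (K : set ('R4 R)) : compact K -> measurable K.
Proof.
move=> cK; rewrite -[K]setCK; apply: measurableC; apply: open_measurable4.
apply: closed_openC; apply: compact_closed => //; exact: norm_hausdorff.
Qed.

End ProductBorel.

Section Scaling.
Context d (T : measurableType d) (R : realType).
Variable m : {measure set T -> \bar R}.
Local Open Scope ereal_scope.

(** The constant c is the inverse of the Jacobian: f multiplies volumes by c^-1.  The condition
    on non-negative functions is the one that Tonelli carries to products. *)
Definition scales (f : T -> T) (c : R) : Prop :=
  [/\ measurable_fun setT f, (0 < c)%R & forall g : T -> \bar R, measurable_fun setT g ->
    (forall x, 0 <= g x) -> \int[m]_x g (f x) = c%:E * \int[m]_x g x].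

Lemma scales_comp f g a b : scales f a -> scales g b -> scales (f \o g) (b * a)%R.
Proof.
move=> [mf a0 fE] [mg b0 gE]; split; [exact: measurableT_comp|exact: mulr_gt0|].
move=> h mh h0; rewrite /= (gE (h \o f))//=; last exact: measurableT_comp.
by rewrite fE// EFinM muleA.
Qed.

Lemma integral_scales f c g : scales f c -> m.-integrable setT g ->
  m.-integrable setT (g \o f) /\ \int[m]_x g (f x) = c%:E * \int[m]_x g x.
Proof.
move=> [mf c0 fE] ig; have mg := measurable_int _ ig.
have igf : m.-integrable setT (g \o f).
  apply/integrableP; split; first exact: measurableT_comp.
  rewrite (fE (fun x => `|g x|))//; last exact: measurableT_comp.
  have /integrableP[_ lg] := ig.
  by rewrite lte_mul_pinfty// lee_fin ltW.
split => //; rewrite -[RHS]integralZl//.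
rewrite [LHS]integralE [RHS]integralE; congr (_ - _).
- have -> : \int[m]_x (fun x => g (f x))^\+ x = \int[m]_x (g ^\+) (f x).
    by transitivity (\int[m]_x (g \o f)^\+ x) => //; rewrite funepos_comp.
  have mg' : measurable_fun setT (g ^\+) by exact: measurable_funepos.
  rewrite (fE (g ^\+))//.
  by rewrite ge0_funeposM ?ltW// ge0_integralZl ?lee_fin ?ltW.
- have -> : \int[m]_x (fun x => g (f x))^\- x = \int[m]_x (g ^\-) (f x).
    by transitivity (\int[m]_x (g \o f)^\- x) => //; rewrite funeneg_comp.
  have mg' : measurable_fun setT (g ^\-) by exact: measurable_funeneg.
  rewrite (fE (g ^\-))//.
  by rewrite ge0_funenegM ?ltW// ge0_integralZl ?lee_fin ?ltW.
Qed.

Lemma scales_null f c A : scales f c -> measurable A -> m A = 0 -> m (f @^-1` A) = 0.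
Proof.
move=> [mf c0 fE] mA A0.
have mfA : measurable (f @^-1` A) by rewrite -[X in measurable X]setTI; exact: mf.
rewrite -[f @^-1` A]setIT -integral_indic// (_ : \int[m]_x _ = \int[m]_x ((\1_A (f x))%:E)).
  rewrite (fE (fun x => (\1_A x)%:E))//; first by rewrite integral_indic// setIT A0 mule0.
  exact/measurable_EFinP.
by apply: eq_integral.
Qed.

End Scaling.

Section ScalingProduct.
Context d1 d2 (T1 : measurableType d1) (T2 : measurableType d2) (R : realType).
Variables (m1 : {sigma_finite_measure set T1 -> \bar R})
  (m2 : {sigma_finite_measure set T2 -> \bar R}).
Local Open Scope ereal_scope.

Lemma scales_prod1 (f : T1 -> T2 -> T1) c :
  measurable_fun setT (fun x : T1 * T2 => f x.1 x.2) ->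
  (forall y, scales m1 (f^~ y) c) -> (0 < c)%R ->
  scales (m1 \x m2) (fun x => (f x.1 x.2, x.2)) c.
Proof.
move=> mf fE c0.
have mT : measurable_fun setT (fun x : T1 * T2 => (f x.1 x.2, x.2)).
  by apply: measurable_fun_pair => //; exact: measurable_snd.
split => // g mg g0; rewrite fubini_tonelli2//=; last exact: (measurableT_comp mg mT).
rewrite /fubini_G /= fubini_tonelli2// -ge0_integralZl//; last 3 first.
- exact: measurable_fun_fubini_tonelli_G.
- by move=> y _; exact: integral_ge0.
- by rewrite lee_fin ltW.
apply: eq_integral => y _; have [_ _ fy] := fE y.
by rewrite (fy (fun x => g (x, y)))//; exact: measurableT_comp.
Qed.

Lemma scales_prod2 (f : T1 -> T2 -> T2) c :
  measurable_fun setT (fun x : T1 * T2 => f x.1 x.2) ->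
  (forall x, scales m2 (f x) c) -> (0 < c)%R ->
  scales (m1 \x m2) (fun x => (x.1, f x.1 x.2)) c.
Proof.
move=> mf fE c0.
have mT : measurable_fun setT (fun x : T1 * T2 => (x.1, f x.1 x.2)).
  by apply: measurable_fun_pair => //; exact: measurable_fst.
split => // g mg g0; rewrite fubini_tonelli1//=; last exact: (measurableT_comp mg mT).
rewrite /fubini_F /= fubini_tonelli1// -ge0_integralZl//; last 3 first.
- exact: measurable_fun_fubini_tonelli_F.
- by move=> y _; exact: integral_ge0.
- by rewrite lee_fin ltW.
apply: eq_integral => x _; have [_ _ fy] := fE x.
by rewrite (fy (fun y => g (x, y)))//; exact: measurableT_comp.
Qed.

End ScalingProduct.

Lemma scales_swap d (T : measurableType d) (R : realType)
    (m : {sigma_finite_measure set T -> \bar R}) :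
  scales (m \x m)%E (fun x => (x.2, x.1)) 1.
Proof.
have mT : measurable_fun setT (fun x : T * T => (x.2, x.1)) by exact: measurable_swap.
split => // g mg g0; rewrite mul1e fubini_tonelli1//=; last exact: (measurableT_comp mg mT).
by rewrite fubini_tonelli2.
Qed.

(** * Lebesgue measure on the line, the plane and the space C^2 *)

Section LebesgueLine.
Variable R : realType.
Local Notation leb := (@lebesgue_measure R).
Local Open Scope ereal_scope.

(** Lebesgue measure lives on a copy of the reals carrying its own display;
    [lebR] is the same set function on the reals themselves. *)
Definition lebR : set R -> \bar R := leb.

Let lebR0 : lebR set0 = 0. Proof. exact: (@measure0 _ _ _ leb). Qed.
Let lebR_ge0 A : 0 <= lebR A. Proof. exact: (@measure_ge0 _ _ _ leb). Qed.
Let lebR_additive : semi_sigma_additive lebR.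
Proof. exact: (@measure_semi_sigma_additive _ _ _ leb). Qed.

HB.instance Definition _ := isMeasure.Build _ _ _ lebR lebR0 lebR_ge0 lebR_additive.

Let lebR_sigma_finite : sigma_finite setT lebR.
Proof. exact: (@sigma_finiteT _ _ _ leb). Qed.

HB.instance Definition _ := Measure_isSigmaFinite.Build _ _ _ lebR lebR_sigma_finite.

Lemma lebR_integralE (D : set R) (g : R -> \bar R) : measurable D ->
  measurable_fun D g -> (forall x, D x -> 0 <= g x) ->
  \int[lebR]_(x in D) g x = \int[leb]_(x in D) g x.
Proof.
move=> mD mg g0.
pose idR : measurableTypeR R -> R := idfun.
have mid : measurable_fun setT idR by move=> _ Y mY; rewrite setTI.
have := @ge0_integral_pushforward _ _ _ _ R idR mid leb D g mD mg.
by apply=> y; rewrite inE; exact: g0.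
Qed.

End LebesgueLine.

Section AffineScaling.
Variable R : realType.
Local Notation leb := (@lebesgue_measure R).
Local Open Scope ereal_scope.

(** The left side is a measure of A that agrees with Lebesgue measure on intervals. *)
Lemma leb_affine (a b : R) : (a != 0)%R -> forall A : set R, measurable A ->
  `|a|%:E * leb ((fun x => a * x + b)%R @^-1` A) = leb A.
Proof.
move=> a0 A mA.
have mf : measurable_fun setT (fun x : R => a * x + b)%R.
  by apply: measurable_funD => //; exact: measurable_funM.
pose af : measurableTypeR R -> measurableTypeR R := (fun x => a * x + b)%R.
have mf' : measurable_fun setT af := mf.
pose mu : {measure set (measurableTypeR R) -> \bar R} :=
  mscale (NngNum (normr_ge0 a)) (pushforward leb af).
symmetry; apply: (@lebesgue_measure_unique R (mu mf')) => // X [[x y] /= xy <-].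
rewrite /mu /= /mscale /= /pushforward.
have -> : af @^-1` `]x, y]%classic = (if (0 < a)%R then `]((x - b) / a)%R, ((y - b) / a)%R]%classic
   else `[((y - b) / a)%R, ((x - b) / a)%R[%classic).
  apply/seteqP; case: ltP => a1; split => z /=; rewrite !in_itv /= /af.
  - by rewrite ltr_pdivrMr// ler_pdivlMr// ltrBlDr lerBrDr [(z * a)%R]mulrC.
  - by rewrite ltr_pdivrMr// ler_pdivlMr// ltrBlDr lerBrDr [(z * a)%R]mulrC.
  - have {}a1 : (a < 0)%R by rewrite lt_neqAle a0.
    by rewrite ler_ndivrMr// ltr_ndivlMr// ltrBlDr lerBrDr [(z * a)%R]mulrC andbC.
  - have {}a1 : (a < 0)%R by rewrite lt_neqAle a0.
    by rewrite ler_ndivrMr// ltr_ndivlMr// ltrBlDr lerBrDr [(z * a)%R]mulrC andbC.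
case: ltP => a1; rewrite !lebesgue_measure_itv /= !lte_fin.
- rewrite ltr_pM2r ?invr_gt0// ltrD2r gtr0_norm//; case: ifP => _; last by rewrite mule0.
  by rewrite -!EFinB -EFinM; congr EFin; field.
- have {}a1 : (a < 0)%R by rewrite lt_neqAle a0.
  rewrite ltr_nM2r ?invr_lt0// ltrD2r ltr0_norm//; case: ifP => _; last by rewrite mule0.
  by rewrite -!EFinB -EFinM; congr EFin; field.
Qed.

Lemma scales_affine (a b : R) : (a != 0)%R ->
  scales (@lebR R) (fun x => a * x + b)%R `|a|^-1.
Proof.
move=> a0; have na0 : (0 < `|a|)%R by rewrite normr_gt0.
have mf : measurable_fun setT (fun x : R => a * x + b)%R.
  by apply: measurable_funD => //; exact: measurable_funM.
split => //; first by rewrite invr_gt0.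
move=> g mg g0.
have k0 : (0 <= `|a|^-1)%R by rewrite invr_ge0 ltW.
rewrite -(@ge0_integral_mscale _ _ R (@lebR R) setT measurableT (NngNum k0) g)//.
have -> : \int[@lebR R]_x g (a * x + b)%R =
   \int[pushforward (@lebR R) (fun x : R => a * x + b)%R]_y g y.
  by rewrite ge0_integral_pushforward.
pose mu : {measure set R -> \bar R} := pushforward (@lebR R) (fun x : R => (a * x + b)%R).
apply: (@eq_measure_integral _ _ R setT (mscale (NngNum k0) (@lebR R)) (mu mf)) => A mA _.
rewrite /mu /= /pushforward /= /mscale /=.
rewrite -[lebR A](leb_affine b a0 mA).
by rewrite muleA -EFinM mulVf ?mul1e// gt_eqF.
Qed.

Lemma scales_affine_ext (f : R -> R) (a b : R) : (a != 0)%R -> (forall x, f x = a * x + b)%R ->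
  scales (@lebR R) f `|a|^-1.
Proof. by move=> a0 fE; rewrite (_ : f = fun x => a * x + b)%R; [exact: scales_affine|exact/funext]. Qed.

End AffineScaling.

Section SquareMeasure.

Lemma product_sigma_finite d1 d2 (T1 : measurableType d1) (T2 : measurableType d2)
    (R : realType)
    (m1 : {sigma_finite_measure set T1 -> \bar R})
    (m2 : {sigma_finite_measure set T2 -> \bar R}) :
  sigma_finite setT (m1 \x m2)%E.
Proof.
have [F TF Foo] := sigma_finiteT m1; have [G TG Goo] := sigma_finiteT m2.
exists (fun n => if @unpickle (nat * nat)%type n is Some p then F p.1 `*` G p.2 else set0).
  apply/seteqP; split => // -[x y] _.
  have [m _ Fx] : (\bigcup_i F i) x by rewrite -TF.
  have [n _ Gy] : (\bigcup_i G i) y by rewrite -TG.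
  by exists (pickle (m, n)) => //; rewrite pickleK.
move=> n; case: unpickle => [[i j] /=|]; last by rewrite measure0 ltry; split.
have [mF Fi] := Foo i; have [mG Gj] := Goo j.
split; first exact: measurableX.
by rewrite product_measure1E// lte_mul_pinfty// ge0_fin_numE.
Qed.

Context d (T : measurableType d) (R : realType).
Variable m : {sigma_finite_measure set T -> \bar R}.

(** A copy of the product measure, on which the structure of sigma-finite measure can be
    declared; it is needed to form products of products. *)
Definition square_measure : set (T * T) -> \bar R := (m \x m)%E.
HB.instance Definition _ := Measure.copy square_measure (m \x m)%E.
HB.instance Definition _ := Measure_isSigmaFinite.Build _ _ _ square_measure
  (product_sigma_finite m m).

End SquareMeasure.

Section PlaneScaling.
Variable R : realType.
Local Notation leb := (@lebesgue_measure R).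

Definition plane : {sigma_finite_measure set (R * R)%type -> \bar R} :=
  square_measure (@lebR R).
Definition space : {sigma_finite_measure set ('R4 R) -> \bar R} := square_measure plane.

Section leb2_measure.
Local Open Scope ereal_scope.

Let m2 : {sigma_finite_measure set (measurableTypeR R * measurableTypeR R)%type -> \bar R} :=
  square_measure leb.

Let leb2_0 : @leb2 R set0 = 0. Proof. exact: (@measure0 _ _ _ m2). Qed.
Let leb2_ge0 A : 0 <= @leb2 R A. Proof. exact: (@measure_ge0 _ _ _ m2). Qed.
Let leb2_additive : semi_sigma_additive (@leb2 R).
Proof. exact: (@measure_semi_sigma_additive _ _ _ m2). Qed.

HB.instance Definition _ := isMeasure.Build _ _ _ (@leb2 R) leb2_0 leb2_ge0 leb2_additive.

(** The measures leb2 and leb4 are built on the copy of the reals that carries Lebesgue measure;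
    by uniqueness of the product measure they agree with the products of lebR. *)
Lemma leb2E A : measurable A -> @leb2 R A = plane A.
Proof.
move=> mA; apply/esym.
apply: (@product_measure_unique _ _ _ _ R (@lebR R) (@lebR R) (@leb2 R)) => // B C mB mC.
exact: (@product_measure1E _ _ _ _ R leb leb B C mB mC).
Qed.

Let m4 : {measure set _ -> \bar R} := square_measure m2.

Let leb4_0 : @leb4 R set0 = 0. Proof. exact: (@measure0 _ _ _ m4). Qed.
Let leb4_ge0 A : 0 <= @leb4 R A. Proof. exact: (@measure_ge0 _ _ _ m4). Qed.
Let leb4_additive : semi_sigma_additive (@leb4 R).
Proof. exact: (@measure_semi_sigma_additive _ _ _ m4). Qed.

HB.instance Definition _ := isMeasure.Build _ _ _ (@leb4 R) leb4_0 leb4_ge0 leb4_additive.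

Lemma leb4E A : measurable A -> @leb4 R A = space A.
Proof.
move=> mA; apply/esym.
apply: (@product_measure_unique _ _ _ _ R plane plane (@leb4 R)) => // B C mB mC.
rewrite -!leb2E//.
exact: (@product_measure1E _ _ _ _ R m2 m2 B C mB mC).
Qed.

Lemma integral_leb2 D f : \int[@leb2 R]_(x in D) f x = \int[plane]_(x in D) f x.
Proof. by apply: eq_measure_integral => A mA _; exact: leb2E. Qed.

Lemma integral_leb4 D f : \int[@leb4 R]_(x in D) f x = \int[space]_(x in D) f x.
Proof. by apply: eq_measure_integral => A mA _; exact: leb4E. Qed.

Lemma integrable_leb4 D f : (@leb4 R).-integrable D f <-> space.-integrable D f.
Proof. by split => /integrableP[? ?]; apply/integrableP; split => //; rewrite ?integral_leb4// -integral_leb4. Qed.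

End leb2_measure.

Lemma scales_ext d (T : measurableType d) (m : {measure set T -> \bar R}) (f g : T -> T) (a b : R) :
  f =1 g -> a = b -> scales m f a -> scales m g b.
Proof. by move=> /funext -> ->. Qed.

Let cfst : continuous (fun x : R * R => x.1). Proof. by move=> x; exact: cvg_fst. Qed.
Let csnd : continuous (fun x : R * R => x.2). Proof. by move=> x; exact: cvg_snd. Qed.

Lemma measurable_plane_affine (a b c : R) :
  measurable_fun setT (fun x : R * R => a * x.1 + b * x.2 + c).
Proof.
apply: continuous_measurable2 => x; apply: cvgD; last exact: cvg_cst.
by apply: cvgD; apply: cvgM; [exact: cvg_cst|exact: cfst|exact: cvg_cst|exact: csnd].
Qed.

(** A complex affine map of the line is a composite of two real shears with dilation if a <> 0,
    and involves a swap of the two real coordinates if a = 0. *)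
Lemma scales_complex (a b c1 c2 : R) : a ^+ 2 + b ^+ 2 != 0 ->
  scales plane (fun x => (a * x.1 - b * x.2 + c1, b * x.1 + a * x.2 + c2))
    (a ^+ 2 + b ^+ 2)^-1.
Proof.
move=> n0; have n1 : 0 < a ^+ 2 + b ^+ 2.
  by rewrite lt_neqAle eq_sym n0 addr_ge0 ?sqr_ge0.
have S1 (p q c : R) : p != 0 -> scales plane (fun x => (p * x.1 + q * x.2 + c, x.2)) `|p|^-1.
  move=> p0; apply: (@scales_prod1 _ _ _ _ R (@lebR R) (@lebR R) (fun x y => p * x + q * y + c)).
  - exact: measurable_plane_affine.
  - by move=> y; apply: (@scales_affine_ext _ _ p (q * y + c)) => // x; rewrite addrA.
  - by rewrite invr_gt0 normr_gt0.
have S2 (p q c : R) : p != 0 -> scales plane (fun x => (x.1, q * x.1 + p * x.2 + c)) `|p|^-1.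
  move=> p0; apply: (@scales_prod2 _ _ _ _ R (@lebR R) (@lebR R) (fun x y => q * x + p * y + c)).
  - exact: measurable_plane_affine.
  - by move=> x; apply: (@scales_affine_ext _ _ p (q * x + c)) => // y; ring.
  - by rewrite invr_gt0 normr_gt0.
have [a0|a0] := eqVneq a 0.
  have b0 : b != 0.
    by apply: contraNneq n0 => b0; rewrite a0 b0 expr0n addr0.
  have := scales_comp (S2 b 0 c2 b0) (scales_comp (S1 (- b) 0 c1 _) (scales_swap (@lebR R))).
  rewrite oppr_eq0 => /(_ b0); apply: scales_ext => [x /=|]; first by congr pair; rewrite a0; ring.
  by rewrite mul1r normrN a0 expr0n add0r -invfM -normrM ger0_norm// -expr2 sqr_ge0.
have := scales_comp (S2 ((a ^+ 2 + b ^+ 2) / a) (b / a) (c2 - b / a * c1) _) (S1 a (- b) c1 a0).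
rewrite mulf_neq0 ?invr_eq0// => /(_ isT); apply: scales_ext => [x /=|].
  by congr pair; field.
rewrite normf_div [`|a ^+ 2 + _|]ger0_norm ?ltW//; field.
by rewrite n0 normr_eq0.
Qed.

Lemma scales_translation2 (c : R * R) : scales plane (fun x => x + c) 1.
Proof.
have := @scales_complex 1 0 c.1 c.2; rewrite expr1n expr0n addr0 invr1.
move=> /(_ (oner_neq0 _)); apply: scales_ext => // x.
by case: c => c1 c2; case: x => x1 x2; congr pair; ring.
Qed.

Lemma scales_homothety2 (r : R) (c : R * R) : r != 0 ->
  scales plane (fun x => r *: x + c) (r ^+ 2)^-1.
Proof.
move=> r0; have := @scales_complex r 0 c.1 c.2; rewrite expr0n addr0 expf_neq0// => /(_ isT).
apply: scales_ext => // x.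
by case: c => c1 c2; case: x => x1 x2; congr pair; rewrite mul0r ?subr0 ?add0r.
Qed.

Lemma continuous_measurable42 (f : 'R4 R -> R * R) : continuous f -> measurable_fun setT f.
Proof.
rewrite (_ : f = fun x => ((f x).1, (f x).2)); last by apply/funext => x; case: (f x).
move=> cf; apply: measurable_fun_pair; apply: continuous_measurable4 => x.
  exact: (continuous_comp (cf x) (@cfst _)).
exact: (continuous_comp (cf x) (@csnd _)).
Qed.

Lemma scales_translation4 (u : 'R4 R) : scales space (fun x => x + u) 1.
Proof.
have S1 : scales space (fun x => (x.1 + u.1, x.2)) 1.
  apply: (@scales_prod1 _ _ _ _ R plane plane (fun x y => x + u.1)) => //.
  - apply: continuous_measurable42 => x; apply: cvgD; last exact: cvg_cst.
    exact: cvg_fst.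
  - by move=> _; exact: scales_translation2.
have S2 : scales space (fun x => (x.1, x.2 + u.2)) 1.
  apply: (@scales_prod2 _ _ _ _ R plane plane (fun x y => y + u.2)) => //.
  - apply: continuous_measurable42 => x; apply: cvgD; last exact: cvg_cst.
    exact: cvg_snd.
  - by move=> _; exact: scales_translation2.
have := scales_comp S2 S1; by apply: scales_ext; rewrite ?mulr1// => x.
Qed.

(** The substitution straightening the complex line z_0 = s(z_1) and blowing
    up its normal direction by 1/r. *)
Lemma scales_shear (s : R * R -> R * R) (r : R) : continuous s -> r != 0 ->
  scales space (fun x => (r *: x.1 + s x.2, x.2)) (r ^+ 2)^-1.
Proof.
move=> cs r0; apply: (@scales_prod1 _ _ _ _ R plane plane (fun x y => r *: x + s y)).
- apply: continuous_measurable42 => x; apply: cvgD.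
    by apply: cvgZr; exact: cvg_fst.
  by apply: cvg_comp; [exact: cvg_snd|exact: cs].
- by move=> y; exact: scales_homothety2.
- by rewrite invr_gt0 exprn_even_gt0.
Qed.

Lemma scales_swap4 : scales space (fun x => (x.2, x.1)) 1.
Proof. exact: scales_swap. Qed.

End PlaneScaling.

(** * Smooth functions and integration by parts *)

Section DirectionalDerivatives.
Context {R : realType} {V : normedModType R}.
Implicit Types (f g : V -> R) (x v : V).

Lemma is_derive_lin f g x v df dg a b : is_derive x v f df -> is_derive x v g dg ->
  is_derive x v (fun y => a * f y + b * g y) (a * df + b * dg).
Proof. by move=> hf hg; exact: (is_deriveD (is_deriveZ a hf) (is_deriveZ b hg)). Qed.

Lemma is_derive_mul f g x v df dg : is_derive x v f df -> is_derive x v g dg ->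
  is_derive x v (fun y => f y * g y) (f x * dg + g x * df).
Proof. by move=> hf hg; exact: (is_deriveM hf hg). Qed.

(** Directional derivatives are derivatives of functions of one variable, to which the chain
    rule applies. *)
Lemma is_derive_line f x v df :
  is_derive (0 : R) 1 (fun t => f (t *: v + x)) df -> is_derive x v f df.
Proof.
move=> [d1 e1]; have dv : derivable f x v by apply/derivable1P.
apply: DeriveDef => //; rewrite -e1 /derive.
congr (lim (_ @ 0^')); apply/funext => h /=.
by rewrite scale0r add0r addr0 [_%:A]mulr1.
Qed.

End DirectionalDerivatives.

Section AlongLines.
Context {R : realType} {V : normedModType R}.
Implicit Types (f g : V -> R) (x v : V).

Lemma line_is_derive f (x v : V) (t : R) : derivable f (t *: v + x) v ->
  is_derive t 1 (fun t => f (t *: v + x)) ('D_v f (t *: v + x)).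
Proof.
move=> hf; have d2 := (derivable1P f (t *: v + x) v).1 hf.
have E : (fun h : R => f (h *: v + (t *: v + x))) = (fun s : R => f ((s *: (1 : R) + t) *: v + x)).
  by apply/funext => s; rewrite addrA -scalerDl [_%:A]mulr1.
have [e1 e2] : is_derive (0 : R) 1 (fun h : R => f (h *: v + (t *: v + x))) ('D_v f (t *: v + x)).
  apply: DeriveDef => //; rewrite /derive; congr (lim (_ @ 0^')); apply/funext => h /=.
  by rewrite scale0r add0r addr0 [_%:A]mulr1.
have := @is_derive_line _ _ (fun t : R => f (t *: v + x)) t 1 ('D_v f (t *: v + x)).
by rewrite -E; apply; exact: DeriveDef.
Qed.

End AlongLines.

Section SmoothFunctions.
Variable R : realType.
Implicit Types (f g : 'R4 R -> R) (u x : 'R4 R).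

Definition iterD (us : seq ('R4 R)) f := foldr (fun u g x => 'D_u g x) f us.

Lemma smooth_continuous f : smooth f -> continuous f.
Proof. by move=> /(_ [::])[]. Qed.

Lemma smooth_derivable f x u : smooth f -> derivable f x u.
Proof. by move=> /(_ [::])[_]; apply. Qed.

Lemma smoothD f u : smooth f -> smooth (fun x => 'D_u f x).
Proof. by move=> sf us; have := sf (rcons us u); rewrite foldr_rcons. Qed.

Lemma smooth_lin a b f g : smooth f -> smooth g -> smooth (fun x => a * f x + b * g x).
Proof.
move=> sf sg us /=.
have E : iterD us (fun x => a * f x + b * g x) =
    (fun x => a * iterD us f x + b * iterD us g x).
  elim: us => // u us IH; rewrite /iterD /= -!/(iterD us _) IH; apply/funext => x.
  have df := derivableP ((sf us).2 x u); have dg := derivableP ((sg us).2 x u).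
  by have [_ ->] := is_derive_lin a b df dg.
rewrite -/(iterD us _) E; split => [x|x u].
  by apply: cvgD; apply: cvgM; [exact: cvg_cst|exact: (sf us).1|exact: cvg_cst|exact: (sg us).1].
have df := derivableP ((sf us).2 x u); have dg := derivableP ((sg us).2 x u).
by have [] := is_derive_lin a b df dg.
Qed.

Lemma smooth_cst0 : smooth (fun _ : 'R4 R => 0).
Proof.
move=> us /=; rewrite -/(iterD us _).
have -> : iterD us (fun=> 0) = cst 0.
  elim: us => // u us IH; rewrite /iterD /= -/(iterD us _) IH; apply/funext => x.
  exact: derive_cst.
split => [x|x u]; [exact: cvg_cst|exact: derivable_cst].
Qed.

Definition vanishes_off (K : set ('R4 R)) f := forall x, ~ K x -> f x = 0.

Lemma vanishes_offD K f u : closed K -> vanishes_off K f ->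
  vanishes_off K (fun x => 'D_u f x).
Proof.
move=> cK fK x Kx; rewrite (@near_eq_derive _ _ _ f (cst 0) x u) ?derive_cst//.
have : nbhs x (~` K) by apply: open_nbhs_nbhs; split => //; exact: closed_openC.
by apply: filterS => y; exact: fK.
Qed.

Lemma compact_bounded4 (K : set ('R4 R)) : compact K -> exists r : R, 0 < r /\ K `<=` [set x | `|x| <= r].
Proof.
move=> cK; have [M [_ KM]] := compact_bounded cK.
exists (Num.max 1 (M + 1)); split; first by rewrite lt_max ltr01.
by move=> x Kx /=; rewrite le_max (KM (M + 1)) ?orbT// ltrDl.
Qed.

Lemma continuous_cpt_bounded (K : set ('R4 R)) f : compact K -> continuous f ->
  vanishes_off K f -> exists2 M : R, 0 < M & forall x, `|f x| <= M.
Proof.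
move=> cK cf fK.
have cfK : compact (f @` K).
  by apply: continuous_compact => //; exact: continuous_subspaceT.
have [M [_ KM]] := compact_bounded cfK.
exists (Num.max 1 (M + 1)); first by rewrite lt_max ltr01.
move=> x; have [Kx|/fK ->] := pselect (K x); last by rewrite normr0 le_max ler01.
by rewrite le_max (KM (M + 1)) ?orbT ?ltrDl//; exists x.
Qed.

End SmoothFunctions.

Section CompactlySupportedIntegrals.
Variable R : realType.
Implicit Types (f g : 'R4 R -> R) (u x : 'R4 R) (r : R).

(** The norm being the supremum of the four coordinates, this is a product of intervals. *)
Definition box r : set ('R4 R) := [set x | `|x| <= r].

Lemma box_measurable r : measurable (box r).
Proof.
rewrite (_ : box r = (fun x : 'R4 R => `|x|) @^-1` `]-oo, r]%classic).
  rewrite -[X in measurable X]setTI; apply: continuous_measurable4 => //.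
  exact: norm_continuous.
by apply/seteqP; split => x /=; rewrite in_itv.
Qed.

Definition square r : set (R * R) := `[- r, r]%classic `*` `[- r, r]%classic.

Lemma boxE r : box r = square r `*` square r.
Proof.
have E (a b : R) : (`|(a, b)| <= r) = (- r <= a <= r) && (- r <= b <= r).
  by rewrite prod_normE /= ge_max !ler_norml.
have E2 (a b : R * R) : (`|(a, b)| <= r) = (`|a| <= r) && (`|b| <= r).
  by rewrite prod_normE /= ge_max.
apply/seteqP; split => -[[a b] [c d]] /=; rewrite /box /square /= E2 !E !in_itv /=.
  by move=> /andP[/andP[-> ->] /andP[-> ->]].
by move=> [[-> ->] [-> ->]].
Qed.

Lemma measurable_square r : measurable (square r).
Proof. by apply: measurableX; exact: measurable_itv. Qed.

Local Open Scope ereal_scope.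

Lemma lebR_itv (i : interval R) :
  @lebR R [set` i] = if i.1 < i.2 then (i.2 : \bar R) - i.1 else 0.
Proof. exact: lebesgue_measure_itv. Qed.

Lemma plane_square r : plane R (square r) < +oo.
Proof.
rewrite /plane /= /square_measure product_measure1E; [|exact: measurable_itv..].
have H : @lebR R [set` `[(- r)%R, r]] < +oo.
  by rewrite lebR_itv /=; case: ifP => // _; rewrite -EFinB ltry.
by apply: lte_mul_pinfty => //; rewrite ge0_fin_numE.
Qed.

Lemma space_box r : space R (box r) < +oo.
Proof.
rewrite boxE /space /= /square_measure product_measure1E; [|exact: measurable_square..].
by apply: lte_mul_pinfty => //; [rewrite ge0_fin_numE ?plane_square|exact: plane_square].
Qed.

Lemma integrable_box_indic r (M : R) :
  (space R).-integrable setT (fun x => (M * \1_(box r) x)%:E).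
Proof.
rewrite (_ : (fun x => _) = (fun x => M%:E * (\1_(box r) x)%:E)); last first.
  by apply/funext => x; rewrite EFinM.
apply: integrableZl => //; apply/integrableP; split.
  by apply/measurable_EFinP; apply: measurable_indic; exact: box_measurable.
rewrite (eq_integral (fun x => (\1_(box r) x)%:E)) => [|x _]; last by rewrite gee0_abs ?lee_fin.
by have mb := box_measurable r; rewrite integral_indic// setIT; exact: space_box.
Qed.

Lemma integrable_box_bounded (f : 'R4 R -> \bar R) r (M : R) : measurable_fun setT f ->
  (forall x, `|f x| <= (M * \1_(box r) x)%:E) -> (space R).-integrable setT f.
Proof.
move=> mf fM; apply: (le_integrable measurableT mf _ (integrable_box_indic r M)) => x _.
by rewrite (le_trans (fM x))// lee_fin ler_norm.
Qed.

Lemma bounded_box f r (M : R) : (forall x, `|f x| <= M)%R -> vanishes_off (box r) f ->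
  forall x, (`|f x| <= M * \1_(box r) x)%R.
Proof.
move=> fM f0 x; rewrite indicE; case: (boolP (x \in box r)); rewrite ?mulr1// notin_setE.
by move=> /f0 ->; rewrite normr0 mulr0.
Qed.

Lemma integrable_cpt f (K : set ('R4 R)) : compact K -> continuous f -> vanishes_off K f ->
  (space R).-integrable setT (EFin \o f).
Proof.
move=> cK cf fK; have [r [r0 Kr]] := compact_bounded4 cK.
have [M M0 fM] := continuous_cpt_bounded cK cf fK.
apply: (@integrable_box_bounded _ r M).
  by apply/measurable_EFinP; exact: continuous_measurable4.
move=> x; rewrite lee_fin; apply: bounded_box => // y yr; apply: fK.
by move=> /Kr.
Qed.

(** Difference quotients integrate to zero by translation invariance, and they
    converge boundedly. *)
Lemma integral_derive0 f u (K : set ('R4 R)) : compact K -> vanishes_off K f ->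
  continuous f -> (forall x, derivable f x u) -> continuous (fun x => 'D_u f x) ->
  \int[space R]_x ('D_u f x)%:E = 0.
Proof.
move=> cK fK cf df cdf.
have clK : closed K by apply: compact_closed => //; exact: norm_hausdorff.
have dfK := vanishes_offD u clK fK.
have [r [r0 Kr]] := compact_bounded4 cK.
have [M M0 dM] := continuous_cpt_bounded cK cdf dfK.
pose s (n : nat) : R := n.+1%:R^-1%R.
have s0 n : (0 < s n)%R by rewrite invr_gt0.
have s1 n : (s n <= 1)%R by rewrite invf_le1// ler1n.
pose q n x := ((s n)^-1 * (f (s n *: u + x) - f x))%R.
have ifu n : (space R).-integrable setT (fun x => (f (s n *: u + x))%:E) /\
    \int[space R]_x (f (s n *: u + x))%:E = \int[space R]_x (f x)%:E.
  have := integral_scales (scales_translation4 (s n *: u)) (integrable_cpt cK cf fK).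
  rewrite mul1e => -[i1 i2]; rewrite -i2; split; last first.
    by apply: eq_integral => x _; rewrite /= addrC.
  by apply: eq_integrable i1 => // x _ /=; rewrite addrC.
have q0 n : \int[space R]_x (q n x)%:E = 0.
  rewrite (eq_integral (fun x => ((s n)^-1)%:E * ((f (s n *: u + x))%:E - (f x)%:E))); last first.
    by move=> x _; rewrite -EFinB -EFinM.
  have [i1 i2] := ifu n; have i3 := integrable_cpt cK cf fK.
  rewrite integralZl//; last exact: integrableB.
  rewrite integralB// i2 subee ?mule0//.
  exact: integrable_fin_num.
have qM n x : (`|q n x| <= M)%R.
  have cl (t : R) : {for t, continuous (fun t : R => f (t *: u + x)%R)}.
    apply: (@continuous_comp _ _ _ (fun t : R => t *: u + x)%R f); last exact: cf.
    apply: cvgD; last exact: cvg_cst.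
    by apply: cvgZl; exact: cvg_id.
  have [c _ E] := @MVT_segment R (fun t => f (t *: u + x)%R) (fun t => 'D_u f (t *: u + x))%R 0 (s n)
    (ltW (s0 n)) (fun t _ => line_is_derive (df _)) (continuous_subspaceT cl).
  rewrite /q; move: E; rewrite scale0r add0r subr0 => ->.
  by rewrite mulrC -mulrA divff ?mulr1// gt_eqF.
have mq n : measurable_fun setT (fun x => (q n x)%:E).
  apply/measurable_EFinP; apply: continuous_measurable4 => x.
  apply: cvgM; first exact: cvg_cst.
  apply: cvgB; last exact: cf.
  apply: (@continuous_comp _ _ _ (fun x => s n *: u + x)%R f); last exact: cf.
  by apply: cvgD; [exact: cvg_cst|exact: cvg_id].
have q_cvg x : (q n x)%:E @[n --> \oo] --> ('D_u f x)%:E.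
  apply: cvg_EFin; first by near=> n.
  rewrite (_ : fine \o _ = q^~ x)//.
  have D : (h^-1 *: ((f \o shift x) (h *: u) - f x))%R @[h --> (0 : R)%R^'] --> 'D_u f x.
    exact: df.
  have S : s @ \oo --> (0 : R)%R^'.
    move=> P; rewrite /= /dnbhs /within /= => hP.
    have s_cvg : s n @[n --> \oo] --> (0 : R)%R by exact: cvg_harmonic.
    have H : \forall n \near \oo, (s n != 0)%R -> P (s n) := s_cvg _ hP.
    suff: \forall n \near \oo, P (s n) by [].
    by apply: filterS H => n; apply; rewrite gt_eqF.
  exact: (cvg_comp s _ S D).
have mD : measurable_fun setT (fun x => ('D_u f x)%:E).
  by apply/measurable_EFinP; exact: continuous_measurable4.
have qB n x : (`|q n x| <= M * \1_(box (r + `|u|)) x)%R.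
  apply: bounded_box => // y /= yb; rewrite /q fK; first last.
    move=> /Kr /= yr; apply: yb; rewrite /box /=.
    have -> : y = ((s n *: u + y) - s n *: u)%R by rewrite addrC addKr.
    apply: (le_trans (ler_normB _ _)); apply: lerD => //.
    by rewrite normrZ gtr0_norm// ler_piMl.
  rewrite fK ?subrr ?mulr0// => /Kr /= yr; apply: yb.
  by rewrite /box /= (le_trans yr)// lerDl.
have [_ _ qlim] := @dominated_convergence _ _ R (space R) setT measurableT
  (fun n x => (q n x)%:E) (fun x => ('D_u f x)%:E)
  (fun x => (M * \1_(box (r + `|u|)) x)%:E) mq mD (aeW _ (fun x _ => q_cvg x))
  (integrable_box_indic _ M) (aeW _ (fun x n _ => qB n x)).
apply: cvg_unique qlim _; first exact: ereal_hausdorff.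
rewrite (_ : [sequence _]_n = cst 0); first exact: cvg_cst.
by apply/funext => n; exact: q0.
Unshelve. all: by end_near. Qed.

End CompactlySupportedIntegrals.

Section IntegrationByParts.
Variable R : realType.
Implicit Types (f g : 'R4 R -> R) (u x : 'R4 R) (K : set ('R4 R)).

Lemma vanishes_offM K f g : vanishes_off K g -> vanishes_off K (fun x => f x * g x).
Proof. by move=> gK x Kx; rewrite gK// mulr0. Qed.

Lemma continuousM4 f g : continuous f -> continuous g -> continuous (fun x => f x * g x).
Proof. by move=> cf cg x; apply: cvgM; [exact: cf|exact: cg]. Qed.

Lemma integration_by_parts4 K f (df : 'R4 R -> R) g u : compact K -> vanishes_off K g ->
  continuous f -> continuous df -> (forall x, is_derive x u f (df x)) ->
  continuous g -> (forall x, derivable g x u) -> continuous (fun x => 'D_u g x) ->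
  \int[space R]_x (f x * 'D_u g x) = - \int[space R]_x (df x * g x).
Proof.
move=> cK gK cf cdf fdf cg dg cdg.
have clK : closed K by apply: compact_closed => //; exact: norm_hausdorff.
have dE x : 'D_u (fun x => f x * g x) x = f x * 'D_u g x + df x * g x.
  by have [_ ->] := is_derive_mul (fdf x) (derivableP (dg x)); rewrite [g x * _]mulrC.
have cD : continuous (fun x => 'D_u (fun x => f x * g x) x).
  have -> : (fun x => 'D_u (fun x => f x * g x) x) = (fun x => f x * 'D_u g x + df x * g x).
    exact/funext.
  by move=> x; apply: cvgD; apply: cvgM; (exact: cf || exact: cdg || exact: cdf || exact: cg).
have := @integral_derive0 R (fun x => f x * g x) u K cK (@vanishes_offM K f g gK) (continuousM4 cf cg)
  (fun x => let: DeriveDef d1 _ := is_derive_mul (fdf x) (derivableP (dg x)) in d1) cD.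
have i1 : (space R).-integrable setT (EFin \o (fun x => f x * 'D_u g x)).
  by apply: (integrable_cpt cK); [exact: continuousM4|apply: vanishes_offM; exact: vanishes_offD].
have i2 : (space R).-integrable setT (EFin \o (fun x => df x * g x)).
  by apply: (integrable_cpt cK); [exact: continuousM4|exact: vanishes_offM].
move=> H; apply/eqP; rewrite -subr_eq0 opprK -RintegralD// /Rintegral.
by under eq_integral do rewrite -dE; rewrite H.
Qed.

End IntegrationByParts.

(** * The regularized logarithm of a linear form *)

Section RegularizedLogarithm.
Variable R : realType.
Variables (v : 'C2 R) (e : R).
Hypothesis e0 : 0 < e.
Implicit Types (u x t : 'R4 R) (K : set ('R4 R)) (g : 'R4 R -> R).

Definition re_form x : R := complex.Re (det2 (toC2 x) v).
Definition im_form x : R := complex.Im (det2 (toC2 x) v).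
Local Notation al := re_form.
Local Notation be := im_form.

Lemma re_formE x : al x = complex.Re (v 0 1) * x.1.1 - complex.Im (v 0 1) * x.1.2
  - complex.Re (v 0 0) * x.2.1 + complex.Im (v 0 0) * x.2.2.
Proof.
rewrite /al /det2 !mxE /=; case: (v 0 1) => a b; case: (v 0 0) => c d /=.
by simpc => /=; ring.
Qed.

Lemma im_formE x : be x = complex.Re (v 0 1) * x.1.2 + complex.Im (v 0 1) * x.1.1
  - complex.Re (v 0 0) * x.2.2 - complex.Im (v 0 0) * x.2.1.
Proof.
rewrite /be /det2 !mxE /=; case: (v 0 1) => a b; case: (v 0 0) => c d /=.
by simpc => /=; ring.
Qed.

(** reg_log is log (|L|^2 + e^2) / 2 for the linear form L = det2 x v; reg_log1 u and
    reg_log2 u t are its directional derivatives, which are explicit since L is real-linear. *)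
Definition reg_sq x : R := al x ^+ 2 + be x ^+ 2 + e ^+ 2.
Definition reg_log x : R := ln (reg_sq x) / 2.
Definition reg_log1 u x : R := (al x * al u + be x * be u) * (reg_sq x)^-1.
Definition reg_log2 u t x : R := (al t * al u + be t * be u) * (reg_sq x)^-1 -
  2 * (al x * al u + be x * be u) * (al x * al t + be x * be t) * (reg_sq x)^-1 ^+ 2.

Lemma reg_sq_gt0 x : 0 < reg_sq x.
Proof. by rewrite ltr_wpDl ?exprn_gt0// addr_ge0 ?sqr_ge0. Qed.

Lemma continuous_coord11 : continuous (fun x => x.1.1).
Proof. by move=> x; apply: (@cvg_comp _ _ _ fst fst); [exact: cvg_fst|exact: cvg_fst]. Qed.
Lemma continuous_coord12 : continuous (fun x => x.1.2).
Proof. by move=> x; apply: (@cvg_comp _ _ _ fst snd); [exact: cvg_fst|exact: cvg_snd]. Qed.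
Lemma continuous_coord21 : continuous (fun x => x.2.1).
Proof. by move=> x; apply: (@cvg_comp _ _ _ snd fst); [exact: cvg_snd|exact: cvg_fst]. Qed.
Lemma continuous_coord22 : continuous (fun x => x.2.2).
Proof. by move=> x; apply: (@cvg_comp _ _ _ snd snd); [exact: cvg_snd|exact: cvg_snd]. Qed.

Lemma continuous_linear4 (a b c d : R) :
  continuous (fun x : 'R4 R => a * x.1.1 + b * x.1.2 + c * x.2.1 + d * x.2.2).
Proof.
move=> x; apply: cvgD; first apply: cvgD; first apply: cvgD; apply: cvgM; try exact: cvg_cst.
- exact: continuous_coord11.
- exact: continuous_coord12.
- exact: continuous_coord21.
- exact: continuous_coord22.
Qed.

Lemma continuous_re_form : continuous al.
Proof.
rewrite (_ : al = fun x => complex.Re (v 0 1) * x.1.1 + (- complex.Im (v 0 1)) * x.1.2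
  + (- complex.Re (v 0 0)) * x.2.1 + complex.Im (v 0 0) * x.2.2).
  exact: continuous_linear4.
by apply/funext => x; rewrite re_formE; ring.
Qed.

Lemma continuous_im_form : continuous be.
Proof.
rewrite (_ : be = fun x => complex.Im (v 0 1) * x.1.1 + (complex.Re (v 0 1)) * x.1.2
  + (- complex.Im (v 0 0)) * x.2.1 + (- complex.Re (v 0 0)) * x.2.2).
  exact: continuous_linear4.
by apply/funext => x; rewrite im_formE; ring.
Qed.

Lemma re_form_line (s : R) u x : al (s *: u + x) = s * al u + 1 * al x.
Proof. by move: u x => [[? ?] [? ?]] [[? ?] [? ?]]; rewrite !re_formE /= /GRing.scale /=; ring. Qed.

Lemma im_form_line (s : R) u x : be (s *: u + x) = s * be u + 1 * be x.
Proof. by move: u x => [[? ?] [? ?]] [[? ?] [? ?]]; rewrite !im_formE /= /GRing.scale /=; ring. Qed.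

Lemma is_derive_re_form x u : is_derive x u al (al u).
Proof.
apply: is_derive_line.
have -> : (fun t : R => al (t *: u + x)) = (fun s : R => al u * s + 1 * al x).
  by apply/funext => s; rewrite re_form_line mulrC.
have := @is_derive_lin R _ _ _ (0 : R) 1 _ _ (al u) 1 (is_derive_id (0 : R) 1) (is_derive_cst (al x) (0 : R) 1).
by rewrite mulr1 mulr0 addr0.
Qed.

Lemma is_derive_im_form x u : is_derive x u be (be u).
Proof.
apply: is_derive_line.
have -> : (fun t : R => be (t *: u + x)) = (fun s : R => be u * s + 1 * be x).
  by apply/funext => s; rewrite im_form_line mulrC.
have := @is_derive_lin R _ _ _ (0 : R) 1 _ _ (be u) 1 (is_derive_id (0 : R) 1) (is_derive_cst (be x) (0 : R) 1).
by rewrite mulr1 mulr0 addr0.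
Qed.

Lemma is_derive_reg_sq x u : is_derive x u reg_sq (2 * (al x * al u + be x * be u)).
Proof.
have h1 := is_derive_mul (is_derive_re_form x u) (is_derive_re_form x u).
have h2 := is_derive_mul (is_derive_im_form x u) (is_derive_im_form x u).
have h3 := is_derive_lin 1 1 (is_derive_lin 1 1 h1 h2) (is_derive_cst (e ^+ 2) x u).
have E : reg_sq = (fun y => 1 * (1 * (al y * al y) + 1 * (be y * be y)) + 1 * cst (e ^+ 2) y).
  by apply/funext => y; rewrite /reg_sq /=; ring.
rewrite E; apply: (is_derive_eq h3); rewrite /=; ring.
Qed.

Lemma is_derive_reg_log x u : is_derive x u reg_log (reg_log1 u x).
Proof.
apply: is_derive_line.
have x0 : 0 *: u + x = x by rewrite scale0r add0r.
have dq := is_derive_reg_sq (0 *: u + x) u.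
have [d1 d2] := dq; have := line_is_derive (t := 0) d1; rewrite d2 => hq.
have hl := @is_derive1_ln R (reg_sq (0 *: u + x)) (reg_sq_gt0 _).
have hc := @is_derive1_comp R (@ln R) (fun t : R => reg_sq (t *: u + x)) 0 _ _ hl hq.
have := is_derive_mul hc (is_derive_cst (2^-1 : R) (0 : R) 1).
rewrite mulr0 add0r x0 (_ : _ * _ = reg_log1 u x)//.
by rewrite /reg_log1 /cst; field; rewrite gt_eqF ?reg_sq_gt0.
Qed.

Lemma is_derive_reg_log1 x u t : is_derive x t (reg_log1 u) (reg_log2 u t x).
Proof.
have q0 : reg_sq x != 0 by rewrite gt_eqF ?reg_sq_gt0.
have dq := is_derive_reg_sq x t.
have h1 := is_derive_lin (al u) (be u) (is_derive_re_form x t) (is_derive_im_form x t).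
have h2 : is_derive x t (fun y => (reg_sq y)^-1) (- (reg_sq x)^-1 ^+ 2 * (2 * (al x * al t + be x * be t))).
  have [d1 d2] := dq; apply: DeriveDef; first exact: derivableV.
  by rewrite deriveV// d2 exprVn.
have := is_derive_mul h1 h2.
rewrite (_ : (fun y => _) = reg_log1 u); last first.
  by apply/funext => y; rewrite /reg_log1 [al u * _]mulrC [be u * _]mulrC.
by rewrite (_ : _ + _ = reg_log2 u t x)// /reg_log2; ring.
Qed.

Lemma continuous_reg_sq : continuous reg_sq.
Proof.
move=> x; apply: cvgD; last exact: cvg_cst.
apply: cvgD; apply: cvgM; (exact: continuous_re_form || exact: continuous_im_form).
Qed.

Lemma continuous_inv_reg_sq : continuous (fun x => (reg_sq x)^-1).
Proof. by move=> x; apply: cvgV; [rewrite gt_eqF ?reg_sq_gt0|exact: continuous_reg_sq]. Qed.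

Lemma continuous_pairing u : continuous (fun x => al x * al u + be x * be u).
Proof.
move=> x; apply: cvgD; apply: cvgM; (exact: cvg_cst || exact: continuous_re_form ||
  exact: continuous_im_form).
Qed.

Lemma continuous_reg_log : continuous reg_log.
Proof.
move=> x; apply: cvgM; last exact: cvg_cst.
apply: (@continuous_comp _ _ _ reg_sq (@ln R)); first exact: continuous_reg_sq.
by apply: continuous_ln; exact: reg_sq_gt0.
Qed.

Lemma continuous_reg_log1 u : continuous (reg_log1 u).
Proof. by move=> x; apply: cvgM; [exact: continuous_pairing|exact: continuous_inv_reg_sq]. Qed.

Lemma continuous_reg_log2 u t : continuous (reg_log2 u t).
Proof.
move=> x; apply: cvgB; first by apply: cvgM; [exact: cvg_cst|exact: continuous_inv_reg_sq].
apply: cvgM; last by apply: cvgM; exact: continuous_inv_reg_sq.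
apply: cvgM; last exact: continuous_pairing.
by apply: cvgM; [exact: cvg_cst|exact: continuous_pairing].
Qed.

(** Two integrations by parts move both derivatives onto the logarithm. *)
Lemma reg_log_ibp K g u t : compact K -> vanishes_off K g -> smooth g ->
  \int[space R]_x (reg_log x * 'D_u (fun y => 'D_t g y) x) =
  \int[space R]_x (reg_log2 u t x * g x).
Proof.
move=> cK gK sg.
have clK : closed K by apply: compact_closed => //; exact: norm_hausdorff.
have sD := smoothD t sg.
have h1 := @integration_by_parts4 R K reg_log (reg_log1 u) (fun y => 'D_t g y) u cK
  (vanishes_offD t clK gK) continuous_reg_log (@continuous_reg_log1 u)
  (fun x => is_derive_reg_log x u) (smooth_continuous sD)
  (fun x => @smooth_derivable R _ x u sD) (smooth_continuous (smoothD u sD)).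
have h2 := @integration_by_parts4 R K (reg_log1 u) (reg_log2 u t) g t cK
  gK (@continuous_reg_log1 u) (@continuous_reg_log2 u t)
  (fun x => is_derive_reg_log1 x u t) (smooth_continuous sg)
  (fun x => @smooth_derivable R _ x t sg) (smooth_continuous sD).
by rewrite h1 h2 opprK.
Qed.

End RegularizedLogarithm.

(** * Complex-valued functions *)

Section ComplexValued.
Variable R : realType.
Local Notation C := R[i].
Implicit Types (a b : C) (f g : 'R4 R -> C) (u x : 'R4 R) (K : set ('R4 R)).

Lemma ReD a b : complex.Re (a + b) = complex.Re a + complex.Re b.
Proof. by case: a b => [? ?] [? ?]. Qed.
Lemma ImD a b : complex.Im (a + b) = complex.Im a + complex.Im b.
Proof. by case: a b => [? ?] [? ?]. Qed.
Lemma ReM a b : complex.Re (a * b) = complex.Re a * complex.Re b - complex.Im a * complex.Im b.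
Proof. by case: a b => [? ?] [? ?]. Qed.
Lemma ImM a b : complex.Im (a * b) = complex.Re a * complex.Im b + complex.Im a * complex.Re b.
Proof. by case: a b => [? ?] [? ?]. Qed.
Lemma complex_eq a b : complex.Re a = complex.Re b -> complex.Im a = complex.Im b -> a = b.
Proof. by case: a b => [? ?] [? ?] /= -> ->. Qed.

Definition csmooth f := smooth (fun x => complex.Re (f x)) /\ smooth (fun x => complex.Im (f x)).

Definition cvanishes K f := forall x, ~ K x -> f x = 0.

Definition ccpt f := [/\ continuous (fun x => complex.Re (f x)), continuous (fun x => complex.Im (f x))
  & exists2 K, compact K & cvanishes K f].

Lemma csmooth_lin a f g : csmooth f -> csmooth g -> csmooth (fun x => a * f x + g x).
Proof.
move=> [rf jf] [rg jg]; split.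
  rewrite (_ : (fun x => _) = fun x => 1 * (complex.Re a * complex.Re (f x) +
     (- complex.Im a) * complex.Im (f x)) + 1 * complex.Re (g x)); last first.
    by apply/funext => x; rewrite ReD ReM; ring.
  exact: (@smooth_lin R 1 1 _ _ (@smooth_lin R _ _ _ _ rf jf) rg).
rewrite (_ : (fun x => _) = fun x => 1 * (complex.Im a * complex.Re (f x) +
   complex.Re a * complex.Im (f x)) + 1 * complex.Im (g x)); last first.
  by apply/funext => x; rewrite ImD ImM; ring.
exact: (@smooth_lin R 1 1 _ _ (@smooth_lin R _ _ _ _ rf jf) jg).
Qed.

Lemma csmooth0 : csmooth (fun=> 0).
Proof. by split; exact: smooth_cst0. Qed.

Lemma csmooth_sum (I : Type) (r : seq I) (c : I -> C) (f : I -> 'R4 R -> C) :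
  (forall i, csmooth (f i)) -> csmooth (fun x => \sum_(i <- r) c i * f i x).
Proof.
move=> sf; elim: r => [|i r IH].
  by rewrite (_ : (fun x => _) = (fun=> 0)); [exact: csmooth0|apply/funext => x; rewrite big_nil].
rewrite (_ : (fun x => _) = (fun x => c i * f i x + \sum_(i <- r) c i * f i x)).
  exact: csmooth_lin.
by apply/funext => x; rewrite big_cons.
Qed.

Lemma cderive_lin a f g u x : csmooth f -> csmooth g ->
  cderive u (fun x => a * f x + g x) x = a * cderive u f x + cderive u g x.
Proof.
move=> [rf jf] [rg jg]; rewrite /cderive.
have drf := derivableP (@smooth_derivable R _ x u rf).
have djf := derivableP (@smooth_derivable R _ x u jf).
have drg := derivableP (@smooth_derivable R _ x u rg).
have djg := derivableP (@smooth_derivable R _ x u jg).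
rewrite (_ : (fun x => complex.Re _) = fun x => 1 * (complex.Re a * complex.Re (f x) +
   (- complex.Im a) * complex.Im (f x)) + 1 * complex.Re (g x)); last first.
  by apply/funext => y; rewrite ReD ReM; ring.
rewrite (_ : (fun x => complex.Im _) = fun x => 1 * (complex.Im a * complex.Re (f x) +
   complex.Re a * complex.Im (f x)) + 1 * complex.Im (g x)); last first.
  by apply/funext => y; rewrite ImD ImM; ring.
have [_ ->] := is_derive_lin 1 1 (is_derive_lin (complex.Re a) (- complex.Im a) drf djf) drg.
have [_ ->] := is_derive_lin 1 1 (is_derive_lin (complex.Im a) (complex.Re a) drf djf) djg.
by apply: complex_eq; rewrite ?ReD ?ImD ?ReM ?ImM /=; ring.
Qed.

Lemma cderive_sum (I : Type) (r : seq I) (c : I -> C) (f : I -> 'R4 R -> C) u x :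
  (forall i, csmooth (f i)) ->
  cderive u (fun x => \sum_(i <- r) c i * f i x) x = \sum_(i <- r) c i * cderive u (f i) x.
Proof.
move=> sf; elim: r => [|i r IH].
  rewrite big_nil /cderive.
  rewrite (_ : (fun y => complex.Re _) = cst 0); last by apply/funext => y; rewrite big_nil.
  rewrite (_ : (fun y => complex.Im _) = cst 0); last by apply/funext => y; rewrite big_nil.
  by rewrite derive_cst.
have E : (fun x => \sum_(i <- i :: r) c i * f i x) = (fun x => c i * f i x + \sum_(i <- r) c i * f i x).
  by apply/funext => y; rewrite big_cons.
rewrite E big_cons -IH; apply: cderive_lin; [exact: sf|exact: csmooth_sum].
Qed.

Lemma csmoothD f u : csmooth f -> csmooth (cderive u f).
Proof. by move=> [rf jf]; split; exact: smoothD. Qed.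

Lemma cvanishesD K f u : compact K -> cvanishes K f -> cvanishes K (cderive u f).
Proof.
move=> cK fK x Kx; rewrite /cderive.
have clK : closed K by apply: compact_closed => //; exact: norm_hausdorff.
rewrite (@vanishes_offD R K _ u clK _ x Kx) => [|y Ky]; last by rewrite fK.
by rewrite (@vanishes_offD R K _ u clK _ x Kx) => [|y Ky]; last by rewrite fK.
Qed.

Lemma csmooth_ccpt K f : compact K -> cvanishes K f -> csmooth f -> ccpt f.
Proof.
by move=> cK fK [rf jf]; split; [exact: smooth_continuous|exact: smooth_continuous|exists K].
Qed.

Definition cR f : C := (\int[space R]_x complex.Re (f x)) +i* (\int[space R]_x complex.Im (f x)).

Lemma ccpt_integrable f : ccpt f ->
  (space R).-integrable setT (fun x => (complex.Re (f x))%:E) /\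
  (space R).-integrable setT (fun x => (complex.Im (f x))%:E).
Proof.
move=> [rf jf [K cK fK]]; split.
  by apply: (@integrable_cpt _ (fun x => complex.Re (f x)) K) => // x /fK ->.
by apply: (@integrable_cpt _ (fun x => complex.Im (f x)) K) => // x /fK ->.
Qed.

Definition cintegrable f :=
  (space R).-integrable setT (fun x => (complex.Re (f x))%:E) /\
  (space R).-integrable setT (fun x => (complex.Im (f x))%:E).

Lemma Rintegral_lin (a b : R) (f g : 'R4 R -> R) :
  (space R).-integrable setT (EFin \o f) -> (space R).-integrable setT (EFin \o g) ->
  (space R).-integrable setT (fun x => (a * f x + b * g x)%:E) /\
  \int[space R]_x (a * f x + b * g x) = a * \int[space R]_x f x + b * \int[space R]_x g x.
Proof.
move=> jf ig.
have ja : (space R).-integrable setT (EFin \o (fun x => a * f x)).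
  rewrite (_ : EFin \o _ = (fun x => (a%:E * (f x)%:E)%E)); first exact: integrableZl.
  by apply/funext => x.
have jb : (space R).-integrable setT (EFin \o (fun x => b * g x)).
  rewrite (_ : EFin \o _ = (fun x => (b%:E * (g x)%:E)%E)); first exact: integrableZl.
  by apply/funext => x.
split; last by rewrite RintegralD// !RintegralZl.
rewrite (_ : (fun x => _) = (fun x => (a * f x)%:E + (b * g x)%:E)%E); first exact: integrableD.
by apply/funext => x.
Qed.

Lemma cR_lin a f g : cintegrable f -> cintegrable g ->
  cintegrable (fun x => a * f x + g x) /\ cR (fun x => a * f x + g x) = a * cR f + cR g.
Proof.
move=> [rf jf] [rg jg]; rewrite /cintegrable /cR.
rewrite (_ : (fun x => (complex.Re _)%:E) = fun x => (1 * (complex.Re a * complex.Re (f x) +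
   (- complex.Im a) * complex.Im (f x)) + 1 * complex.Re (g x))%:E); last first.
  by apply/funext => y; rewrite ReD ReM; congr EFin; ring.
rewrite (_ : (fun x => (complex.Im _)%:E) = fun x => (1 * (complex.Im a * complex.Re (f x) +
   complex.Re a * complex.Im (f x)) + 1 * complex.Im (g x))%:E); last first.
  by apply/funext => y; rewrite ImD ImM; congr EFin; ring.
have [h1 h2] := Rintegral_lin (complex.Re a) (- complex.Im a) rf jf.
have [h3 h4] := Rintegral_lin (complex.Im a) (complex.Re a) rf jf.
have [h5 h6] := Rintegral_lin 1 1 h1 rg.
have [h7 h8] := Rintegral_lin 1 1 h3 jg.
split=> //.
have E1 : (fun x => complex.Re (a * f x + g x)) = fun x => 1 * (complex.Re a * complex.Re (f x) +
   (- complex.Im a) * complex.Im (f x)) + 1 * complex.Re (g x).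
  by apply/funext => y; rewrite ReD ReM; ring.
have E2 : (fun x => complex.Im (a * f x + g x)) = fun x => 1 * (complex.Im a * complex.Re (f x) +
   complex.Re a * complex.Im (f x)) + 1 * complex.Im (g x).
  by apply/funext => y; rewrite ImD ImM; ring.
rewrite E1 E2 h6 h8 h2 h4.
by apply: complex_eq; rewrite ?ReD ?ImD ?ReM ?ImM /=; ring.
Qed.

Lemma cR_sum (I : Type) (r : seq I) (c : I -> C) (f : I -> 'R4 R -> C) :
  (forall i, cintegrable (f i)) ->
  cintegrable (fun x => \sum_(i <- r) c i * f i x) /\
  cR (fun x => \sum_(i <- r) c i * f i x) = \sum_(i <- r) c i * cR (f i).
Proof.
move=> sf; elim: r => [|i r [IH1 IH2]].
  rewrite (_ : (fun x => _) = (fun=> 0)); last by apply/funext => x; rewrite big_nil.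
  split; first by split; exact: integrable0.
  by rewrite big_nil /cR !Rintegral_cst//= !mul0r.
have [h1 h2] := cR_lin (c i) (sf i) IH1.
rewrite (_ : (fun x => _) = (fun x => c i * f i x + \sum_(i <- r) c i * f i x)); last first.
  by apply/funext => x; rewrite big_cons.
by rewrite big_cons h2 IH2.
Qed.

Lemma cR_derive0 K f u : compact K -> cvanishes K f -> csmooth f -> cR (cderive u f) = 0.
Proof.
move=> cK fK [rf jf]; rewrite /cR /cderive /=.
have H (g : 'R4 R -> R) : smooth g -> vanishes_off K g -> \int[space R]_x 'D_u g x = 0.
  move=> sg gK; rewrite /Rintegral (@integral_derive0 R g u K)//.
  - exact: smooth_continuous.
  - by move=> x; exact: smooth_derivable.
  - exact: (smooth_continuous (smoothD u sg)).
by rewrite !H// => x /fK ->.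
Qed.

Lemma ccptM (q : 'R4 R -> R) f : continuous q -> ccpt f -> ccpt (fun x => (q x)%:C * f x).
Proof.
move=> cq [rf jf [K cK fK]]; split; last by exists K => // x /fK ->; rewrite mulr0.
  rewrite (_ : (fun x => _) = (fun x => q x * complex.Re (f x))).
    by move=> x; apply: cvgM; [exact: cq|exact: rf].
  by apply/funext => x; rewrite ReM /= mul0r subr0.
rewrite (_ : (fun x => _) = (fun x => q x * complex.Im (f x))).
  by move=> x; apply: cvgM; [exact: cq|exact: jf].
by apply/funext => x; rewrite ImM /= mul0r addr0.
Qed.

Lemma cR_reg_log K (v : 'C2 R) (e : R) f u t : 0 < e -> compact K -> cvanishes K f -> csmooth f ->
  cR (fun x => (reg_log v e x)%:C * cderive u (cderive t f) x) =
  cR (fun x => (reg_log2 v e u t x)%:C * f x).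
Proof.
move=> e0 cK fK [rf jf]; rewrite /cR.
have E (q : 'R4 R -> R) (h : 'R4 R -> C) :
    (fun x => complex.Re ((q x)%:C * h x)) = (fun x => q x * complex.Re (h x)) /\
    (fun x => complex.Im ((q x)%:C * h x)) = (fun x => q x * complex.Im (h x)).
  by split; apply/funext => x; rewrite ?ReM ?ImM /= mul0r ?subr0 ?addr0.
have [-> ->] := E (reg_log v e) (cderive u (cderive t f)).
have [-> ->] := E (reg_log2 v e u t) f.
rewrite /cderive /=.
congr (_ +i* _).
  by apply: (@reg_log_ibp R v e e0 K _ u t cK _ rf) => x /fK ->.
by apply: (@reg_log_ibp R v e e0 K _ u t cK _ jf) => x /fK ->.
Qed.

End ComplexValued.

(** * The operator dd^c against the regularized logarithm *)

Lemma half_sub (K : fieldType) (A B I h : K) : (A - I * B) * h = - I * h * B + h * A.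
Proof. by ring. Qed.

Section Kernel.
Variable R : realType.
Local Notation C := R[i].
Implicit Types (f g : 'R4 R -> C) (x : 'R4 R) (K : set ('R4 R)) (w : diff_form R) (j l : 'I_(2 + 2)).

(** The four derivations d/dz_k, d/dconj z_k are combinations of real directional derivatives:
    zvec j b and zcoef j b are the directions and coefficients for zeta_j, with b = false for the
    x-direction and b = true for the y-direction. *)
Definition zvec j (b : bool) : 'R4 R :=
  let k := match fintype.split j with inl k => k | inr k => k end in if b then e_y R k else e_x R k.

Definition zcoef j (b : bool) : C :=
  if b then (if fintype.split j is inl _ then - 'i%C / 2%:R else 'i%C / 2%:R) else 2%:R^-1.

(** The four derivations dual to the forms dzeta_j. *)
Definition dzeta j f x : C := \sum_(b : bool) zcoef j b * cderive (zvec j b) f x.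

Lemma split_l (k : 'I_2) : fintype.split (lshift 2 k) = inl k :> 'I_2 + 'I_2.
Proof. exact: (unsplitK (inl k)). Qed.

Lemma split_r (k : 'I_2) : fintype.split (rshift 2 k) = inr k :> 'I_2 + 'I_2.
Proof. exact: (unsplitK (inr k)). Qed.

Lemma dz_dzeta (k : 'I_2) f : dz k f = dzeta (lshift 2 k) f.
Proof.
apply/funext => x; rewrite /dz /dzeta big_bool /zcoef /zvec split_l /=.
exact: half_sub.
Qed.

Lemma dzbar_dzeta (k : 'I_2) f : dzbar k f = dzeta (rshift 2 k) f.
Proof.
apply/funext => x; rewrite /dzbar /dzeta big_bool /zcoef /zvec split_r /=.
by rewrite -[X in _ + X * _]opprK mulNr half_sub opprK.
Qed.

(** The sign of dzeta_j /\ dzeta_(J minus j) with respect to dzeta_J. *)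
Definition wsign j (J : {set 'I_(2 + 2)}) : C :=
  if j \in J then (-1) ^+ #|[set i in J | (i < j)%N]%SET| else 0.

(** In d^c the holomorphic derivations occur with a minus sign. *)
Definition dcsign l : C := if fintype.split l is inl _ then -1 else 1.

Lemma dformE w J x : dform w J x = \sum_j wsign j J * dzeta j (w (J :\ j)%SET) x.
Proof.
rewrite /dform /del /delbar big_split_ord /=; congr (_ + _); apply: eq_bigr => k _;
  by rewrite /wedge1 /wsign; case: ifP; rewrite ?mul0r// ?dz_dzeta ?dzbar_dzeta.
Qed.

Lemma dcformE w J x : dcform w J x =
  \sum_l ('i%C / (2%:R * (pi : R)%:C) * dcsign l * wsign l J) * dzeta l (w (J :\ l)%SET) x.
Proof.
rewrite big_split_ord /= /dcform /del /delbar.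
have E1 k : wedge1 (lshift 2 k) (fun I => dz k (w I)) J x =
    wsign (lshift 2 k) J * dzeta (lshift 2 k) (w (J :\ lshift 2 k)%SET) x.
  by rewrite /wedge1 /wsign; case: ifP; rewrite ?mul0r// dz_dzeta.
have E2 k : wedge1 (rshift 2 k) (fun I => dzbar k (w I)) J x =
    wsign (rshift 2 k) J * dzeta (rshift 2 k) (w (J :\ rshift 2 k)%SET) x.
  by rewrite /wedge1 /wsign; case: ifP; rewrite ?mul0r// dzbar_dzeta.
rewrite (eq_bigr _ (fun k _ => E2 k)) (eq_bigr _ (fun k _ => E1 k)).
rewrite mulrAC mulrBr addrC -mulrN -sumrN !big_distrr /=.
congr (_ + _); apply: eq_bigr => k _; rewrite /dcsign ?split_l ?split_r.
  by rewrite mulr1 mulrA.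
by rewrite mulrN1 !mulNr mulrN mulrA.
Qed.

Lemma csmooth_dzeta j f : csmooth f -> csmooth (dzeta j f).
Proof. by move=> sf; apply: csmooth_sum => b; exact: csmoothD. Qed.

Lemma cvanishes_dzeta K j f : compact K -> cvanishes K f -> cvanishes K (dzeta j f).
Proof.
by move=> cK fK x Kx; rewrite /dzeta big1// => b _; rewrite (cvanishesD _ cK fK)// mulr0.
Qed.

Lemma dzeta_sum (I : Type) (r : seq I) (c : I -> C) (f : I -> 'R4 R -> C) j x :
  (forall i, csmooth (f i)) ->
  dzeta j (fun x => \sum_(i <- r) c i * f i x) x = \sum_(i <- r) c i * dzeta j (f i) x.
Proof.
move=> sf; rewrite /dzeta; under eq_bigr do rewrite cderive_sum// big_distrr/=.
rewrite exchange_big/=; apply: eq_bigr => i _; rewrite big_distrr /=.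
by apply: eq_bigr => b _; rewrite mulrCA.
Qed.

Lemma cR_dzeta0 K j f : compact K -> cvanishes K f -> csmooth f -> cR (dzeta j f) = 0.
Proof.
move=> cK fK sf; rewrite /dzeta.
have [_ ->] := @cR_sum R _ (index_enum bool) (zcoef j) (fun b => cderive (zvec j b) f)
  (fun b => ccpt_integrable (csmooth_ccpt cK (@cvanishesD R K f _ cK fK) (csmoothD _ sf))).
by rewrite big1// => b _; rewrite (cR_derive0 _ cK fK sf) mulr0.
Qed.

Variables (v : 'C2 R) (e : R).
Hypothesis e0 : 0 < e.

Definition kern j l x : C :=
  \sum_(b : bool) \sum_(c : bool) zcoef j b * zcoef l c * (reg_log2 v e (zvec j b) (zvec l c) x)%:C.

Lemma kern_sym j l x : kern j l x = kern l j x.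
Proof.
rewrite /kern exchange_big /=; apply: eq_bigr => b _; apply: eq_bigr => c _.
rewrite [zcoef j c * _]mulrC; congr (_ * _%:C).
by rewrite /reg_log2; ring.
Qed.

(** The coefficients of the linear form det2 x v = v_1 x_0 - v_0 x_1. *)
Definition lcoef (k : 'I_2) : C := if k == 0 then v 0 1 else - v 0 0.

(** Up to the constants of kern_mixed this is the mixed second derivative of reg_log; its
    integral over any complex line transversal to L = 0 is independent of e. *)
Definition kappa x : R := e ^+ 2 / reg_sq v e x ^+ 2.

Lemma re_form_ex k : re_form v (e_x R k) = complex.Re (lcoef k).
Proof.
rewrite re_formE /e_x /lcoef; case: ifP => _ /=; case: (v 0 0) (v 0 1) => [? ?] [? ?] /=; ring.
Qed.
Lemma im_form_ex k : im_form v (e_x R k) = complex.Im (lcoef k).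
Proof.
rewrite im_formE /e_x /lcoef; case: ifP => _ /=; case: (v 0 0) (v 0 1) => [? ?] [? ?] /=; ring.
Qed.
Lemma re_form_ey k : re_form v (e_y R k) = - complex.Im (lcoef k).
Proof.
rewrite re_formE /e_y /lcoef; case: ifP => _ /=; case: (v 0 0) (v 0 1) => [? ?] [? ?] /=; ring.
Qed.
Lemma im_form_ey k : im_form v (e_y R k) = complex.Re (lcoef k).
Proof.
rewrite im_formE /e_y /lcoef; case: ifP => _ /=; case: (v 0 0) (v 0 1) => [? ?] [? ?] /=; ring.
Qed.

(** Since L is holomorphic, (d/dz_a)(d/dconj z_b) of log (|L|^2 + e^2) / 2 is
    L_a conj(L_b) e^2 / (2 (|L|^2 + e^2)^2). *)
Lemma kern_mixed (a b : 'I_2) x :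
  kern (lshift 2 a) (rshift 2 b) x = lcoef a * conjc (lcoef b) / 2%:R * (kappa x)%:C.
Proof.
rewrite /kern !big_bool /zcoef /zvec !split_l !split_r /=.
have q0 : reg_sq v e x != 0 by rewrite gt_eqF// reg_sq_gt0.
have -> : kappa x = (reg_sq v e x)^-1 - (re_form v x ^+ 2 + im_form v x ^+ 2) * (reg_sq v e x)^-1 ^+ 2.
  have qE : e ^+ 2 = reg_sq v e x - re_form v x ^+ 2 - im_form v x ^+ 2 by rewrite /reg_sq; ring.
  by rewrite /kappa qE; field.
rewrite /reg_log2 !re_form_ex !re_form_ey !im_form_ex !im_form_ey.
have -> : (2%:R^-1 : C) = (2%:R^-1 : R)%:C by rewrite fmorphV rmorph_nat.
case: (lcoef a) (lcoef b) => [p r] [s t] /=.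
move: (re_form v x) (im_form v x) (reg_sq v e x)^-1 => al be q.
by apply: complex_eq; rewrite /=; field.
Qed.

Lemma cR_kern K j l f : compact K -> cvanishes K f -> csmooth f ->
  cR (fun x => (reg_log v e x)%:C * dzeta j (dzeta l f) x) = cR (fun x => kern j l x * f x).
Proof.
move=> cK fK sf.
have sD u : csmooth (cderive u f) by exact: csmoothD.
have E1 : (fun x => (reg_log v e x)%:C * dzeta j (dzeta l f) x) =
    (fun x => \sum_(p : bool * bool) (zcoef j p.1 * zcoef l p.2) *
       ((reg_log v e x)%:C * cderive (zvec j p.1) (cderive (zvec l p.2) f) x)).
  apply/funext => x; rewrite /dzeta.
  under eq_bigr do rewrite cderive_sum// big_distrr/=.
  rewrite pair_big/= big_distrr/=; apply: eq_bigr => p _.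
  by ring.
have E2 : (fun x => kern j l x * f x) =
    (fun x => \sum_(p : bool * bool) (zcoef j p.1 * zcoef l p.2) *
       ((reg_log2 v e (zvec j p.1) (zvec l p.2) x)%:C * f x)).
  apply/funext => x; rewrite /kern pair_big/= big_distrl/=; apply: eq_bigr => p _.
  by rewrite mulrA.
have cc (p : bool * bool) : cintegrable (fun x => (reg_log v e x)%:C * cderive (zvec j p.1) (cderive (zvec l p.2) f) x).
  apply: ccpt_integrable; apply: ccptM; first exact: continuous_reg_log.
  apply: (csmooth_ccpt cK); last by do 2 apply: csmoothD.
  by do 2 (apply: cvanishesD => //).
have cc2 (p : bool * bool) : cintegrable (fun x => (reg_log2 v e (zvec j p.1) (zvec l p.2) x)%:C * f x).
  apply: ccpt_integrable; apply: ccptM; first exact: continuous_reg_log2.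
  exact: (csmooth_ccpt cK).
rewrite E1 E2 (cR_sum _ _ cc).2 (cR_sum _ _ cc2).2; apply: eq_bigr => p _.
by congr (_ * _); exact: (cR_reg_log v _ _ e0 cK).
Qed.

End Kernel.

(** The sum over pairs (j, l) in cR_reg_log_ddc, with its signs written out: Y and X are the
    integrals of the terms of type (2, 0) and (0, 2), and Z those of the mixed terms. *)
Lemma pairing_aux (K : numFieldType) (k Y1 Y2 Y3 Y4 X1 X2 Z00 Z01 Z10 Z11 v0 v1 w0 w1 : K) :
  1 * (k * -1 * 0) * Y1 + 1 * (k * -1 * 1) * X2 +
  (1 * (k * 1 * -1) * (v1 * w1 / 2 * Z11) + 1 * (k * 1 * 1) * (v1 * - w0 / 2 * Z10)) +
  (-1 * (k * -1 * 1) * X2 + -1 * (k * -1 * 0) * Y2 +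
   (-1 * (k * 1 * -1) * (- v0 * w1 / 2 * Z01) + -1 * (k * 1 * 1) * (- v0 * - w0 / 2 * Z00))) +
  (1 * (k * -1 * 1) * (v1 * w1 / 2 * Z11) + 1 * (k * -1 * -1) * (- v0 * w1 / 2 * Z01) +
   (1 * (k * 1 * 0) * Y3 + 1 * (k * 1 * 1) * X1) +
   (-1 * (k * -1 * 1) * (v1 * - w0 / 2 * Z10) + -1 * (k * -1 * -1) * (- v0 * - w0 / 2 * Z00) +
    (-1 * (k * 1 * 1) * X1 + -1 * (k * 1 * 0) * Y4))) =
  - k * (v0 * w0 * Z00 + (v0 * w1 * Z01 + 0) + (v1 * w0 * Z10 + (v1 * w1 * Z11 + 0) + 0)).
Proof. by field. Qed.

Section PoincareLelong.
Variable R : realType.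
Local Notation C := R[i].
Implicit Types (w : diff_form R) (j l : 'I_(2 + 2)).

Lemma card_lt (n : nat) (j : 'I_n) : #|[set i : 'I_n | (i < j)%N]%SET| = j.
Proof.
rewrite -sum1_card (eq_bigl (fun i : 'I_n => (i < j)%N)) => [|i]; last by rewrite inE.
by rewrite -(big_ord_widen _ (fun=> 1%N) (ltnW (ltn_ord j))) sum1_card card_ord.
Qed.

Lemma wsignT j : wsign R j [set: _]%SET = (-1) ^+ j.
Proof.
rewrite /wsign inE; congr (_ ^+ _); rewrite -[RHS]card_lt.
by apply: eq_card => i; rewrite !inE.
Qed.

Lemma wsignT1 j l : wsign R l ([set: _] :\ j)%SET =
  if l == j then 0 else (-1) ^+ (l - (j < l))%N.
Proof.
rewrite /wsign !inE andbT; case: eqVneq => //= lj; congr (_ ^+ _).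
have := cardsD1 j [set i : 'I_(2 + 2) | (i < l)%N]%SET; rewrite card_lt inE => E.
rewrite {2}E addKn; apply: eq_card => i; by rewrite !inE andbT.
Qed.

Variables (w : diff_form R) (K : set ('R4 R)).
Hypotheses (cK : compact K) (wK : forall I, cvanishes K (w I)) (sw : forall I, csmooth (w I)).

Let coef j l : C := wsign R j [set: _]%SET *
  ('i%C / (2%:R * (pi : R)%:C) * dcsign R l * wsign R l ([set: _] :\ j)%SET).

Let rest j l := w ([set: _] :\ j :\ l)%SET.

Lemma ddcE x : dform (dcform w) [set: _]%SET x =
  \sum_(p : 'I_(2 + 2) * 'I_(2 + 2)) coef p.1 p.2 * dzeta p.1 (dzeta p.2 (rest p.1 p.2)) x.
Proof.
rewrite dformE -(pair_bigA _ (fun j l => coef j l * dzeta j (dzeta l (rest j l)) x)) /=.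
apply: eq_bigr => j _.
have -> : dcform w ([set: _] :\ j)%SET = fun x => \sum_l ('i%C / (2%:R * (pi : R)%:C) * dcsign R l *
    wsign R l ([set: _] :\ j)%SET) * dzeta l (rest j l) x.
  by apply/funext => y; rewrite dcformE.
rewrite dzeta_sum => [|l]; last by apply: csmooth_dzeta; exact: sw.
by rewrite big_distrr /=; apply: eq_bigr => l _; rewrite mulrA.
Qed.

Let dd_vanishes p : cvanishes K (dzeta p.1 (dzeta p.2 (rest p.1 p.2))).
Proof. by do 2 (apply: cvanishes_dzeta => //); exact: wK. Qed.

Let dd_smooth p : csmooth (dzeta p.1 (dzeta p.2 (rest p.1 p.2))).
Proof. by do 2 (apply: csmooth_dzeta); exact: sw. Qed.

Lemma ddc_smooth : csmooth (fun x => dform (dcform w) [set: _]%SET x).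
Proof.
rewrite (_ : (fun x => _) = fun x => \sum_(p : 'I_(2 + 2) * 'I_(2 + 2)) coef p.1 p.2 *
    dzeta p.1 (dzeta p.2 (rest p.1 p.2)) x); last by apply/funext => x; exact: ddcE.
by apply: csmooth_sum => p; exact: dd_smooth.
Qed.

Lemma ddc_vanishes : cvanishes K (fun x => dform (dcform w) [set: _]%SET x).
Proof. by move=> x Kx; rewrite ddcE big1// => p _; rewrite dd_vanishes// mulr0. Qed.

(** Every term of dd^c w is a derivative of a function of compact support. *)
Lemma cR_ddc0 : cR (fun x => dform (dcform w) [set: _]%SET x) = 0.
Proof.
rewrite (_ : (fun x => _) = fun x => \sum_(p : 'I_(2 + 2) * 'I_(2 + 2)) coef p.1 p.2 *
    dzeta p.1 (dzeta p.2 (rest p.1 p.2)) x); last by apply/funext => x; exact: ddcE.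
rewrite (cR_sum _ _ (fun p => ccpt_integrable (csmooth_ccpt cK (@dd_vanishes p) (dd_smooth p)))).2.
rewrite big1// => p _; rewrite (@cR_dzeta0 R K) ?mulr0//.
  by apply: cvanishes_dzeta => //; exact: wK.
by apply: csmooth_dzeta; exact: sw.
Qed.

Variables (v : 'C2 R) (e : R).
Hypothesis e0 : 0 < e.

Lemma continuous_kappa : continuous (kappa v e).
Proof.
have E : kappa v e = (fun x => e ^+ 2 * ((reg_sq v e x)^-1 * (reg_sq v e x)^-1)).
  by apply/funext => y; rewrite /kappa expr2 invfM.
rewrite E => x; apply: cvgM; first exact: cvg_cst.
by apply: cvgM; exact: continuous_inv_reg_sq.
Qed.

Lemma sum4 (V : zmodType) (F : 'I_(2 + 2) -> V) :
  \sum_j F j = F (lshift 2 0) + F (lshift 2 1) + (F (rshift 2 0) + F (rshift 2 1)).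
Proof.
by rewrite big_split_ord /= !big_ord_recl !big_ord0 !addr0; do ! congr (_ + _); congr F; apply: val_inj.
Qed.

Lemma restC j l : rest j l = rest l j.
Proof. by apply: (congr1 w); apply/setP => i; rewrite !inE !andbT andbC. Qed.

Lemma rest_mixed (a b : 'I_2) :
  rest (lshift 2 a) (rshift 2 b) = w [set lshift 2 (1 - a); rshift 2 (1 - b)]%SET.
Proof.
apply: (congr1 w); apply/setP => i; rewrite !inE andbT.
rewrite -!(inj_eq (@ord_inj _)); case: a => [[|[|//]] ha]; case: b => [[|[|//]] hb];
  by case: i => [[|[|[|[|//]]]] hi].
Qed.

(** The pure terms cancel, the kernel being symmetric while the wedge product is
    alternating; each mixed term occurs twice with the same sign. *)
Lemma cR_reg_log_ddc : cR (fun x => (reg_log v e x)%:C * dform (dcform w) [set: _]%SET x) =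
  - ('i%C / (2%:R * (pi : R)%:C)) * cR (fun x => (kappa v e x)%:C *
     \sum_(j < 2) \sum_(k < 2) v 0 j * conjc (v 0 k) * w [set lshift 2 j; rshift 2 k]%SET x).
Proof.
rewrite (_ : (fun x => _ * dform _ _ _) = fun x => \sum_(p : 'I_(2 + 2) * 'I_(2 + 2)) coef p.1 p.2 *
    ((reg_log v e x)%:C * dzeta p.1 (dzeta p.2 (rest p.1 p.2)) x)); last first.
  by apply/funext => x; rewrite ddcE big_distrr/=; apply: eq_bigr => p _; rewrite mulrCA.
have i1 p : cintegrable (fun x => (reg_log v e x)%:C * dzeta p.1 (dzeta p.2 (rest p.1 p.2)) x).
  apply: ccpt_integrable; apply: ccptM; first exact: continuous_reg_log.
  exact: (csmooth_ccpt cK (@dd_vanishes p) (dd_smooth p)).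
rewrite (cR_sum _ _ i1).2.
pose X j l := cR (fun x => kern v e j l x * rest j l x).
transitivity (\sum_j \sum_l coef j l * X j l).
  rewrite pair_big /=; apply: eq_bigr => p _; congr (_ * _); apply: (@cR_kern R v e e0 K _ _ _ cK).
    exact: wK.
  exact: sw.
have XC j l : X j l = X l j.
  by rewrite /X restC; congr cR; apply/funext => x; rewrite kern_sym.
pose Z (a b : 'I_2) := cR (fun x => (kappa v e x)%:C * w [set lshift 2 a; rshift 2 b]%SET x).
have i2 I : cintegrable (fun x => (kappa v e x)%:C * w I x).
  apply: ccpt_integrable; apply: ccptM; first exact: continuous_kappa.
  by apply: (csmooth_ccpt cK).
have XY a b : X (lshift 2 a) (rshift 2 b) = lcoef v a * conjc (lcoef v b) / 2%:R * Z (1 - a) (1 - b).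
  have E : (fun x => kern v e (lshift 2 a) (rshift 2 b) x * rest (lshift 2 a) (rshift 2 b) x) =
      (fun x => \sum_(i < 1) (lcoef v a * conjc (lcoef v b) / 2%:R) *
        ((kappa v e x)%:C * w [set lshift 2 (1 - a); rshift 2 (1 - b)]%SET x)).
    by apply/funext => x; rewrite big_ord1 kern_mixed// rest_mixed mulrA.
  by rewrite /X E (cR_sum _ _ (fun _ => i2 _)).2 big_ord1.
rewrite (_ : (fun x => (kappa v e x)%:C * _) = fun x => \sum_(p : 'I_2 * 'I_2)
    (v 0 p.1 * conjc (v 0 p.2)) * ((kappa v e x)%:C * w [set lshift 2 p.1; rshift 2 p.2]%SET x)); last first.
  apply/funext => x; rewrite pair_big/= big_distrr/=; apply: eq_bigr => p _.
  by rewrite mulrCA.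
rewrite (cR_sum _ _ (fun p => i2 _)).2.
rewrite -(pair_bigA _ (fun j k : 'I_2 => v 0 j * conjc (v 0 k) * Z j k)) /=.
rewrite !sum4 !big_ord_recl !big_ord0 /coef !wsignT !wsignT1 /dcsign !split_l !split_r /=.
have [e1 e2 e3 e4] : [/\ 2 + 1 %% 2 - 1 = 2, 2 + 0 - 1 = 1, 2 + 0 - 0 = 2 & 2 + 1 %% 2 = 3]%N by [].
have [e5 e6 e7 e8] : [/\ 1 %% 2 - 1 = 0, 1 %% 2 - 0 = 1, 1 %% 2 = 1 & 0 - 0 = 0]%N by [].
rewrite ?(e1, e2, e3, e4, e5, e6, e7, e8) addn0 ?expr0 ?expr1 ?sqrrN ?expr1n.
rewrite (_ : (-1) ^+ 3 = -1); last by rewrite exprSr sqrrN expr1n mul1r.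
rewrite [X (rshift 2 0) (lshift 2 0)]XC [X (rshift 2 0) (lshift 2 1)]XC.
rewrite [X (rshift 2 1) (lshift 2 0)]XC [X (rshift 2 1) (lshift 2 1)]XC.
rewrite [X (rshift 2 1) (rshift 2 0)]XC [X (lshift 2 1) (lshift 2 0)]XC !XY /lcoef /=.
rewrite (_ : lift ord0 ord0 = 1); last exact: val_inj.
rewrite (_ : ord0 = 0); last exact: val_inj.
rewrite subr0 subrr (_ : conjc (- v 0 0) = - conjc (v 0 0)); last by case: (v 0 0).
move: (X (lshift 2 0) (lshift 2 0)) (X (lshift 2 1) (lshift 2 1)) (X (rshift 2 0) (rshift 2 0)) (X (rshift 2 1) (rshift 2 1)) => Y1 Y2 Y3 Y4.
move: (X (rshift 2 0) (rshift 2 1)) (X (lshift 2 0) (lshift 2 1)) => X1 X2.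
move: (Z 0 0) (Z 0 1) (Z 1 0) (Z 1 1) => Z00 Z01 Z10 Z11.
move: ((v 0 0)^*%C) ((v 0 1)^*%C) => w0 w1; move: (v 0 0) (v 0 1) => v0 v1.
move: ('i%C / _) => k.
exact: pairing_aux.
Qed.

End PoincareLelong.

(** * An integral over the plane *)

Section PlanarConstant.
Variable R : realType.
Implicit Types (x c : R).

Lemma integral_even (f F : R -> R) (l : R) : (forall x, 0 <= f x) -> continuous f ->
  (forall x, f (- x) = f x) -> (forall x, is_derive x (1 : R) F (f x)) -> F 0 = 0 ->
  F x @[x --> +oo] --> l ->
  (\int[@lebR R]_x (f x)%:E = (2 * l)%:E)%E.
Proof.
move=> f0 cf ev dF F0 Fl.
have cF : continuous F.
  move=> x; apply: differentiable_continuous; apply/derivable1_diffP.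
  by have [] := dF x.
rewrite lebR_integralE//; first last.
- by move=> x _; rewrite lee_fin.
- by apply/measurable_EFinP; exact: continuous_measurable_fun.
rewrite (ge0_symfun_integralT f0 cf) => [|x /=]; last by rewrite ev.
rewrite EFinM; congr (_ * _)%E.
rewrite (_ : [set x | 0 <= x] = `[0, +oo[%classic); last first.
  by apply/seteqP; split => x /=; rewrite in_itv/= andbT.
rewrite (ge0_continuous_FTC2y _ _ Fl)/=.
- by rewrite F0 oppr0 addr0.
- by move=> x _.
- exact: continuous_subspaceT.
- by move=> x x0; have [] := dF x.
- by apply: cvg_at_right_filter; exact: cF.
- by move=> x _; rewrite derive1E; have [_ ->] := dF x.
Qed.

Local Notation ca x := (cos (atan x)).
Local Notation sa x := (sin (atan x)).

Lemma continuous_ca : continuous (fun x => ca x).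
Proof.
move=> x; apply: (@continuous_comp _ _ _ (@atan R) (@cos R)).
  exact: continuous_atan.
exact: continuous_cos.
Qed.

Lemma cos_atan_sqr x : ca x ^+ 2 = (1 + x ^+ 2)^-1.
Proof. by rewrite cos_atan exprVn sqr_sqrtr// addr_ge0// sqr_ge0. Qed.

Lemma is_derive_sa x : is_derive x (1 : R) (fun x => sa x) (ca x ^+ 3).
Proof.
have := @is_derive1_comp R (@sin R) (@atan R) x _ _ (is_derive_sin _) (is_derive1_atan x).
by rewrite -cos_atan_sqr [ca x * _]mulrC -exprSr.
Qed.

Lemma is_derive_ca x : is_derive x (1 : R) (fun x => ca x) (- sa x * ca x ^+ 2).
Proof.
have := @is_derive1_comp R (@cos R) (@atan R) x _ _ (is_derive_cos _) (is_derive1_atan x).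
by rewrite -cos_atan_sqr.
Qed.

Lemma integral_ca3 : (\int[@lebR R]_x (ca x ^+ 3)%:E = 2%:E)%E.
Proof.
rewrite -[2%R]mulr1; apply: (@integral_even (fun x => ca x ^+ 3) (fun x => sa x) 1).
- by move=> x; rewrite exprn_ge0// cos_atan invr_ge0 sqrtr_ge0.
- by move=> x; do ! apply: cvgM; exact: continuous_ca.
- by move=> x; rewrite atanN cosN.
- exact: is_derive_sa.
- by rewrite atan0 sin0.
- rewrite -(@sin_pihalf R); apply: (cvg_comp (@atan R) (@sin R) (@cvgy_atan R)).
  exact: continuous_sin.
Qed.

Lemma integral_ca4 : (\int[@lebR R]_x (ca x ^+ 4)%:E = (pi / 2)%:E)%E.
Proof.
rewrite (_ : pi / 2 = 2 * (pi / 2 / 2))%R; last by field.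
apply: (@integral_even (fun x => ca x ^+ 4) (fun x => 2^-1 * atan x + 2^-1 * (sa x * ca x)) (pi / 2 / 2)).
- by move=> x; rewrite exprn_ge0// cos_atan invr_ge0 sqrtr_ge0.
- by move=> x; do ! apply: cvgM; exact: continuous_ca.
- by move=> x; rewrite atanN cosN.
- move=> x.
  have h := is_derive_lin 2^-1 2^-1 (is_derive1_atan x) (is_derive_mul (is_derive_sa x) (is_derive_ca x)).
  apply: (is_derive_eq h); rewrite -cos_atan_sqr.
  have s2 : sa x ^+ 2 = 1 - ca x ^+ 2 by rewrite -(cos2Dsin2 (atan x)) addrC addKr.
  transitivity (2^-1 * ca x ^+ 2 * (1 + ca x ^+ 2 - sa x ^+ 2)); first by ring.
  by rewrite s2; field.
- by rewrite atan0 sin0 mul0r !mulr0 addr0.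
- rewrite (_ : pi / 2 / 2 = 2^-1 * (pi / 2) + 2^-1 * (sin (pi / 2) * cos (pi / 2)) :> R); last first.
    by rewrite cos_pihalf !mulr0 addr0 mulrC.
  apply: cvgD; apply: cvgM; try exact: cvg_cst; first exact: cvgy_atan.
  apply: cvgM.
    apply: (cvg_comp (@atan R) (@sin R) (@cvgy_atan R)); exact: continuous_sin.
  apply: (cvg_comp (@atan R) (@cos R) (@cvgy_atan R)); exact: continuous_cos.
Qed.

(** The substitution y = c tan s, in the form of a dilation followed by arctangent. *)
Lemma integral_inv_sq c : 0 < c ->
  (\int[@lebR R]_y (((c ^+ 2 + y ^+ 2) ^+ 2)^-1)%:E = (pi / 2 * (c^-1) ^+ 3)%:E)%E.
Proof.
move=> c0; have cn : c != 0 by rewrite gt_eqF.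
have [_ _ H] := scales_affine 0 cn.
have g0 y : (0 <= (((c ^+ 2 + y ^+ 2) ^+ 2)^-1)%:E)%E by rewrite lee_fin invr_ge0 sqr_ge0.
have mg : measurable_fun setT (fun y : R => (((c ^+ 2 + y ^+ 2) ^+ 2)^-1)%:E).
  apply/measurable_EFinP; apply: continuous_measurable_fun => y; apply: cvgV.
    by rewrite expf_neq0// gt_eqF// ltr_pwDl ?exprn_gt0// sqr_ge0.
  apply: cvgM; (apply: cvgD; [exact: cvg_cst|apply: cvgM; exact: cvg_id]).
have := H _ mg g0; rewrite gtr0_norm//.
have E y : (((c ^+ 2 + (c * y + 0) ^+ 2) ^+ 2)^-1)%:E = ((c^-1 ^+ 4)%:E * (ca y ^+ 4)%:E)%E.
  rewrite -EFinM; congr EFin; rewrite addr0.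
  rewrite (_ : ca y ^+ 4 = (ca y ^+ 2) ^+ 2); last by rewrite -exprM.
  rewrite cos_atan_sqr; field.
  have d0 (t b : R) : t != 0 -> t ^+ 2 + b ^+ 2 != 0.
    by move=> t0; rewrite gt_eqF// ltr_pwDl ?sqr_ge0// exprn_even_gt0.
  by rewrite cn d0// -[X in X + _](expr1n _ 2) d0// oner_neq0.
rewrite (eq_integral _ _ (fun y _ => E y)) ge0_integralZl//; first last.
- by rewrite lee_fin exprn_ge0// invr_ge0 ltW.
- by move=> y _; rewrite lee_fin exprn_ge0// cos_atan invr_ge0 sqrtr_ge0.
- apply/measurable_EFinP; apply: continuous_measurable_fun => y.
  by do ! apply: cvgM; exact: continuous_ca.
rewrite integral_ca4.
set J := integral _ _ _ => HJ.
transitivity (c%:E * (c^-1%:E * J))%E.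
  by rewrite muleA -EFinM divff// mul1e.
by rewrite -HJ -!EFinM; congr EFin; field.
Qed.

Definition planar_kernel (s : R * R) : R := ((1 + s.1 ^+ 2 + s.2 ^+ 2) ^+ 2)^-1.

Lemma planar_den s : 0 < 1 + s.1 ^+ 2 + s.2 ^+ 2 :> R.
Proof. by rewrite -addrA ltr_wpDr// addr_ge0 ?sqr_ge0. Qed.

Lemma planar_kernel_ge0 s : 0 <= planar_kernel s.
Proof. by rewrite invr_ge0 sqr_ge0. Qed.

Lemma continuous_planar_kernel : continuous planar_kernel.
Proof.
have c1 : continuous (fun s : R * R => 1 + s.1 ^+ 2 + s.2 ^+ 2).
  move=> s; apply: cvgD; first apply: cvgD; first exact: cvg_cst.
    by apply: cvgM; exact: cvg_fst.
  by apply: cvgM; exact: cvg_snd.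
move=> s; apply: cvgV; first by rewrite expf_neq0// gt_eqF ?planar_den.
by apply: cvgM; exact: c1.
Qed.

(** One variable at a time: the inner integral is the preceding lemma with c^2 = 1 + x^2, and
    leaves a power of cos (atan x). *)
Lemma integral_planar_kernel : (\int[plane R]_s (planar_kernel s)%:E = (pi : R)%:E)%E.
Proof.
have mk : measurable_fun setT (fun s => (planar_kernel s)%:E).
  by apply/measurable_EFinP; apply: continuous_measurable2; exact: continuous_planar_kernel.
rewrite /plane /= /square_measure (@fubini_tonelli1 _ _ _ _ R (@lebR R) (@lebR R))//; last first.
  by move=> s; rewrite lee_fin planar_kernel_ge0.
rewrite /fubini_F (eq_integral (fun x => ((pi / 2)%:E * (ca x ^+ 3)%:E)%E)) => [|x _]; last first.
  have c0 : 0 < Num.sqrt (1 + x ^+ 2) by rewrite sqrtr_gt0 ltr_wpDr// sqr_ge0.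
  have := integral_inv_sq c0; rewrite sqr_sqrtr ?ltW ?ltr_wpDr ?sqr_ge0//.
  by rewrite -cos_atan -EFinM.
rewrite ge0_integralZl//; first last.
- by rewrite lee_fin divr_ge0// pi_ge0.
- by move=> y _; rewrite lee_fin exprn_ge0// cos_atan invr_ge0 sqrtr_ge0.
- apply/measurable_EFinP; apply: continuous_measurable_fun => y.
  by do ! apply: cvgM; exact: continuous_ca.
by rewrite integral_ca3 -EFinM; congr EFin; field.
Qed.

End PlanarConstant.

(** * An approximate identity along a complex line *)

Section ApproximateIdentity.
Variable R : realType.
Local Notation C := R[i].
Implicit Types (f : 'R4 R -> R) (x : 'R4 R) (K : set ('R4 R)).

Definition sqn (a : C) : R := complex.Re a ^+ 2 + complex.Im a ^+ 2.

Lemma sqnM a b : sqn (a * b) = sqn a * sqn b.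
Proof. by case: a b => [? ?] [? ?]; rewrite /sqn /=; ring. Qed.

Lemma sqn_eq0 a : (sqn a == 0) = (a == 0).
Proof. by case: a => p q; rewrite /sqn /= eq_complex /= paddr_eq0 ?sqr_ge0// !sqrf_eq0. Qed.

Lemma sqn_ge0 a : 0 <= sqn a.
Proof. by rewrite addr_ge0 ?sqr_ge0. Qed.

Lemma sqn_gt0 a : a != 0 -> 0 < sqn a.
Proof. by move=> a0; rewrite lt_neqAle sqn_ge0 eq_sym sqn_eq0 a0. Qed.

Lemma reg_sqE v e x : reg_sq v e x = sqn (det2 (toC2 x) v) + e ^+ 2.
Proof. by []. Qed.

Local Open Scope ereal_scope.

Lemma integrable_square_indic (r M : R) :
  (plane R).-integrable setT (fun s : R * R => (M * \1_(square r) s)%:E).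
Proof.
rewrite (_ : (fun s : R * R => _) = (fun s : R * R => M%:E * (\1_(square r) s)%:E)); last first.
  by apply/funext => s; rewrite EFinM.
apply: integrableZl => //; apply/integrableP; split.
  by apply/measurable_EFinP; apply: measurable_indic; exact: measurable_square.
rewrite (eq_integral (fun s : R * R => (\1_(square r) s)%:E)) => [|s _]; last by rewrite gee0_abs ?lee_fin.
by have mb := measurable_square r; rewrite integral_indic// setIT; exact: plane_square.
Qed.

Lemma integrable_square_bounded (h : R * R -> R) (r M : R) : measurable_fun setT h ->
  (forall s, (`|h s| <= M)%R) -> (forall s, ~ square r s -> h s = 0%R) ->
  (plane R).-integrable setT (EFin \o h).
Proof.
move=> mh hM h0.
apply: (le_integrable measurableT _ _ (integrable_square_indic r M)).
  exact/measurable_EFinP.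
move=> x _; rewrite lee_fin; apply: le_trans (ler_norm _); rewrite indicE.
case: (boolP (x \in square r)); rewrite ?mulr1 ?hM// notin_setE => /h0 ->.
by rewrite normr0 mulr0.
Qed.

Lemma integral_space_prod (g h : R * R -> R) : (forall s, (0 <= g s)%R) ->
  (plane R).-integrable setT (EFin \o g) -> (plane R).-integrable setT (EFin \o h) ->
  (space R).-integrable setT (fun x => (g x.1 * h x.2)%:E) /\
  \int[space R]_x (g x.1 * h x.2)%:E =
    (\int[plane R]_s (g s)%:E) * (\int[plane R]_s (h s)%:E).
Proof.
move=> g0 jg ih.
have mg : measurable_fun setT g by have /measurable_EFinP := measurable_int _ jg.
have mh : measurable_fun setT h by have /measurable_EFinP := measurable_int _ ih.
have mgh : measurable_fun setT (fun x : 'R4 R => (g x.1 * h x.2)%:E).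
  apply/measurable_EFinP; apply: measurable_funM.
    by apply: measurableT_comp => //; exact: measurable_fst.
  by apply: measurableT_comp => //; exact: measurable_snd.
have inn s : \int[plane R]_y (g s * h y)%:E = (g s)%:E * \int[plane R]_y (h y)%:E.
  by rewrite -integralZl//; apply: eq_integral => y _; rewrite -EFinM.
have fg := integrable_fin_num measurableT jg; have fh := integrable_fin_num measurableT ih.
have igh : (space R).-integrable setT (fun x => (g x.1 * h x.2)%:E).
  rewrite /space /= /square_measure.
  apply/(@integrable12ltyP _ _ _ _ R (plane R) (plane R)) => //=.
  have [I IE] : exists I : R, \int[plane R]_y `|(h y)%:E| = I%:E.
    exists (fine (\int[plane R]_y `|(h y)%:E|)); rewrite fineK// ge0_fin_numE ?integral_ge0//.
    by move/integrableP : ih => [].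
  rewrite (eq_integral (fun s => I%:E * (g s)%:E)) => [|s _].
    rewrite integralZl//.
    by apply: lte_mul_pinfty; rewrite -?IE ?integral_ge0// ?IE// ltey_eq fg.
  rewrite -IE.
  rewrite (eq_integral (fun y => (g s)%:E * `|(h y)%:E|)) => [|y _].
    rewrite ge0_integralZl// 1?muleC//; first by apply/measurable_EFinP; apply: measurableT_comp.
    by rewrite lee_fin.
  by rewrite -!EFinM normrM ger0_norm.
split=> //.
transitivity (\int[plane R]_s ((\int[plane R]_y (h y)%:E) * (g s)%:E)).
  rewrite /space /= /square_measure -(@integral12_prod_meas1 _ _ _ _ R (plane R) (plane R))//.
  by apply: eq_integral => s _; rewrite /fubini_F /= muleC; exact: inn.
by rewrite -(fineK fh) integralZl// muleC.
Qed.

Lemma integrable_planar_kernel : (plane R).-integrable setT (EFin \o @planar_kernel R).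
Proof.
apply/integrableP; split.
  by apply/measurable_EFinP; apply: continuous_measurable2; exact: continuous_planar_kernel.
rewrite (eq_integral (fun s => (planar_kernel s)%:E)) => [|s _].
  by rewrite integral_planar_kernel ltry.
by rewrite /= ger0_norm// planar_kernel_ge0.
Qed.

End ApproximateIdentity.

Lemma continuous_pair (T U V : topologicalType) (f : T -> U) (g : T -> V) :
  continuous f -> continuous g -> continuous (fun x => (f x, g x)).
Proof. by move=> cf cg x; exact: (cvg_pair (cf x) (cg x)). Qed.

Section KappaLimit.
Variable R : realType.
Local Notation C := R[i].
Variables (v : 'C2 R) (f : 'R4 R -> R) (K : set ('R4 R)).
Hypotheses (v1 : v 0 1 != 0) (cK : compact K) (cf : continuous f) (fK : vanishes_off K f).
Implicit Types (x y : 'R4 R).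

Let q : R := sqn (v 0 1).
Let q0 : 0 < q. Proof. exact: sqn_gt0. Qed.

(** Chosen so that (polar_line z, z) is on the line of v. *)
Definition polar_line (z : R * R) : R * R :=
  let a := v 0 0 / v 0 1 in (complex.Re a * z.1 - complex.Im a * z.2, complex.Im a * z.1 + complex.Re a * z.2).

(** The substitution dilating by r the distance to the line of v; it turns kappa into a fixed
    kernel in the first coordinate. *)
Definition shear (r : R) x : 'R4 R := (r *: x.1 + polar_line x.2, x.2).

Lemma polar_line_param (t : R * R) :
  let z := (complex.Re (v 0 1) * t.1 - complex.Im (v 0 1) * t.2 + 0,
            complex.Im (v 0 1) * t.1 + complex.Re (v 0 1) * t.2 + 0) in
  (polar_line z, z) = ofC2 ((t.1 +i* t.2) *: v).
Proof.
rewrite /ofC2 !mxE /polar_line.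
have [a [-> ->]] : exists a, v 0 0 = a * v 0 1 /\ v 0 0 / v 0 1 = a.
  by exists (v 0 0 / v 0 1); rewrite divfK.
by case: (v 0 1) a t => [p q'] [a b] [t1 t2]; congr (_, _, (_, _)); rewrite /=; ring.
Qed.

Lemma continuous_polar_line : continuous polar_line.
Proof.
apply: continuous_pair => z.
  by apply: cvgB; apply: cvgM; (exact: cvg_cst || exact: cvg_fst || exact: cvg_snd).
by apply: cvgD; apply: cvgM; (exact: cvg_cst || exact: cvg_fst || exact: cvg_snd).
Qed.

Lemma det2_shear r x : det2 (toC2 (shear r x)) v = (r%:C * v 0 1) * (x.1.1 +i* x.1.2).
Proof.
rewrite /det2 !mxE /=.
have -> : (r *: x.1 + polar_line x.2).1 +i* (r *: x.1 + polar_line x.2).2 =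
    r%:C * (x.1.1 +i* x.1.2) + v 0 0 / v 0 1 * (x.2.1 +i* x.2.2).
  rewrite /polar_line; case: (v 0 0 / v 0 1) => a b; case: x => [[? ?] [? ?]] /=.
  by simpc; apply: complex_eq; rewrite /= /GRing.scale /=; ring.
by rewrite mulrDr mulrA [v 0 1 * r%:C]mulrC mulrA mulrCA divff// mulr1 addrK.
Qed.

Lemma kappa_shear (e : R) x : 0 < e ->
  kappa v e (shear (e / Num.sqrt q) x) = (e ^+ 2)^-1 * planar_kernel x.1.
Proof.
move=> e0; rewrite /kappa reg_sqE det2_shear !sqnM.
have -> : sqn (e / Num.sqrt q)%:C = e ^+ 2 / q.
  by rewrite /sqn /= expr0n addr0 exprMn exprVn sqr_sqrtr ?ltW.
rewrite divfK ?gt_eqF//  /planar_kernel /sqn /=.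
have d0 := planar_den x.1.
rewrite -addrA in d0 *.
have -> : e ^+ 2 * (x.1.1 ^+ 2 + x.1.2 ^+ 2) + e ^+ 2 = e ^+ 2 * (1 + (x.1.1 ^+ 2 + x.1.2 ^+ 2)) by ring.
by field; rewrite !gt_eqF.
Qed.

Let e (n : nat) : R := n.+1%:R^-1.
Let e0 n : 0 < e n. Proof. by rewrite invr_gt0. Qed.
Let r n := e n / Num.sqrt q.
Let r0 n : 0 < r n. Proof. by rewrite divr_gt0 ?sqrtr_gt0. Qed.

Lemma continuous_shear t : continuous (shear t).
Proof.
apply: continuous_pair => x; last exact: cvg_snd.
apply: cvgD; first by apply: cvgZr; exact: cvg_fst.
by apply: (@continuous_comp _ _ _ snd polar_line); [exact: cvg_snd|exact: continuous_polar_line].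
Qed.

Local Open Scope ereal_scope.

Lemma integral_kappa n : \int[space R]_x (kappa v (e n) x * f x)%:E =
  (q^-1)%:E * \int[space R]_x (planar_kernel x.1 * f (shear (r n) x))%:E.
Proof.
have ig : (space R).-integrable setT (EFin \o (fun x => kappa v (e n) x * f x)%R).
  apply: (integrable_cpt cK) => [|x Kx]; last by rewrite fK ?mulr0.
  by move=> x; apply: cvgM; [exact: continuous_kappa|exact: cf].
have := integral_scales (scales_shear continuous_polar_line (lt0r_neq0 (r0 n))) ig.
move=> [ig2]; rewrite -/(shear (r n)) /=.
have E x : (kappa v (e n) (shear (r n) x) * f (shear (r n) x))%:E =
   ((e n ^+ 2)^-1)%:E * (planar_kernel x.1 * f (shear (r n) x))%:E.
  by rewrite kappa_shear// -EFinM mulrA.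
have ig3 : (space R).-integrable setT (EFin \o (fun x => planar_kernel x.1 * f (shear (r n) x))%R).
  rewrite (_ : _ \o _ = fun x => (e n ^+ 2)%:E * (kappa v (e n) (shear (r n) x) * f (shear (r n) x))%:E).
    exact: integrableZl.
  have en : (e n ^+ 2 != 0)%R by rewrite gt_eqF// exprn_gt0.
  by apply/funext => x; rewrite E -!EFinM mulrA divff// mul1r.
rewrite (eq_integral _ _ (fun x _ => E x)) integralZl//.
have [J <-] : exists J : R, J%:E = \int[space R]_x (planar_kernel x.1 * f (shear (r n) x))%:E.
  by exists (fine (\int[space R]_x (planar_kernel x.1 * f (shear (r n) x))%:E)); rewrite fineK// (integrable_fin_num _ ig3).
have [I <-] : exists I : R, I%:E = \int[space R]_x (kappa v (e n) x * f x)%:E.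
  by exists (fine (\int[space R]_x (kappa v (e n) x * f x)%:E)); rewrite fineK// (integrable_fin_num _ ig).
rewrite -!EFinM => -[H]; congr EFin.
have rq : (r n ^+ 2 = e n ^+ 2 / q)%R by rewrite /r expr_div_n sqr_sqrtr ?ltW.
have en : (e n ^+ 2 != 0)%R by rewrite gt_eqF// exprn_gt0.
have -> : (I = r n ^+ 2 * ((r n ^+ 2)^-1 * I))%R by rewrite mulrA divff ?mul1r// gt_eqF// exprn_gt0.
rewrite -H rq; move: (e n ^+ 2)%R en => E2 E2n; field.
by rewrite E2n gt_eqF.
Qed.

Let on_line (z : R * R) : R := f (polar_line z, z).

Let dominated : exists M rho : R, (0 < M)%R /\ forall x t, (`|f (shear t x)| <= M * \1_(square rho) x.2)%R.
Proof.
have [M M0 fM] := continuous_cpt_bounded cK cf fK.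
have [rho [rho0 Kr]] := compact_bounded4 cK.
exists M, rho; split=> // x t; rewrite indicE; case: (boolP (x.2 \in square rho)); rewrite ?mulr1 ?fM//.
rewrite notin_setE => h; rewrite fK ?normr0 ?mulr0// => /Kr /= h2; apply: h.
by have : box rho (shear t x) by []; rewrite boxE => -[].
Qed.

Lemma integrable_on_line : (plane R).-integrable setT (EFin \o on_line).
Proof.
have [M [rho [M0 fM]]] := dominated.
have fM0 z : (`|on_line z| <= M * \1_(square rho) z)%R.
  by have := fM ((0%R, 0%R), z) 0%R; rewrite /shear /= scale0r add0r.
apply: (@integrable_square_bounded _ _ rho M).
- apply: continuous_measurable2 => z.
  apply: (@continuous_comp _ _ _ (fun z => (polar_line z, z)) f); last exact: cf.
  by apply: (continuous_pair continuous_polar_line) => y; exact: cvg_id.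
- move=> z; apply: (le_trans (fM0 z)); by rewrite ler_piMr// ?ltW// indicE.
- move=> z /= zr; apply/eqP; rewrite -normr_le0.
  by have := fM0 z; rewrite indicE memNset// mulr0.
Qed.

(** After the substitution the integrand is planar_kernel x.1 times f (shear r x), which tends
    to the value of f on the line; the convergence is dominated since f has compact support. *)
Lemma kappa_cvg : \int[space R]_x (kappa v (e n) x * f x)%:E @[n --> \oo] -->
  (q^-1 * pi)%:E * \int[plane R]_z (on_line z)%:E.
Proof.
have [M [rho [M0 fM]]] := dominated.
rewrite (_ : (fun n => _) = fun n => (q^-1)%:E * \int[space R]_x (planar_kernel x.1 * f (shear (r n) x))%:E); last first.
  by apply/funext => n; exact: integral_kappa.
rewrite EFinM -muleA; apply: cvgeZl => //.
rewrite -integral_planar_kernel.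
have [_ <-] := integral_space_prod (@planar_kernel_ge0 R) (integrable_planar_kernel R) integrable_on_line.
have iM : (plane R).-integrable setT (EFin \o (fun z => M * \1_(square rho) z)%R).
  exact: integrable_square_indic.
have [idom _] := integral_space_prod (@planar_kernel_ge0 R) (integrable_planar_kernel R) iM.
have ck : continuous (fun x : 'R4 R => planar_kernel x.1).
  by move=> x; apply: (@continuous_comp _ _ _ fst (@planar_kernel R)); [exact: cvg_fst|exact: continuous_planar_kernel].
have cfs t : continuous (fun x => f (shear t x)).
  by move=> x; apply: (@continuous_comp _ _ _ (shear t) f); [exact: continuous_shear|exact: cf].
have mF t : measurable_fun setT (fun x => (planar_kernel x.1 * f (shear t x))%:E).
  apply/measurable_EFinP; apply: continuous_measurable4 => x.
  by apply: cvgM; [exact: ck|exact: cfs].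
have pointwise x : (planar_kernel x.1 * f (shear (r n) x))%:E @[n --> \oo] --> (planar_kernel x.1 * on_line x.2)%:E.
  apply: cvg_EFin; first by near=> n.
  apply: cvgM; first exact: cvg_cst.
  rewrite (_ : on_line x.2 = f (shear 0 x)); last by rewrite /shear scale0r add0r.
  have r_cvg : r n @[n --> \oo] --> (0 : R)%R.
    by rewrite -[X in _ --> X](mul0r (Num.sqrt q)^-1%R); apply: cvgM; [exact: cvg_harmonic|exact: cvg_cst].
  apply: (cvg_comp r (fun t => f (shear t x)) r_cvg).
  apply: (@continuous_comp _ _ _ (fun t => shear t x) f); last exact: cf.
  apply: continuous_pair => y; last exact: cvg_cst.
  by apply: cvgD; last exact: cvg_cst; apply: cvgZl; exact: cvg_id.
have bound x n : (`|(planar_kernel x.1 * f (shear (r n) x))%:E| <= (planar_kernel x.1 * (M * \1_(square rho) x.2))%:E)%E.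
  rewrite lee_fin normrM (ger0_norm (planar_kernel_ge0 _)).
  by apply: ler_wpM2l; [exact: planar_kernel_ge0|exact: fM].
have [_ _ lim] := @dominated_convergence _ _ R (space R) setT measurableT
  (fun n x => (planar_kernel x.1 * f (shear (r n) x))%:E) (fun x => (planar_kernel x.1 * on_line x.2)%:E)
  _ (fun n => mF (r n)) (measurable_int _ (integral_space_prod (@planar_kernel_ge0 R) (integrable_planar_kernel R) integrable_on_line).1)
  (aeW _ (fun x _ => pointwise x)) idom (aeW _ (fun x n _ => bound x n)).
exact: lim.
Unshelve. all: by end_near. Qed.

(** The line is parametrized in kappa_cvg by its second coordinate z, and in fibre integrals
    by t |-> t v; the factor q is the Jacobian of t |-> v_1 t. *)
Lemma integral_line : \int[plane R]_z (on_line z)%:E =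
  q%:E * \int[plane R]_t (f (ofC2 ((t.1 +i* t.2) *: v)))%:E.
Proof.
have qn : (complex.Re (v 0 1) ^+ 2 + complex.Im (v 0 1) ^+ 2 != 0)%R by rewrite gt_eqF.
have [_] := integral_scales (scales_complex 0 0 qn) integrable_on_line.
have fn := integrable_fin_num measurableT integrable_on_line.
have E (t : R * R) : on_line (complex.Re (v 0 1) * t.1 - complex.Im (v 0 1) * t.2 + 0,
     complex.Im (v 0 1) * t.1 + complex.Re (v 0 1) * t.2 + 0)%R = f (ofC2 ((t.1 +i* t.2) *: v)).
  by rewrite /on_line polar_line_param.
rewrite (eq_integral _ _ (fun t _ => congr1 EFin (E t))) => ->.
by rewrite muleA -EFinM divff// mul1e.
Qed.

End KappaLimit.

Section KappaLimitGeneral.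
Variable R : realType.
Implicit Types (v : 'C2 R) (f : 'R4 R -> R) (K : set ('R4 R)) (x : 'R4 R).

Definition swap4 x : 'R4 R := (x.2, x.1).
Definition swapC v : 'C2 R := \row_j v 0 (1 - j).

Lemma swapC0 v : swapC v 0 0 = v 0 1.
Proof. by rewrite mxE subr0. Qed.
Lemma swapC1 v : swapC v 0 1 = v 0 0.
Proof. by rewrite mxE subrr. Qed.

Lemma det2_swap v x : det2 (toC2 (swap4 x)) v = - det2 (toC2 x) (swapC v).
Proof. by rewrite /det2 swapC0 swapC1 !mxE /= opprB. Qed.

Lemma sqnN (a : R[i]) : sqn (- a) = sqn a.
Proof. by case: a => p q; rewrite /sqn /= !sqrrN. Qed.

Lemma kappa_swap v (e : R) x : kappa v e (swap4 x) = kappa (swapC v) e x.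
Proof. by rewrite /kappa !reg_sqE det2_swap sqnN. Qed.

Lemma continuous_swap4 : continuous swap4.
Proof. by apply: continuous_pair => x; [exact: cvg_snd|exact: cvg_fst]. Qed.

Lemma neq0_coord v : v != 0 -> v 0 1 != 0 \/ v 0 0 != 0.
Proof.
move=> v0; have [e1|] := eqVneq (v 0 1) 0; [right|by left].
apply: contra_neq v0 => e0; apply/rowP => i; rewrite mxE.
by case: i => [[|[|]]]//= hi; [rewrite -e0|rewrite -e1]; congr (v _ _); apply: val_inj.
Qed.

Local Open Scope ereal_scope.

(** The functions kappa are an approximate identity along the line of v.  The case v_1 = 0
    follows from the other one by exchanging the two coordinates. *)
Lemma kappa_limit v f K : v != 0%R -> compact K -> continuous f -> vanishes_off K f ->
  (plane R).-integrable setT (fun t => (f (ofC2 ((t.1 +i* t.2) *: v)))%:E) /\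
  \int[space R]_x (kappa v n.+1%:R^-1 x * f x)%:E @[n --> \oo] -->
  (pi : R)%:E * \int[plane R]_t (f (ofC2 ((t.1 +i* t.2) *: v)))%:E.
Proof.
have main (u : 'C2 R) (g : 'R4 R -> R) (L : set ('R4 R)) : u 0%R 1%R != 0%R -> compact L -> continuous g -> vanishes_off L g ->
    (plane R).-integrable setT (fun t => (g (ofC2 ((t.1 +i* t.2) *: u)))%:E) /\
    \int[space R]_x (kappa u n.+1%:R^-1 x * g x)%:E @[n --> \oo] -->
    (pi : R)%:E * \int[plane R]_t (g (ofC2 ((t.1 +i* t.2) *: u)))%:E.
  move=> u1 cL cg gL.
  have q0 : (0 < sqn (u 0%R 1%R))%R by exact: sqn_gt0.
  split.
    have qn : (complex.Re (u 0%R 1%R) ^+ 2 + complex.Im (u 0%R 1%R) ^+ 2 != 0)%R by rewrite gt_eqF.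
    have [H _] := integral_scales (scales_complex 0 0 qn) (integrable_on_line u cL cg gL).
    by apply: eq_integrable H => // t _; rewrite /= polar_line_param.
  have := kappa_cvg u1 cL cg gL; rewrite (integral_line u1 cL cg gL).
  by rewrite muleA -EFinM mulrAC mulVf ?gt_eqF// mul1r.
move=> v0 cK cf fK; have [v1|v1] := neq0_coord v0; first exact: (main v f K v1 cK cf fK).
pose g x := f (swap4 x); have cg : continuous g.
  by move=> x; apply: (@continuous_comp _ _ _ swap4 f); [exact: continuous_swap4|exact: cf].
have cL : compact (swap4 @` K).
  by apply: continuous_compact => //; apply: continuous_subspaceT; exact: continuous_swap4.
have gL : vanishes_off (swap4 @` K) g.
  by move=> x Kx; apply: fK => h; apply: Kx; exists (swap4 x) => //; case: x {h}.
have u1 : swapC v 0%R 1%R != 0%R by rewrite swapC1.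
have E (t : R * R) : g (ofC2 ((t.1 +i* t.2) *: swapC v)) = f (ofC2 ((t.1 +i* t.2) *: v)).
  by rewrite /g /ofC2 /swap4 /=; congr f; rewrite !mxE subr0 subrr.
have [i1 l1] := main _ _ _ u1 cL cg gL; split.
  by apply: eq_integrable i1 => // t _; rewrite E.
move: l1; under eq_integral do rewrite E; move=> l1.
rewrite (_ : (fun n => _) = fun n => \int[space R]_x (kappa (swapC v) n.+1%:R^-1 x * g x)%:E)//.
apply/funext => n.
have en : (0 < n.+1%:R^-1 :> R)%R by rewrite invr_gt0.
have ig : (space R).-integrable setT (EFin \o (fun x => kappa v n.+1%:R^-1 x * f x)%R).
  apply: (integrable_cpt cK) => [|x Kx]; last by rewrite fK ?mulr0.
  by move=> x; apply: cvgM; [exact: continuous_kappa|exact: cf].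
have [_] := integral_scales (@scales_swap4 R) ig; rewrite mul1e => <-.
by apply: eq_integral => x _; rewrite /= -kappa_swap.
Qed.

End KappaLimitGeneral.

(** * Local integrability of the logarithm of a linear form *)

Section LogarithmBound.
Variable R : realType.
Local Notation C := R[i].
Implicit Types (v : 'C2 R) (x : 'R4 R) (a : C).

(** As ln 0 = 0, this is 0 at a = 0, a value taken only on null sets below. *)
Definition lognorm a : R := ln (sqn a) / 2.

Lemma continuous_coord_line v : continuous (fun x => sqn (det2 (toC2 x) v)).
Proof.
have E : (fun x => sqn (det2 (toC2 x) v)) = (fun x => reg_sq v 1 x - 1 ^+ 2).
  by apply/funext => x; rewrite reg_sqE addrK.
by rewrite E => x; apply: cvgB; [exact: continuous_reg_sq|exact: cvg_cst].
Qed.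

Lemma measurable_lognorm v : measurable_fun setT (fun x => lognorm (det2 (toC2 x) v)).
Proof.
apply: measurable_funM; last exact: measurable_cst.
apply: (@measurableT_comp _ _ _ _ _ _ (@ln R)); first exact: measurable_ln.
by apply: continuous_measurable4; exact: continuous_coord_line.
Qed.

Lemma measurable_origin : measurable [set (0 : R * R)].
Proof.
rewrite (_ : [set _] = [set 0] `*` [set 0]); first by apply: measurableX; exact: measurable_set1.
by apply/seteqP; split => -[a b] /= [-> ->].
Qed.

Lemma plane_origin : plane R [set 0] = 0%E.
Proof.
rewrite (_ : [set _] = [set 0] `*` [set 0]); last by apply/seteqP; split => -[a b] /= [-> ->].
rewrite /plane /= /square_measure product_measure1E; [|exact: measurable_set1..].
by apply: etrans (mul0e _); congr (_ * _)%E; exact: lebesgue_measure_set1.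
Qed.

(** A shear carries the line of v to the set x_0 = 0. *)
Lemma null_line v : v != 0 -> measurable [set x | det2 (toC2 x) v = 0] /\
  space R [set x | det2 (toC2 x) v = 0] = 0%E.
Proof.
have mA u : measurable [set x : 'R4 R | det2 (toC2 x) u = 0].
  rewrite (_ : mkset _ = (fun x => sqn (det2 (toC2 x) u)) @^-1` [set 0]).
    rewrite -[X in measurable X]setTI; apply: continuous_measurable4 => //.
    exact: continuous_coord_line.
  by apply/seteqP; split => x /= => [->|/eqP]; [rewrite /sqn /= expr0n addr0|rewrite sqn_eq0 => /eqP].
have main (u : 'C2 R) : u 0 1 != 0 -> space R [set x | det2 (toC2 x) u = 0] = 0%E.
  move=> u1.
  have cl : continuous (fun z => - polar_line u z).
    by move=> z; apply: cvgN; exact: continuous_polar_line.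
  have := scales_null (scales_shear cl (oner_neq0 R)) (measurableX (measurable_origin) (@measurableT _ (R * R)%type)).
  rewrite /space /= /square_measure product_measure1E; [|exact: measurable_origin|exact: measurableT].
  move=> /(_ (etrans (congr1 (fun t => t * _)%E plane_origin) (mul0e _))).
  rewrite (_ : _ @^-1` _ = [set x | det2 (toC2 x) u = 0])//.
  apply/seteqP; split => x /=.
    case=> + _; rewrite scale1r => /eqP; rewrite subr_eq0 => /eqP E.
    have -> : x = shear u 1 ((0, 0), x.2) by rewrite /shear scale1r /= -E; case: x {E} => a b; rewrite [_ + a]add0r.
    by rewrite det2_shear// mulr0.
  move=> d0; split=> //; move: d0.
  have -> : x = shear u 1 (1 *: x.1 - polar_line u x.2, x.2).
    by rewrite /shear !scale1r /= subrK; case: x.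
  rewrite det2_shear// mul1r => /eqP; rewrite mulf_eq0 (negbTE u1) /= => /eqP[h1 h2].
  by rewrite /shear /= !scale1r subrK; apply: injective_projections; move: h1 h2; rewrite !scale1r.
move=> v0; split => //; have [v1|v1] := neq0_coord v0; first exact: main.
have u1 : swapC v 0 1 != 0 by rewrite swapC1.
have := scales_null (@scales_swap4 R) (mA _) (main _ u1).
rewrite (_ : _ @^-1` _ = [set x | det2 (toC2 x) v = 0])//.
apply/seteqP; split => x /=; have := det2_swap v (swap4 x); rewrite /swap4 -surjective_pairing /= => ->.
  by move=> ->; rewrite oppr0.
by move=> /eqP; rewrite oppr_eq0 => /eqP.
Qed.

(** An integrable majorant of |ln |a|| near 0, of which the integral is a geometric series: the
    number of n such that |a| <= exp(- n). *)
Definition log_majorant (a : R) : \bar R := (\sum_(n <oo) (\1_(`[- expR (- n%:R), expR (- n%:R)]%classic) a)%:E)%E.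

Lemma log_majorant_ge (a t : R) : 0 <= t -> `|a| <= expR (- t) -> (t%:E <= log_majorant a)%E.
Proof.
move=> t0 at1.
have h0 n : (0 <= (\1_(`[- expR (- n%:R), expR (- n%:R)]%classic : set R) a : R)%:E)%E by rewrite lee_fin.
have := truncn_itv t0; set N := Num.truncn t => /andP[Nt tN].
apply: (@le_trans _ _ (N.+1%:R%:E)%E); first by rewrite lee_fin ltW.
apply: (le_trans _ (@nneseries_lim_ge _ _ xpredT 0 N.+1 (fun n _ _ => h0 n))).
rewrite big_mkord (eq_bigr (fun=> 1%E)) => [|i _].
  by rewrite sumEFin sumr_const card_ord.
congr EFin; rewrite indicE mem_set//= in_itv /= -ler_norml.
apply: (le_trans at1); rewrite ler_expR lerN2 (le_trans _ Nt)// ler_nat.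
by rewrite -ltnS.
Qed.

Lemma integral_log_majorant : (\int[@lebR R]_a log_majorant a < +oo)%E.
Proof.
have mI n : measurable (`[- expR (- n%:R), expR (- n%:R)]%classic : set R) by exact: measurable_itv.
rewrite /log_majorant integral_nneseries//; last first.
  by move=> n; apply/measurable_EFinP; exact: measurable_indic.
rewrite (eq_eseriesr (g := fun n => (2 * expR (- 1) ^+ n)%:E)) => [|n _].
  have e1 : `|expR (- 1)| < 1 :> R by rewrite ger0_norm ?expR_ge0// expR_lt1 ltrN10.
  have H := @cvg_geometric_series R 2 (expR (- 1)) e1.
  have -> : (\sum_(n <oo) (2 * expR (- 1) ^+ n : R)%:E)%E = (2 / (1 - expR (- 1)))%:E; last by rewrite ltry.
  apply/cvg_lim => //; apply: cvg_EFin; first by apply: nearW => n; rewrite sumEFin.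
  apply: cvg_trans H; apply: near_eq_cvg; apply: nearW => n.
  by rewrite /= sumEFin /series /=.
rewrite integral_indic// setIT [X in X = _]lebR_itv /= lte_fin gtrN ?expR_gt0// -EFinB opprK.
rewrite (_ : expR (- n%:R) = expR (- 1) ^+ n); last by rewrite -expRM_natl mulrN1.
by congr EFin; ring.
Qed.

Lemma log_majorant_ge0 (a : R) : (0 <= log_majorant a)%E.
Proof. by apply: nneseries_ge0 => n _ _; rewrite lee_fin. Qed.

Lemma measurable_log_majorant : measurable_fun setT log_majorant.
Proof.
apply: ge0_emeasurable_sum => [n x _ _|n _]; first by rewrite lee_fin.
by apply/measurable_EFinP; apply: measurable_indic; exact: measurable_itv.
Qed.

(** Where the logarithm is negative, |s| >= |s.1| reduces the singularity to one real variable;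
    elsewhere the logarithm is bounded on the square. *)
Lemma lognorm_le (r : R) (s : R * R) : square r s ->
  (`|lognorm (s.1 +i* s.2)|%:E <= log_majorant s.1 + (ln (r ^+ 2 + r ^+ 2 + 1) / 2)%:E)%E.
Proof.
case: s => a b; rewrite /square /= !in_itv /= -!ler_norml => -[ar br].
have sq t : `|t| <= r -> t ^+ 2 <= r ^+ 2 by move=> tr; rewrite -[t ^+ 2]real_normK ?num_real// lerXn2r ?nnegrE// (le_trans _ tr).
have c0 : 0 <= ln (r ^+ 2 + r ^+ 2 + 1) / 2.
  by rewrite divr_ge0// ln_ge0// lerDr addr_ge0 ?sqr_ge0.
have uE : sqn (a +i* b) = a ^+ 2 + b ^+ 2 by [].
have u0 := sqn_ge0 (a +i* b).
rewrite /lognorm; have [l0|l0] := leP 0 (ln (sqn (a +i* b))).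
  rewrite ger0_norm ?divr_ge0//; apply: (@le_trans _ _ (ln (r ^+ 2 + r ^+ 2 + 1) / 2)%:E); last first.
    by rewrite leeDr// log_majorant_ge0.
  rewrite lee_fin ler_pM2r ?invr_gt0//.
  have [u1|u1] := leP (sqn (a +i* b)) 0.
    by rewrite ln0// ln_ge0// lerDr addr_ge0 ?sqr_ge0.
  rewrite ler_ln ?posrE//; last by rewrite ltr_wpDl// addr_ge0 ?sqr_ge0.
  by rewrite uE -[X in X <= _]addr0 lerD// lerD// sq.
have u1 : 0 < sqn (a +i* b) by rewrite ltNge; apply/negP => u1; rewrite ln0// ltxx in l0.
rewrite ler0_norm; last by rewrite pmulr_lle0 ?invr_gt0// ltW.
apply: (@le_trans _ _ (log_majorant a)); last by rewrite leeDl// lee_fin.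
apply: log_majorant_ge.
  by rewrite oppr_ge0 pmulr_lle0 ?invr_gt0// ltW.
rewrite opprK -ler_sqr ?nnegrE ?expR_ge0// -expRM_natr mulfVK// lnK ?posrE//.
by rewrite real_normK ?num_real// uE lerDl sqr_ge0.
Qed.

Lemma measurable_planar_lognorm : measurable_fun setT (fun s : R * R => lognorm (s.1 +i* s.2)).
Proof.
apply: measurable_funM; last exact: measurable_cst.
apply: (@measurableT_comp _ _ _ _ _ _ (@ln R)); first exact: measurable_ln.
apply: continuous_measurable2 => s; apply: cvgD; apply: cvgM; (exact: cvg_fst || exact: cvg_snd).
Qed.

(** The unit sphere of the supremum norm, for which one coordinate has modulus exactly 1: this
    keeps the slope of the line of v bounded in polar_line_le. *)
Definition unit_vec v : Prop :=
  [/\ (sqn (v 0 0) <= 1), (sqn (v 0 1) <= 1) & sqn (v 0 0) = 1 \/ sqn (v 0 1) = 1].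

Lemma polar_line_le v (r : R) (z : R * R) : unit_vec v -> sqn (v 0 1) = 1 -> square r z ->
  square (r + r) (polar_line v z).
Proof.
move=> [v0 _ _] v1; rewrite /square /= !in_itv /= -!ler_norml => -[z1 z2].
have : (sqn (v 0 0 / v 0 1) <= 1).
  by have := sqnM (v 0 0 / v 0 1) (v 0 1); rewrite divfK ?v1 ?mulr1 => [<-//|]; rewrite -sqn_eq0 v1 oner_neq0.
rewrite /polar_line; case: (v 0 0 / v 0 1) => a b; rewrite /sqn /= => ab.
have a1 : (`|a| <= 1).
  by rewrite -(ler_sqr) ?nnegrE// real_normK ?num_real// expr1n (le_trans _ ab)// lerDl sqr_ge0.
have b1 : (`|b| <= 1).
  by rewrite -(ler_sqr) ?nnegrE// real_normK ?num_real// expr1n (le_trans _ ab)// lerDr sqr_ge0.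
have M t s : (`|t| <= 1 -> `|s| <= r -> `|t * s| <= r).
  by move=> t1 sr; rewrite normrM -[r in (_ <= r)]mul1r ler_pM.
split; first by rewrite (le_trans (ler_normB _ _))// lerD// M.
by rewrite (le_trans (ler_normD _ _))// lerD// M.
Qed.

Local Open Scope ereal_scope.

Lemma planar_log_integrable (r : R) : (plane R).-integrable setT
  (fun s : R * R => (\1_(square r) s * `|lognorm (s.1 +i* s.2)|)%:E).
Proof.
have mI : measurable (`[(- r)%R, r]%classic : set R) by exact: measurable_itv.
apply/integrableP; split.
  apply/measurable_EFinP; apply: measurable_funM.
    by apply: measurable_indic; exact: measurable_square.
  by apply: measurableT_comp => //; exact: measurable_planar_lognorm.
pose c : R := (ln (r ^+ 2 + r ^+ 2 + 1) / 2)%R.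
have c0 : (0 <= c)%R by rewrite divr_ge0// ln_ge0// lerDr addr_ge0 ?sqr_ge0.
have I0 (a : R) : 0 <= (\1_(`[(- r)%R, r]%classic : set R) a : R)%:E by rewrite lee_fin.
pose g (a : R) := log_majorant a + c%:E * (\1_(`[(- r)%R, r]%classic : set R) a)%:E.
have g0 (a : R) : 0 <= g a by rewrite adde_ge0 ?log_majorant_ge0 ?mule_ge0.
have mII : measurable_fun setT (fun a : R => (\1_(`[(- r)%R, r]%classic : set R) a : R)%:E).
  by apply/measurable_EFinP; exact: measurable_indic.
have mg : measurable_fun setT g.
  apply: emeasurable_funD; first exact: measurable_log_majorant.
  by apply: measurable_funeM.
have jg : \int[@lebR R]_a g a < +oo.
  rewrite ge0_integralD//; [|by move=> a _; exact: log_majorant_ge0|exact: measurable_log_majorant|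
    by move=> a _; rewrite mule_ge0|exact: measurable_funeM].
  rewrite ge0_integralZl// integral_indic// setIT.
  apply: lte_add_pinfty; first exact: integral_log_majorant.
  apply: lte_mul_pinfty => //; rewrite [X in X < _]lebR_itv /=.
  by case: ifP => // _; rewrite -EFinB ltry.
have mgs : measurable_fun setT (fun s : R * R => g s.1 * (\1_(`[(- r)%R, r]%classic : set R) s.2)%:E).
  apply: emeasurable_funM.
    by apply: (measurableT_comp mg); exact: measurable_fst.
  by apply: (measurableT_comp mII); exact: measurable_snd.
apply: (@le_lt_trans _ _ (\int[plane R]_s (g s.1 * (\1_(`[(- r)%R, r]%classic : set R) s.2)%:E))).
  apply: ge0_le_integral => //.
  - apply: measurableT_comp => //; apply/measurable_EFinP; apply: measurable_funM.
      by apply: measurable_indic; exact: measurable_square.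
    by apply: measurableT_comp => //; exact: measurable_planar_lognorm.
  - move=> s _; rewrite gee0_abs ?lee_fin ?mulr_ge0// [X in (X * _)%R]indicE.
    case: (boolP (s \in square r)) => [/set_mem sr|_]; last by rewrite mul0r mule_ge0.
    rewrite mul1r; apply: (le_trans (lognorm_le sr)).
    by move: sr; rewrite /square /= /g => -[s1 s2]; rewrite !indicE !mem_set// !mule1.
rewrite /plane /= /square_measure (@fubini_tonelli1 _ _ _ _ R (@lebR R) (@lebR R))//; last first.
  by move=> s; rewrite mule_ge0.
rewrite /fubini_F /= (eq_integral (fun a : R => @lebR R `[(- r)%R, r]%classic * g a)) => [|a _]; last first.
  by rewrite ge0_integralZl// integral_indic// setIT muleC.
rewrite ge0_integralZl//.
apply: lte_mul_pinfty => //.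
rewrite [X in X \is a _]lebR_itv /=; by case: ifP => // _; rewrite -EFinB.
Qed.

(** The shear of slope v_0 / v_1, of modulus at most 1, maps the box into a larger one and turns
    the linear form into the first coordinate, up to a factor of modulus 1; what remains is the
    integral of |log |s|| over a square, times an area.  If |v_1| < 1 the two coordinates are
    exchanged first. *)
Lemma lognorm_bound (r : R) : (0 <= r)%R -> exists c : R, forall v, unit_vec v ->
  \int[space R]_x (\1_(box r) x * `|lognorm (det2 (toC2 x) v)|)%:E <= c%:E.
Proof.
move=> r0.
have iS : (plane R).-integrable setT (EFin \o (fun s => 1 * \1_(square r) s)%R).
  exact: integrable_square_indic.
have pos (s : R * R) : (0 <= \1_(square (r + (r + r))%R) s * `|lognorm (s.1 +i* s.2)|)%R by rewrite mulr_ge0.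
have [jB eB] := integral_space_prod pos (planar_log_integrable (r + (r + r))) iS.
pose B := \int[space R]_x ((\1_(square (r + (r + r))%R) x.1 * `|lognorm (x.1.1 +i* x.1.2)|) * (1 * \1_(square r) x.2))%:E.
exists (fine B) => v uv; rewrite fineK; last exact: (integrable_fin_num measurableT jB).
have mG u : measurable_fun setT (fun x : 'R4 R => (\1_(box r) x * `|lognorm (det2 (toC2 x) u)|)%:E).
  apply/measurable_EFinP; apply: measurable_funM.
    by apply: measurable_indic; exact: box_measurable.
  by apply: measurableT_comp => //; exact: measurable_lognorm.
have main (u : 'C2 R) : unit_vec u -> sqn (u 0%R 1%R) = 1%R ->
    \int[space R]_x (\1_(box r) x * `|lognorm (det2 (toC2 x) u)|)%:E <= B.
  move=> uu u1; have u1' : (u 0 1 != 0)%R by rewrite -sqn_eq0 u1 oner_neq0.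
  have [_ _ /(_ _ (mG u))] := scales_shear (@continuous_polar_line R u) (oner_neq0 R).
  rewrite expr1n invr1 mul1e => <-; last by move=> x; rewrite lee_fin mulr_ge0.
  apply: ge0_le_integral => //.
  - apply: (measurableT_comp (mG u)); by have [] := scales_shear (@continuous_polar_line R u) (oner_neq0 R).
  - exact: measurable_int jB.
  move=> x _; rewrite lee_fin -/(shear u 1 x) det2_shear//.
  have -> : lognorm (1%:C * u 0%R 1%R * (x.1.1 +i* x.1.2))%R = lognorm (x.1.1 +i* x.1.2).
    by rewrite /lognorm mul1r sqnM u1 mul1r.
  rewrite [X in (X * _ <= _)%R]indicE; case: (boolP (shear u 1 x \in box r)) => [/set_mem|_]; last first.
    by rewrite mul0r !mulr_ge0.
  rewrite boxE /shear /= scale1r => -[/= h1 h2].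
  rewrite (_ : \1_(square (r + (r + r))) x.1 = 1%R) ?mul1r; last first.
    rewrite indicE mem_set//; have := polar_line_le uu u1 h2; move: h1.
    rewrite /square /= !in_itv /= -!ler_norml => -[p1 p2] [p3 p4].
    split.
      by rewrite -[x.1.1](addrK (polar_line u x.2).1) (le_trans (ler_normB _ _))// lerD.
    by rewrite -[x.1.2](addrK (polar_line u x.2).2) (le_trans (ler_normB _ _))// lerD.
  by rewrite indicE (mem_set h2) mulr1.
have [v0 v1 [v2|v2]] := uv; last exact: main.
have [_ _ /(_ _ (mG v))] := @scales_swap4 R; rewrite mul1e => <-; last by move=> x; rewrite lee_fin mulr_ge0.
rewrite (eq_integral (fun x => (\1_(box r) x * `|lognorm (det2 (toC2 x) (swapC v))|)%:E)) => [|x _]; last first.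
  rewrite -/(swap4 x) /lognorm det2_swap sqnN; congr (_ * _)%:E; rewrite !indicE.
  have B4 y : box r y -> box r (swap4 y) by rewrite !boxE => -[].
  case: (boolP (x \in box r)) => [/set_mem h|]; first by rewrite mem_set//; exact: B4.
  by rewrite notin_setE => h; rewrite memNset// => /B4; rewrite /swap4 -surjective_pairing.
apply: main; last by rewrite swapC1.
by split; rewrite ?swapC0 ?swapC1//; right.
Qed.

End LogarithmBound.

Section LogarithmicPotential.
Variable R : realType.
Local Notation C := R[i].
Implicit Types (u v : 'C2 R) (x : 'R4 R) (f g : 'R4 R -> R) (K : set ('R4 R)).

Lemma unit_normalize v : v != 0 -> exists m u, [/\ 0 < m :> R, unit_vec u & v = m%:C *: u].
Proof.
move=> v0; pose q : R := Num.max (sqn (v 0 0)) (sqn (v 0 1)).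
have q0 : 0 < q.
  by rewrite lt_max; have [/sqn_gt0->|/sqn_gt0->] := neq0_coord v0; rewrite ?orbT.
have m0 : 0 < Num.sqrt q by rewrite sqrtr_gt0.
have mC : (Num.sqrt q)%:C != 0 :> C by rewrite eq_complex /= eqxx andbT gt_eqF.
exists (Num.sqrt q), ((Num.sqrt q)%:C^-1 *: v); split => //; last by rewrite scalerA divff ?scale1r.
have sE a : sqn ((Num.sqrt q)%:C^-1 * a) = sqn a / q.
  rewrite sqnM mulrC; congr (_ * _).
  have := sqnM (Num.sqrt q)%:C (Num.sqrt q)%:C^-1; rewrite divff//.
  rewrite {2}/sqn /= expr0n addr0 sqr_sqrtr ?ltW// => H.
  apply: (mulfI (lt0r_neq0 q0)); rewrite -H divff ?gt_eqF//.
  by rewrite /sqn /= expr1n expr0n addr0.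
split; rewrite !mxE !sE ?ler_pdivrMr ?mul1r ?le_max ?lexx ?orbT//.
have [h|h] : q = sqn (v 0 0) \/ q = sqn (v 0 1).
- by rewrite /q /Num.max; case: ifP; [right|left].
- by left; rewrite -h divff// gt_eqF.
- by right; rewrite -h divff// gt_eqF.
Qed.

Lemma lognormM (a b : C) : a != 0 -> b != 0 -> lognorm (a * b) = lognorm a + lognorm b.
Proof. by move=> a0 b0; rewrite /lognorm sqnM lnM ?posrE ?sqn_gt0// mulrDl. Qed.

Lemma lognorm0 : lognorm (0 : C) = 0.
Proof. by rewrite /lognorm /sqn /= expr0n addr0 ln0// mul0r. Qed.

Lemma lognorm_real (m : R) : 0 < m -> lognorm m%:C = ln m.
Proof.
move=> m0; rewrite /lognorm /sqn /= expr0n addr0 lnXn//.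
by rewrite -[_ *+ 2]mulr_natr -mulrA divff ?mulr1// pnatr_eq0.
Qed.

Local Open Scope ereal_scope.

Lemma lognorm_integrable v (r : R) : v != 0%R -> (space R).-integrable setT
  (fun x => (\1_(box r) x * lognorm (det2 (toC2 x) v))%:E).
Proof.
move=> v0; have [r0|r0] := leP 0%R r; last first.
  rewrite (_ : (fun x => _) = cst 0); first exact: integrable0.
  apply/funext => x; rewrite indicE memNset ?mul0r// /box /= => h.
  by have := le_lt_trans h r0; rewrite normr_lt0.
have [m [u [m0 uu vE]]] := unit_normalize v0.
have mC : m%:C != 0%R :> C by rewrite eq_complex /= eqxx andbT gt_eqF.
have ml w : measurable_fun setT (fun x => (\1_(box r) x * lognorm (det2 (toC2 x) w))%:E).
  apply/measurable_EFinP; apply: measurable_funM; last exact: measurable_lognorm.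
  by apply: measurable_indic; exact: box_measurable.
have [c cB] := lognorm_bound r0.
have iu : (space R).-integrable setT (fun x => (\1_(box r) x * lognorm (det2 (toC2 x) u))%:E).
  apply/integrableP; split; first exact: ml.
  apply: le_lt_trans (ltry c); apply: le_trans (cB _ uu).
  rewrite le_eqVlt; apply/orP; left; apply/eqP; apply: eq_integral => x _ /=.
  by rewrite normrM ger0_norm.
have im := integrable_box_indic r `|ln m|%R.
have := integrableD measurableT im (integrable_abse iu).
apply: le_integrable => //.
move=> x _ /=; rewrite !lee_fin vE det2Zr.
rewrite [leRHS]ger0_norm; last by rewrite addr_ge0 ?mulr_ge0.
rewrite ![`|\1_(box r) x * _|%R]normrM !(@ger0_norm _ (\1_(box r) x))// [(`|ln m| * _)%R]mulrC -mulrDr ler_wpM2l//.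
have [->|d0] := eqVneq (det2 (toC2 x) u) 0%R; first by rewrite mulr0 lognorm0 normr0 addr0.
by rewrite lognormM// lognorm_real// ler_normD.
Qed.

Lemma logM_integrable v g K : v != 0%R -> compact K -> continuous g -> vanishes_off K g ->
  (space R).-integrable setT (fun x => (lognorm (det2 (toC2 x) v) * g x)%:E).
Proof.
move=> v0 cK cg gK; have [r [r0 Kr]] := compact_bounded4 cK.
have [M M0 gM] := continuous_cpt_bounded cK cg gK.
have := integrableZl measurableT M (integrable_abse (lognorm_integrable r v0)).
apply: le_integrable => //.
  apply/measurable_EFinP; apply: measurable_funM; first exact: measurable_lognorm.
  exact: continuous_measurable4.
move=> x _ /=; rewrite lee_fin normrM [leRHS]ger0_norm; last by rewrite mulr_ge0// ltW.
have [Kx|/gK ->] := pselect (K x); last by rewrite normr0 mulr0 mulr_ge0// ltW.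
by rewrite indicE mem_set ?mul1r 1?mulrC ?ler_wpM2r//; exact: Kr.
Qed.

Lemma not_on_line v : v != 0%R -> {ae space R, forall x, det2 (toC2 x) v != 0%R}.
Proof.
move=> v0; have [mZ Z0] := null_line v0; exists [set x | det2 (toC2 x) v = 0%R]; split => //.
by move=> x /= /negP; rewrite negbK => /eqP.
Qed.

(** On the support of g the regularized logarithm lies between the logarithm and a constant,
    which dominates the convergence. *)
Lemma reg_log_cvg v g K : v != 0%R -> compact K -> continuous g -> vanishes_off K g ->
  \int[space R]_x (reg_log v n.+1%:R^-1 x * g x)%:E @[n --> \oo] -->
  \int[space R]_x (lognorm (det2 (toC2 x) v) * g x)%:E.
Proof.
move=> v0 cK cg gK; have [r [r0 Kr]] := compact_bounded4 cK.
have [M M0 gM] := continuous_cpt_bounded cK cg gK.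
have csq := @continuous_coord_line R v.
have [U [U0 UB]] : exists U : R, (0 <= U)%R /\ forall x, K x -> (sqn (det2 (toC2 x) v) <= U)%R.
  have cI : compact ((fun x => sqn (det2 (toC2 x) v)) @` K).
    by apply: continuous_compact => //; exact: continuous_subspaceT.
  have [U [_ KU]] := compact_bounded cI.
  exists (Num.max 0 (U + 1))%R; split; first by rewrite le_max lexx.
  move=> x bx; rewrite le_max; apply/orP; right.
  by apply: (le_trans (ler_norm _)); apply: (KU (U + 1)%R); [rewrite ltrDl|exists x].
pose c : R := (ln (U + 1) / 2)%R.
have c0 : (0 <= c)%R by rewrite divr_ge0// ln_ge0// lerDr.
have e0 (n : nat) : (0 < n.+1%:R^-1 :> R)%R by rewrite invr_gt0.
have e1 (n : nat) : (n.+1%:R^-1 ^+ 2 <= 1 :> R)%R by rewrite exprn_ile1 ?(ltW (e0 n))// invf_le1 ?ler1n ?ltr0n.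
have bound x n : det2 (toC2 x) v != 0%R -> K x ->
    (`|reg_log v n.+1%:R^-1 x| <= `|lognorm (det2 (toC2 x) v)| + c)%R.
  move=> d0 bx; have u0 := sqn_gt0 d0.
  rewrite /reg_log /lognorm reg_sqE; set a := sqn _ in u0 *; set t := (_ ^+ 2)%R.
  have t0 : (0 <= t)%R by rewrite sqr_ge0.
  have aU : (a + t <= U + 1)%R by rewrite lerD ?UB ?e1.
  have at0 : (0 < a + t)%R by rewrite ltr_wpDr.
  have l1 : (ln a <= ln (a + t))%R by rewrite ler_ln ?posrE// lerDl.
  have l2 : (ln (a + t) <= ln (U + 1))%R by rewrite ler_ln ?posrE// (lt_le_trans at0).
  have l3 : (ln a / 2 <= ln (a + t) / 2)%R by rewrite ler_pM2r// invr_gt0.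
  have l4 : (ln (a + t) / 2 <= c)%R by rewrite ler_pM2r// invr_gt0.
  have := ler_norm (- (ln a / 2))%R; rewrite normrN => h.
  have h2 : (0 <= `|ln a / 2|)%R by [].
  move: (ln a / 2)%R (ln (a + t) / 2)%R (`|ln a / 2|)%R l3 l4 h h2 => p q s l3 l4 h h2.
  rewrite ler_norml; apply/andP; split; last by rewrite (le_trans l4)// lerDr.
  by apply: le_trans l3; rewrite lerNl; apply: (le_trans h); rewrite lerDl.
have mreg n : measurable_fun setT (fun x => (reg_log v n.+1%:R^-1 x * g x)%:E).
  apply/measurable_EFinP; apply: measurable_funM; apply: continuous_measurable4 => //.
  exact: continuous_reg_log.
have jlog := logM_integrable v0 cK cg gK.
have pointwise x : det2 (toC2 x) v != 0%R ->
    (reg_log v n.+1%:R^-1 x * g x)%:E @[n --> \oo] --> (lognorm (det2 (toC2 x) v) * g x)%:E.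
  move=> d0; apply: cvg_EFin; first by near=> n.
  apply: cvgM; last exact: cvg_cst.
  apply: cvgM; last exact: cvg_cst.
  apply: (@cvg_comp _ _ _ (fun n => reg_sq v n.+1%:R^-1 x) (@ln R) _ (nbhs (sqn (det2 (toC2 x) v)))); last first.
    by apply: continuous_ln; exact: sqn_gt0.
  have : reg_sq v n.+1%:R^-1 x @[n --> \oo] --> (sqn (det2 (toC2 x) v) + 0 * 0)%R.
    by apply: cvgD; [exact: cvg_cst|apply: cvgM; exact: cvg_harmonic].
  by rewrite mulr0 addr0.
have idom : (space R).-integrable setT (fun x => M%:E * (`|(\1_(box r) x * lognorm (det2 (toC2 x) v))%:E| + (c * \1_(box r) x)%:E)).
  apply: integrableZl => //; apply: integrableD => //; last exact: integrable_box_indic.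
  by apply: integrable_abse; exact: lognorm_integrable.
have dom x n : det2 (toC2 x) v != 0%R -> `|(reg_log v n.+1%:R^-1 x * g x)%:E| <=
    M%:E * (`|(\1_(box r) x * lognorm (det2 (toC2 x) v))%:E| + (c * \1_(box r) x)%:E).
  move=> d0; rewrite /= -EFinD -EFinM lee_fin normrM.
  have [Kx|/gK ->] := pselect (K x); last first.
    by rewrite normr0 mulr0 mulr_ge0 ?(ltW M0)// addr_ge0// mulr_ge0.
  rewrite indicE mem_set ?mul1r ?mulr1; last exact: Kr.
  by rewrite [leLHS]mulrC ler_pM// bound.
have ae1 : {ae space R, forall x, setT x ->
    (reg_log v n.+1%:R^-1 x * g x)%:E @[n --> \oo] --> (lognorm (det2 (toC2 x) v) * g x)%:E}.
  by apply: filterS (not_on_line v0) => x d0 _; exact: pointwise.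
have ae2 : {ae space R, forall x n, setT x -> `|(reg_log v n.+1%:R^-1 x * g x)%:E| <=
    M%:E * (`|(\1_(box r) x * lognorm (det2 (toC2 x) v))%:E| + (c * \1_(box r) x)%:E)}.
  by apply: filterS (not_on_line v0) => x d0 n _; exact: dom.
have [_ _ lim] := dominated_convergence measurableT mreg (measurable_int _ jlog) ae1 idom ae2.
exact: lim.
Unshelve. all: by end_near. Qed.

End LogarithmicPotential.

(** * The Poincare-Lelong formula for a linear form *)

Section PoincareLelongFormula.
Variable R : realType.
Local Notation C := R[i].
Variables (w : diff_form R) (K : set ('R4 R)).
Hypotheses (cK : compact K) (wK : forall I, cvanishes K (w I)) (sw : forall I, csmooth (w I)).
Implicit Types (v u : 'C2 R) (x : 'R4 R).

Definition top_coef x : C := dform (dcform w) [set: _]%SET x.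
Let W := top_coef.

Let Wre := (ddc_smooth sw).1.
Let Wim := (ddc_smooth sw).2.
Let cre : continuous (fun x => complex.Re (W x)). Proof. exact: smooth_continuous Wre. Qed.
Let cim : continuous (fun x => complex.Im (W x)). Proof. exact: smooth_continuous Wim. Qed.
Let vre : vanishes_off K (fun x => complex.Re (W x)).
Proof. by move=> x Kx; rewrite /W /top_coef (ddc_vanishes cK wK sw). Qed.
Let vim : vanishes_off K (fun x => complex.Im (W x)).
Proof. by move=> x Kx; rewrite /W /top_coef (ddc_vanishes cK wK sw). Qed.

(** The coefficient of the pullback of w by t |-> t v, up to the factor of dt /\ d conj t. *)
Definition line_coef v x : C :=
  \sum_(j < 2) \sum_(k < 2) v 0 j * conjc (v 0 k) * w [set lshift 2 j; rshift 2 k]%SET x.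

Lemma line_coef_pair v x : line_coef v x = \sum_(p : 'I_2 * 'I_2)
  (v 0 p.1 * conjc (v 0 p.2)) * w [set lshift 2 p.1; rshift 2 p.2]%SET x.
Proof. by rewrite /line_coef pair_big. Qed.

Lemma line_coef_smooth v : csmooth (line_coef v).
Proof.
rewrite (_ : line_coef v = fun x => \sum_(p : 'I_2 * 'I_2)
  (v 0 p.1 * conjc (v 0 p.2)) * w [set lshift 2 p.1; rshift 2 p.2]%SET x); last first.
  by apply/funext => x; exact: line_coef_pair.
by apply: csmooth_sum => p; exact: sw.
Qed.

Lemma line_coef_vanishes v : cvanishes K (line_coef v).
Proof. by move=> x Kx; rewrite line_coef_pair big1// => p _; rewrite wK// mulr0. Qed.

Lemma line_coef_vanishes_re v : vanishes_off K (fun x => complex.Re (line_coef v x)).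
Proof. by move=> x /line_coef_vanishes ->. Qed.

Lemma line_coef_vanishes_im v : vanishes_off K (fun x => complex.Im (line_coef v x)).
Proof. by move=> x /line_coef_vanishes ->. Qed.

Lemma cR_eq_kappa v (n : nat) : v != 0 ->
  (\int[space R]_x (reg_log v n.+1%:R^-1 x * complex.Re (W x)) =
    (2 * pi)^-1 * \int[space R]_x (kappa v n.+1%:R^-1 x * complex.Im (line_coef v x)))%R /\
  (\int[space R]_x (reg_log v n.+1%:R^-1 x * complex.Im (W x)) =
    - ((2 * pi)^-1 * \int[space R]_x (kappa v n.+1%:R^-1 x * complex.Re (line_coef v x))))%R.
Proof.
move=> v0; have e0 : 0 < n.+1%:R^-1 :> R by rewrite invr_gt0.
have E (q : 'R4 R -> R) (h : 'R4 R -> C) : cR (fun x => (q x)%:C * h x) =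
   (\int[space R]_x (q x * complex.Re (h x))) +i* (\int[space R]_x (q x * complex.Im (h x))).
  rewrite /cR; congr (_ +i* _); congr Rintegral; apply/funext => x;
  by rewrite ?ReM ?ImM /= mul0r ?subr0 ?addr0.
have := cR_reg_log_ddc cK wK sw v e0.
rewrite -/(line_coef v) (E (reg_log v n.+1%:R^-1) W).
rewrite (E (kappa v n.+1%:R^-1) (line_coef v)).
have -> : 'i%C / (2%:R * (pi : R)%:C) = 0 +i* (2 * pi)^-1.
  have -> : 2%:R * (pi : R)%:C = (2 * pi : R)%:C by rewrite rmorphM /= rmorph_nat.
  by rewrite -fmorphV; simpc.
move=> [h1 h2]; split; rewrite ?h1 ?h2; ring.
Qed.

Local Open Scope ereal_scope.

Let fine_limit (a : nat -> \bar R) (l : \bar R) : l \is a fin_num -> a n @[n --> \oo] --> l ->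
  fine (a n) @[n --> \oo] --> fine l.
Proof. by move=> lf al; apply: fine_cvg; rewrite fineK. Qed.

Lemma lognorm_W v : v != 0%R ->
  (\int[space R]_x (lognorm (det2 (toC2 x) v) * complex.Re (W x)) =
    2^-1 * \int[plane R]_t complex.Im (line_coef v (ofC2 ((t.1 +i* t.2) *: v))))%R /\
  (\int[space R]_x (lognorm (det2 (toC2 x) v) * complex.Im (W x)) =
    - (2^-1 * \int[plane R]_t complex.Re (line_coef v (ofC2 ((t.1 +i* t.2) *: v)))))%R.
Proof.
move=> v0.
have [smr smi] := line_coef_smooth v.
have [ir lr] := kappa_limit v0 cK (smooth_continuous smr) (@line_coef_vanishes_re v).
have [ii li] := kappa_limit v0 cK (smooth_continuous smi) (@line_coef_vanishes_im v).
have l1 := reg_log_cvg v0 cK cre vre.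
have l2 := reg_log_cvg v0 cK cim vim.
have f1 := integrable_fin_num measurableT (logM_integrable v0 cK cre vre).
have f2 := integrable_fin_num measurableT (logM_integrable v0 cK cim vim).
have := fine_limit f1 l1; have := fine_limit f2 l2.
have fr := integrable_fin_num measurableT ir; have fi := integrable_fin_num measurableT ii.
have := fine_limit _ lr; have := fine_limit _ li.
rewrite !fin_numM// => /(_ isT) Li /(_ isT) Lr L2 L1.
have pi0 : (pi != 0 :> R)%R by rewrite gt_eqF// pi_gt0.
split.
  apply: cvg_unique L1 _; first exact: Rhausdorff.
  rewrite (_ : (fun n => _) = (fun n => (2 * pi)^-1 *
    \int[space R]_x (kappa v n.+1%:R^-1 x * complex.Im (line_coef v x)))%R); last first.
    by apply/funext => n; have [<- _] := cR_eq_kappa n v0.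
  rewrite (_ : 2^-1 * _ = (2 * pi)^-1 * (pi * \int[plane R]_t complex.Im (line_coef v (ofC2 ((t.1 +i* t.2) *: v)))))%R; last first.
    by rewrite mulrA invfM -(mulrA 2^-1%R) mulVf// mulr1.
  by apply: cvgM; [exact: cvg_cst|]; move: Li; rewrite fineM.
apply: cvg_unique L2 _; first exact: Rhausdorff.
rewrite (_ : (fun n => _) = (fun n => - ((2 * pi)^-1 *
  \int[space R]_x (kappa v n.+1%:R^-1 x * complex.Re (line_coef v x))))%R); last first.
  by apply/funext => n; have [_ <-] := cR_eq_kappa n v0.
rewrite (_ : 2^-1 * _ = (2 * pi)^-1 * (pi * \int[plane R]_t complex.Re (line_coef v (ofC2 ((t.1 +i* t.2) *: v)))))%R; last first.
  by rewrite mulrA invfM -(mulrA 2^-1%R) mulVf// mulr1.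
by apply: cvgN; apply: cvgM; [exact: cvg_cst|]; move: Lr; rewrite fineM.
Qed.

(** The Poincare-Lelong formula for a linear form: the zero divisor of det2 x v is the line of
    v with multiplicity one.  It is the limit of cR_eq_kappa as the regularization tends to 0. *)
Lemma fibre_integralE (z : P1 R) :
  fibre_integral w z = (4 * \int[space R]_x (lognorm (det2 (toC2 x) (vec z)) * complex.Re (W x)))%R +i*
                       (4 * \int[space R]_x (lognorm (det2 (toC2 x) (vec z)) * complex.Im (W x)))%R.
Proof.
have v0 := vec_neq0 z.
have [smr smi] := line_coef_smooth (vec z).
have [ir _] := kappa_limit v0 cK (smooth_continuous smr) (@line_coef_vanishes_re (vec z)).
have [ii _] := kappa_limit v0 cK (smooth_continuous smi) (@line_coef_vanishes_im (vec z)).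
have [-> ->] := lognorm_W v0.
rewrite /fibre_integral /cintegral.
rewrite (eq_integral (fun t : R * R => (2 * complex.Im (line_coef (vec z) (ofC2 ((t.1 +i* t.2) *: vec z))))%:E)) => [|t _]; last first.
  congr EFin; rewrite -/(line_coef (vec z) _); case: (line_coef _ _) => a b /=; ring.
rewrite [X in _ +i* fine X](eq_integral (fun t : R * R => (- 2 * complex.Re (line_coef (vec z) (ofC2 ((t.1 +i* t.2) *: vec z))))%:E)) => [|t _]; last first.
  congr EFin; rewrite -/(line_coef (vec z) _); case: (line_coef _ _) => a b /=; ring.
rewrite !integral_leb2 -![fine _]/(Rintegral _ _ _) !RintegralZl//.
by congr (_ +i* _); field.
Qed.

End PoincareLelongFormula.

(** * Homogeneous functions on C^2 *)

Section ComplexContinuity.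
Variable R : realType.
Local Notation C := R[i].
Implicit Types (f g : 'R4 R -> C) (V : 'R4 R -> 'C2 R).

Definition ccont f := continuous (fun x => complex.Re (f x)) /\ continuous (fun x => complex.Im (f x)).

Lemma ccont_cst (c : C) : ccont (fun=> c).
Proof. by split => x; exact: cvg_cst. Qed.

Lemma ccontD f g : ccont f -> ccont g -> ccont (fun x => f x + g x).
Proof.
move=> [f1 f2] [g1 g2]; split.
  rewrite (_ : (fun x => _) = fun x => complex.Re (f x) + complex.Re (g x)).
    by move=> x; apply: cvgD; [exact: f1|exact: g1].
  by apply/funext => x; rewrite ReD.
rewrite (_ : (fun x => _) = fun x => complex.Im (f x) + complex.Im (g x)).
  by move=> x; apply: cvgD; [exact: f2|exact: g2].
by apply/funext => x; rewrite ImD.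
Qed.

Lemma ccontM f g : ccont f -> ccont g -> ccont (fun x => f x * g x).
Proof.
move=> [f1 f2] [g1 g2]; split.
  rewrite (_ : (fun x => _) = fun x => complex.Re (f x) * complex.Re (g x) - complex.Im (f x) * complex.Im (g x)).
    by move=> x; apply: cvgB; apply: cvgM; [exact: f1|exact: g1|exact: f2|exact: g2].
  by apply/funext => x; rewrite ReM.
rewrite (_ : (fun x => _) = fun x => complex.Re (f x) * complex.Im (g x) + complex.Im (f x) * complex.Re (g x)).
  by move=> x; apply: cvgD; apply: cvgM; [exact: f1|exact: g2|exact: f2|exact: g1].
by apply/funext => x; rewrite ImM.
Qed.

Lemma ccont_sum (I : Type) (s : seq I) (F : I -> 'R4 R -> C) :
  (forall i, ccont (F i)) -> ccont (fun x => \sum_(i <- s) F i x).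
Proof.
move=> cF; elim: s => [|i s IH].
  by rewrite (_ : (fun x => _) = fun=> 0); [exact: ccont_cst|apply/funext => x; rewrite big_nil].
rewrite (_ : (fun x => _) = fun x => F i x + \sum_(j <- s) F j x); first exact: ccontD.
by apply/funext => x; rewrite big_cons.
Qed.

Lemma ccont_prod (I : Type) (s : seq I) (F : I -> 'R4 R -> C) :
  (forall i, ccont (F i)) -> ccont (fun x => \prod_(i <- s) F i x).
Proof.
move=> cF; elim: s => [|i s IH].
  by rewrite (_ : (fun x => _) = fun=> 1); [exact: ccont_cst|apply/funext => x; rewrite big_nil].
rewrite (_ : (fun x => _) = fun x => F i x * \prod_(j <- s) F j x); first exact: ccontM.
by apply/funext => x; rewrite big_cons.
Qed.

Lemma ccontX f n : ccont f -> ccont (fun x => f x ^+ n).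
Proof.
move=> cf; rewrite (_ : (fun x => _) = fun x => \prod_(i <- iota 0 n) f x); first exact: ccont_prod.
by apply/funext => x; rewrite big_const_seq count_predT size_iota; elim: n => [|n IH]; rewrite ?expr0// exprS IH.
Qed.

Lemma ccont_meval V (p : 'poly2 R) : (forall j, ccont (fun x => V x 0 j)) ->
  ccont (fun x => meval (V x 0) p).
Proof.
move=> cV; rewrite (_ : (fun x => _) = fun x =>
  \sum_(m <- msupp p) mcoeff m p * \prod_(i <- index_enum 'I_2) V x 0 i ^+ m i); last first.
  by apply/funext => x; rewrite mevalE.
apply: ccont_sum => m; apply: ccontM; first exact: ccont_cst.
by apply: ccont_prod => i; exact: ccontX.
Qed.

Lemma ccont_toC2 j : ccont (fun x => toC2 x 0 j).
Proof.
have E : (fun x : 'R4 R => toC2 x 0 j) = fun x => if j == 0 then x.1.1 +i* x.1.2 else x.2.1 +i* x.2.2.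
  by apply/funext => x; rewrite mxE.
rewrite E; case: (j == 0); split => x /=.
- exact: continuous_coord11.
- exact: continuous_coord12.
- exact: continuous_coord21.
- exact: continuous_coord22.
Qed.

Lemma ccont_iter (G : 'lift R) n j : ccont (fun x => iter n (lift_map G) (toC2 x) 0 j).
Proof.
elim: n j => [|n IH] j; first exact: ccont_toC2.
rewrite (_ : (fun x => _) = fun x => meval (iter n (lift_map G) (toC2 x) 0) (tnth G j)).
  exact: ccont_meval.
by apply/funext => x; rewrite iterS mxE.
Qed.

Lemma ccont_sqn f : ccont f -> continuous (fun x => sqn (f x)).
Proof.
by move=> [f1 f2] x; apply: cvgD; apply: cvgM; (exact: f1 || exact: f2).
Qed.

End ComplexContinuity.

Section HomogeneousBounds.
Variable R : realType.
Local Notation C := R[i].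
Implicit Types (u v : 'C2 R).

Definition nsq v : R := sqn (v 0 0) + sqn (v 0 1).

Lemma nsqZ (c : C) v : nsq (c *: v) = sqn c * nsq v.
Proof.
have E j : (c *: v) 0 j = c * v 0 j by rewrite mxE.
by rewrite /nsq (E 0) (E 1) (sqnM c (v 0 0)) (sqnM c (v 0 1)) -mulrDr.
Qed.

Lemma nsq_gt0 v : v != 0 -> 0 < nsq v.
Proof.
move=> v0; have [h|h] := neq0_coord v0; have := sqn_gt0 h => q0.
  by rewrite ltr_wpDl// sqn_ge0.
by rewrite ltr_wpDr// sqn_ge0.
Qed.

Lemma nsq0 : nsq 0 = 0.
Proof. by rewrite /nsq 2!mxE /sqn /= expr0n /= !addr0. Qed.

Lemma toC2K v : toC2 (ofC2 v) = v.
Proof.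
apply/rowP => j; rewrite mxE /=; case: j => [[|[|//]]] hj /=.
  by rewrite (_ : Ordinal hj = 0); [case: (v 0 0)|apply: val_inj].
by rewrite (_ : Ordinal hj = 1); [case: (v 0 1)|apply: val_inj].
Qed.

Lemma continuous_nsq (V : 'R4 R -> 'C2 R) : (forall j, ccont (fun x => V x 0 j)) ->
  continuous (fun x => nsq (V x)).
Proof. by move=> cV x; apply: cvgD; exact: ccont_sqn. Qed.

Lemma compact_box (r : R) : compact (box r).
Proof.
rewrite boxE; apply: compact_setX; apply: compact_setX; exact: segment_compact.
Qed.

Lemma nsq_toC2 (x : 'R4 R) : nsq (toC2 x) = x.1.1 ^+ 2 + x.1.2 ^+ 2 + (x.2.1 ^+ 2 + x.2.2 ^+ 2).
Proof. by rewrite /nsq 2!mxE. Qed.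

Lemma sphere_compact : compact [set x : 'R4 R | nsq (toC2 x) = 1].
Proof.
apply: (@subclosed_compact _ _ (box 1)); last 2 first.
- exact: compact_box.
- move=> x /= h; have le1 (t s : R) : 0 <= s -> t ^+ 2 + s = 1 -> `|t| <= 1.
    by move=> s0 ts; rewrite -(ler_sqr) ?nnegrE// real_normK ?num_real// expr1n -ts lerDl.
  rewrite boxE /square /= !in_itv /= -!ler_norml; rewrite nsq_toC2 in h.
  have P (a b c : R) : 0 <= a ^+ 2 + b ^+ 2 + c ^+ 2 by rewrite !addr_ge0 ?sqr_ge0.
  move: h; case: x => [[a b] [c d]] /= h; split; split.
  + by apply: (le1 _ _ (P b c d)); rewrite -h; ring.
  + by apply: (le1 _ _ (P a c d)); rewrite -h; ring.
  + by apply: (le1 _ _ (P a b d)); rewrite -h; ring.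
  + by apply: (le1 _ _ (P a b c)); rewrite -h; ring.
- have -> : [set x : 'R4 R | nsq (toC2 x) = 1] = (fun x => nsq (toC2 x)) @^-1` [set 1] by [].
  apply: closed_comp; last exact: closed_eq.
  by move=> x _; apply: continuous_nsq => j; exact: ccont_toC2.
Qed.

(** The quotient of f by the power of the norm of the same degree is invariant by scaling, and
    continuous and positive on the unit sphere, which is compact. *)
Lemma homogeneous_bound (m : nat) (f : 'C2 R -> R) :
  (forall (c : C) v, f (c *: v) = sqn c ^+ m * f v) -> continuous (fun x => f (toC2 x)) ->
  (forall v, v != 0 -> 0 < f v) ->
  exists2 L : R, 0 <= L & forall v, v != 0 -> `|ln (f v) - m%:R * ln (nsq v)| <= L.
Proof.
move=> fZ cf f0.
have : compact ((fun x => ln (f (toC2 x))) @` [set x : 'R4 R | nsq (toC2 x) = 1]).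
  apply: continuous_compact; last exact: sphere_compact.
  apply: continuous_in_subspaceT => x; rewrite inE /= => x1.
  apply: (@continuous_comp _ _ _ (fun x => f (toC2 x)) (@ln R)); first exact: cf.
  apply: continuous_ln; apply: f0; apply/eqP => x0; move: x1; rewrite x0 nsq0 => /esym/eqP.
  by rewrite oner_eq0.
move=> /compact_bounded[M [_ KM]].
exists (Num.max 0 (M + 1)); first by rewrite le_max lexx.
move=> v v0; have n0 := nsq_gt0 v0.
pose t := Num.sqrt (nsq v); have t0 : 0 < t by rewrite sqrtr_gt0.
have st : sqn t%:C = nsq v by rewrite /sqn /= expr0n addr0 sqr_sqrtr// ltW.
have tC : t%:C != 0 by rewrite eq_complex /= eqxx andbT gt_eqF.
pose u := t%:C^-1 *: v; have vE : v = t%:C *: u by rewrite scalerA divff// scale1r.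
have u1 : nsq u = 1.
  by apply: (mulfI (lt0r_neq0 n0)); rewrite -st -nsqZ -vE mulr1 st.
have u0 : u != 0 by apply/eqP => u0; move: u1; rewrite u0 nsq0 => /esym/eqP; rewrite oner_eq0.
have -> : ln (f v) - m%:R * ln (nsq v) = ln (f u).
  rewrite {1}vE fZ st lnM ?posrE ?exprn_gt0 ?f0// lnXn// mulr_natl addrAC subrr add0r //.
rewrite le_max; apply/orP; right; apply: KM; first by rewrite ltrDl.
by exists (ofC2 u); rewrite /= toC2K.
Qed.

(** The lower bound fails when f has zeros; adding the power of the norm removes them. *)
Lemma homogeneous_upper (m : nat) (f : 'C2 R -> R) :
  (forall (c : C) v, f (c *: v) = sqn c ^+ m * f v) -> continuous (fun x => f (toC2 x)) ->
  (forall v, 0 <= f v) ->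
  exists2 L : R, 0 <= L & forall v, v != 0 -> 0 < f v -> ln (f v) <= m%:R * ln (nsq v) + L.
Proof.
move=> fZ cf f0.
have [|||L L0 HL] := @homogeneous_bound m (fun v => f v + nsq v ^+ m).
- by move=> c v; rewrite fZ nsqZ exprMn mulrDr.
- move=> x; apply: cvgD; first exact: cf.
  have cn : continuous (fun x => nsq (toC2 x)).
    by apply: continuous_nsq => j; exact: ccont_toC2.
  apply: (@continuous_comp _ _ _ (fun x => nsq (toC2 x)) (fun t : R => t ^+ m)); first exact: cn.
  exact: exprn_continuous.
- by move=> v v0; rewrite ltr_wpDl// exprn_gt0// nsq_gt0.
exists L => // v v0 fv; have := HL v v0; rewrite ler_norml => /andP[_].
rewrite lerBlDl => H; apply: le_trans H; rewrite ler_ln ?posrE ?lerDl ?exprn_ge0 ?ltW ?nsq_gt0//.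
by rewrite ltr_wpDr// exprn_ge0// ltW// nsq_gt0.
Qed.

End HomogeneousBounds.

(** * Escape rates *)

Section Dynamics.
Variable R : realType.
Local Notation C := R[i].
Variables (F : 'lift R) (N : 'C2 R -> R) (d h e : nat) (zs : nat -> seq (P1 R)) (cs : nat -> C).
Hypotheses (d2 : (2 <= d)%N) (ed : (e < d)%N) (hed : (h + e = d)%N) (hN : is_norm N)
  (size_zs : forall n, size (zs n) = (h * e ^ n)%N)
  (formG : forall j, tnth (reduced F) j \is ishomog1 e mdeg)
  (nzG : no_common_zero (reduced F))
  (FE : forall j, tnth F j = hgcd F * tnth (reduced F) j)
  (formH : hgcd F \is ishomog1 h mdeg)
  (csE : forall n, cs n != 0 /\ forall v,
     meval (iter n (lift_map (reduced F)) v 0) (hgcd F) = cs n * \prod_(z <- zs n) det2 v (vec z)).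
Implicit Types (u v : 'C2 R).

Definition gmap : 'C2 R -> 'C2 R := lift_map (reduced F).
Definition hval v : C := meval (v 0) (hgcd F).
Definition hole_val k v : C := hval (iter k gmap v).

Lemma lift_mapE v : lift_map F v = hval v *: gmap v.
Proof. by apply/rowP => j; rewrite !mxE FE mevalM. Qed.

Lemma gmapZ (c : C) v : gmap (c *: v) = c ^+ e *: gmap v.
Proof. exact: lift_mapZ. Qed.

Lemma hvalZ (c : C) v : hval (c *: v) = c ^+ h * hval v.
Proof. exact: meval_homog. Qed.

Lemma gmap_neq0 k v : v != 0 -> iter k gmap v != 0.
Proof. exact: iter_neq0. Qed.

Fixpoint cofactor_val n v : C :=
  if n is m.+1 then cofactor_val m v ^+ d * hole_val m v else 1.

Lemma iter_lift n v : iter n (lift_map F) v = cofactor_val n v *: iter n gmap v.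
Proof.
elim: n => [|n IH]; first by rewrite scale1r.
rewrite iterS IH lift_mapE hvalZ gmapZ scalerA [in RHS]iterS /=; congr (_ *: _).
by rewrite mulrAC -exprD hed.
Qed.

Definition lnv v : R := ln (nsq v) / 2.

Lemma lnvZ (c : C) v : c != 0 -> v != 0 -> lnv (c *: v) = lognorm c + lnv v.
Proof. by move=> c0 v0; rewrite /lnv nsqZ lnM ?posrE ?sqn_gt0 ?nsq_gt0// mulrDl. Qed.

Lemma gmap_bound : exists2 L : R, 0 <= L & forall v, v != 0 -> `|lnv (gmap v) - e%:R * lnv v| <= L.
Proof.
have [||v v0|L L0 HL] := @homogeneous_bound R e (fun v => nsq (gmap v)).
- by move=> c v; rewrite gmapZ nsqZ; congr (_ * _); elim: e => [|n IH]; rewrite ?exprS ?sqnM ?IH// expr0 /sqn /= expr1n expr0n addr0.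
- by apply: continuous_nsq => j; exact: (ccont_iter _ 1).
- by apply: nsq_gt0; exact: (gmap_neq0 1).
exists (L / 2); first by rewrite divr_ge0.
move=> v /HL; rewrite /lnv mulrA -mulrBl normrM (ger0_norm (_ : 0 <= 2^-1))// ler_pM2r// invr_gt0.
Qed.

Lemma hval_upper : exists2 L : R, 0 <= L & forall v, v != 0 -> hval v != 0 -> lognorm (hval v) <= h%:R * lnv v + L.
Proof.
have [||v|L L0 HL] := @homogeneous_upper R h (fun v => sqn (hval v)).
- move=> c v; rewrite hvalZ sqnM; congr (_ * _).
  by elim: h => [|n IH]; rewrite ?exprS ?sqnM ?IH// expr0 /sqn /= expr1n expr0n addr0.
- by apply: ccont_sqn; apply: ccont_meval => j; exact: ccont_toC2.
- exact: sqn_ge0.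
exists (L / 2); first by rewrite divr_ge0.
move=> v v0 hv0; rewrite /lognorm /lnv mulrA -mulrDl ler_pM2r ?invr_gt0//.
by apply: HL => //; exact: sqn_gt0.
Qed.

Lemma normc_sqn (c : C) : Normc.normc c ^+ 2 = sqn c.
Proof. by case: c => a b; rewrite /= sqr_sqrtr// addr_ge0 ?sqr_ge0. Qed.

Lemma N0 : N 0 = 0.
Proof. by have [_ hom _] := hN; rewrite -(scale0r (0 : 'C2 R)) hom Normc.normc0 mul0r. Qed.

Lemma NN v : N (- v) = N v.
Proof.
have [_ hom _] := hN; rewrite -scaleN1r hom (_ : Normc.normc (-1) = 1) ?mul1r//.
by rewrite /= oppr0 expr0n addr0 sqrrN expr1n sqrtr1.
Qed.

Lemma N_gt0 v : v != 0 -> 0 < N v.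
Proof.
move=> v0; have [tri _ sep] := hN.
have := tri v (- v); rewrite subrr N0 NN -mulr2n => Nv2.
have Nv : 0 <= N v by move: Nv2; rewrite pmulrn_lge0.
by rewrite lt_neqAle Nv andbT eq_sym; apply: contra_neq v0; exact: sep.
Qed.

Lemma normcE (c : C) : Normc.normc c = Num.sqrt (sqn c).
Proof. by case: c. Qed.

Lemma continuous_N : continuous (fun x : 'R4 R => N (toC2 x)).
Proof.
have [tri hom _] := hN.
pose p (x y : 'R4 R) := Num.sqrt (sqn (toC2 y 0 0 - toC2 x 0 0)) * N (delta_mx 0 0) +
  Num.sqrt (sqn (toC2 y 0 1 - toC2 x 0 1)) * N (delta_mx 0 1).
have Np x y : N (toC2 y - toC2 x) <= p x y.
  have -> : toC2 y - toC2 x = (toC2 y 0 0 - toC2 x 0 0) *: delta_mx 0 0 + (toC2 y 0 1 - toC2 x 0 1) *: delta_mx 0 1.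
    apply: eq_row2; rewrite [RHS]mxE [X in _ = X + _]mxE [X in _ = _ + X]mxE ![delta_mx _ _ _ _]mxE [LHS]mxE [X in _ + X = _]mxE /=;
      by rewrite ?mulr1 ?mulr0 ?addr0 ?add0r.
  by apply: (le_trans (tri _ _)); rewrite !hom !normcE.
have c1 (x : 'R4 R) j : continuous (fun y => Num.sqrt (sqn (toC2 y 0 j - toC2 x 0 j))).
  have cs1 : continuous (fun y => sqn (toC2 y 0 j - toC2 x 0 j)).
    apply: ccont_sqn; apply: ccontD; first exact: ccont_toC2.
    exact: ccont_cst.
  move=> y; apply: (@continuous_comp _ _ _ (fun y => sqn (toC2 y 0 j - toC2 x 0 j)) (@Num.sqrt R)); first exact: cs1.
  exact: sqrt_continuous.
have cp (x : 'R4 R) : continuous (p x).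
  by move=> y; apply: cvgD; apply: cvgM; (exact: cvg_cst || exact: c1).
have p0 (x : 'R4 R) : p x x = 0 by rewrite /p !subrr /sqn /= expr0n addr0 sqrtr0 !mul0r addr0.
move=> x; apply: (@squeeze_cvgr _ _ _ _ (fun y => N (toC2 x) - p x y) (fun y => N (toC2 x) + p x y)).
- apply: nearW => y; rewrite lerBlDr; apply/andP; split.
    rewrite -[toC2 x](subrK (toC2 y)) addrC; apply: (le_trans (tri _ _)); rewrite lerD2l.
    by rewrite -NN opprB Np.
  by rewrite -[toC2 y](subrK (toC2 x)) addrC; apply: (le_trans (tri _ _)); rewrite lerD2l ?subrK.
- rewrite -[X in _ --> X]subr0 -(p0 x); apply: cvgB; [exact: cvg_cst|exact: cp].
- rewrite -[X in _ --> X]addr0 -(p0 x); apply: cvgD; [exact: cvg_cst|exact: cp].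
Qed.

(** All norms are equivalent. *)
Lemma N_bound : exists2 L : R, 0 <= L & forall v, v != 0 -> `|ln (N v) - lnv v| <= L.
Proof.
have [_ hom _] := hN.
have [||v v0|L L0 HL] := @homogeneous_bound R 1 (fun v => N v ^+ 2).
- by move=> c v; rewrite hom exprMn normc_sqn expr1.
- by move=> x; apply: cvgM; exact: continuous_N.
- by rewrite exprn_gt0// N_gt0.
exists (L / 2); first by rewrite divr_ge0.
move=> v v0; have := HL v v0; rewrite lnXn ?N_gt0// mul1r /lnv => H.
rewrite (_ : ln (N v) - _ = (ln (N v) *+ 2 - ln (nsq v)) / 2).
  by rewrite normrM (ger0_norm (_ : 0 <= 2^-1))// ler_pM2r// invr_gt0.
by rewrite mulr2n; field.
Qed.

(** A growth rate with e + 1/2 <= rho < d and 1 <= rho; the margin 1/2 absorbs the additive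
    constant of gmap_bound. *)
Definition rho : R := d%:R - 2^-1.

Lemma d_gt0 : 0 < d%:R :> R.
Proof. by rewrite ltr0n (leq_trans _ d2). Qed.

Lemma rho_ge1 : 1 <= rho.
Proof.
have : (2%:R <= d%:R :> R) by rewrite ler_nat.
by rewrite /rho => ?; lra.
Qed.

Lemma rho_lt_d : rho < d%:R.
Proof. by rewrite /rho ltrBlDr ltrDl invr_gt0. Qed.

Lemma rho_e : e%:R + 2^-1 <= rho.
Proof.
have : (e.+1%:R <= d%:R :> R) by rewrite ler_nat.
by rewrite /rho -natr1 => ?; lra.
Qed.

(** Each step multiplies the logarithm of the norm by e up to a bounded error, and e < rho. *)
Lemma orbit_growth : exists2 L : R, 0 <= L & forall k v, v != 0 ->
  `|lnv (iter k gmap v)| <= rho ^+ k * (`|lnv v| + L).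
Proof.
have [L L0 HL] := gmap_bound; exists (2 * L); first by rewrite mulr_ge0.
elim=> [|k IH] v v0; first by rewrite expr0 mul1r lerDl mulr_ge0.
have kv := gmap_neq0 k v0; have := HL _ kv; rewrite -iterS => H.
have {}H : `|lnv (iter k.+1 gmap v)| <= e%:R * `|lnv (iter k gmap v)| + L.
  rewrite -[lnv (iter k.+1 _ _)](subrK (e%:R * lnv (iter k gmap v))) addrC.
  apply: (le_trans (ler_normD _ _)); rewrite normrM ger0_norm//.
  by rewrite lerD2l.
apply: (le_trans H); have := IH v v0; set B := `|lnv v| + 2 * L.
have BL : L <= 2^-1 * B by rewrite /B; have := normr_ge0 (lnv v); lra.
have r1 : 1 <= rho ^+ k by rewrite exprn_ege1// rho_ge1.
have B0 : 0 <= B by rewrite addr_ge0// mulr_ge0.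
move=> {}H; rewrite exprS -mulrA; set T := rho ^+ k * B in H *.
have BT : B <= T by rewrite ler_peMl.
apply: (@le_trans _ _ ((e%:R + 2^-1) * T)).
  rewrite mulrDl lerD// ?ler_wpM2l//; apply: (le_trans BL).
  by rewrite ler_wpM2l.
by rewrite ler_wpM2r ?rho_e// (le_trans B0).
Qed.

Lemma hole_val_upper : exists2 A : R, 0 <= A & forall k v, v != 0 -> hole_val k v != 0 ->
  lognorm (hole_val k v) <= rho ^+ k * (h%:R * `|lnv v| + A).
Proof.
have [L1 L10 H1] := hval_upper; have [L2 L20 H2] := orbit_growth.
exists (h%:R * L2 + L1); first by rewrite addr_ge0// mulr_ge0.
move=> k v v0 hk; have kv := gmap_neq0 k v0.
apply: (le_trans (H1 _ kv hk)).
have r1 : 1 <= rho ^+ k by rewrite exprn_ege1// rho_ge1.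
rewrite addrA -mulrDr [leRHS]mulrDr [X in _ <= X + _]mulrCA lerD//.
  by rewrite ler_wpM2l// (le_trans (ler_norm _))// H2.
by rewrite ler_peMl.
Qed.

Definition good v := forall k, hole_val k v != 0.

Definition partial n v : R := \sum_(k < n) d%:R^-1 ^+ k.+1 * lognorm (hole_val k v).

Lemma lognorm1 : lognorm (1 : C) = 0.
Proof. by rewrite /lognorm /sqn /= expr1n expr0n addr0 ln1 mul0r. Qed.

Lemma lognormX (c : C) n : c != 0 -> lognorm (c ^+ n) = n%:R * lognorm c.
Proof.
move=> c0; elim: n => [|n IH]; last by rewrite exprS lognormM ?expf_neq0// IH -natr1 mulrDl mul1r addrC.
by rewrite expr0 mul0r lognorm1.
Qed.

Lemma ln_normc (c : C) : c != 0 -> ln (Normc.normc c) = lognorm c.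
Proof.
move=> c0; have n0 : 0 < Normc.normc c.
  by rewrite normcE sqrtr_gt0 sqn_gt0.
by rewrite /lognorm -normc_sqn lnXn// mulr2n; field.
Qed.

Lemma dn_neq0 n : d%:R ^+ n != 0 :> R.
Proof. by rewrite expf_neq0// gt_eqF// d_gt0. Qed.

Lemma cofactor_lognorm n v : good v -> cofactor_val n v != 0 /\
  d%:R ^- n * lognorm (cofactor_val n v) = partial n v.
Proof.
move=> gv; elim: n => [|n [c0 IH]].
  by rewrite /= oner_neq0 /partial big_ord0 lognorm1 mulr0.
split; first by rewrite /= mulf_neq0 ?expf_neq0.
rewrite /partial big_ord_recr /= -/(partial n v) -IH lognormM ?expf_neq0// lognormX//.
have dn := dn_neq0 n; have d0 := lt0r_neq0 d_gt0.
rewrite mulrDr exprVn; congr (_ + _); rewrite exprS; field.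
by rewrite dn d0.
Qed.

Lemma escape_seq_good n v : v != 0 -> good v ->
  escape_seq N d F v n = (partial n v + d%:R ^- n * ln (N (iter n gmap v)))%:E.
Proof.
move=> v0 gv; have [c0 <-] := cofactor_lognorm n gv.
have [_ hom _] := hN; rewrite /escape_seq iter_lift hom.
have n0 : 0 < Normc.normc (cofactor_val n v) by rewrite normcE sqrtr_gt0 sqn_gt0.
have N0 := N_gt0 (gmap_neq0 n v0).
rewrite lne_EFin ?mulr_gt0// lnM ?posrE// ln_normc// -EFinM mulrDr//.
Qed.

Lemma escape_seq_bad k n v : hole_val k v = 0 -> (k < n)%N -> escape_seq N d F v n = -oo%E.
Proof.
move=> hk kn; rewrite /escape_seq iter_lift.
have -> : cofactor_val n v = 0.
  elim: n kn => // n IH; rewrite ltnS leq_eqVlt => /predU1P[<-|/IH kn] /=; first by rewrite hk mulr0.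
  by rewrite kn expr0n gtn_eqF ?mul0r// (leq_trans _ d2).
by rewrite scale0r N0 le0_lneNy// gt0_muleNy// lte_fin invr_gt0 exprn_gt0// d_gt0.
Qed.

Lemma good_neq0 v : good v -> v != 0.
Proof.
move=> /(_ 0%N); apply: contra_neq => ->; rewrite /hole_val /= -(scale0r (0 : 'C2 R)) hvalZ expr0n.
by rewrite (_ : (h == 0)%N = false) ?mul0r//; apply/negbTE; apply: contraTneq ed => h0; rewrite -hed h0 add0n ltnn.
Qed.

Lemma ratio_lt1 : `|rho / d%:R| < 1.
Proof.
rewrite ger0_norm; first by rewrite ltr_pdivrMr ?d_gt0// mul1r rho_lt_d.
by rewrite divr_ge0// (le_trans ler01)// rho_ge1.
Qed.

Lemma remainder_cvg v : v != 0 -> d%:R ^- n * ln (N (iter n gmap v)) @[n --> \oo] --> (0 : R).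
Proof.
move=> v0; have [L1 L10 H1] := N_bound; have [L2 L20 H2] := orbit_growth.
pose B := `|lnv v| + L2 + L1.
have r0 : 0 <= rho by rewrite (le_trans ler01)// rho_ge1.
have H n : `|d%:R ^- n * ln (N (iter n gmap v))| <= B * (rho / d%:R) ^+ n.
  have nv := gmap_neq0 n v0.
  have l : `|ln (N (iter n gmap v))| <= rho ^+ n * B.
    rewrite -[ln _](subrK (lnv (iter n gmap v))) addrC (le_trans (ler_normD _ _))// mulrDr lerD ?H2//.
    by rewrite (le_trans (H1 _ nv))// ler_peMl// exprn_ege1// rho_ge1.
  rewrite normrM ger0_norm ?invr_ge0 ?exprn_ge0 ?ler0n//.
  rewrite expr_div_n mulrA [B * _]mulrC [leRHS]mulrC ler_wpM2l// invr_ge0 exprn_ge0// ler0n.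
have G : B * (rho / d%:R) ^+ n @[n --> \oo] --> (0 : R).
  have := cvg_geometric B ratio_lt1; exact.
apply: (@squeeze_cvgr _ _ _ _ (fun n => - (B * (rho / d%:R) ^+ n)) (fun n => B * (rho / d%:R) ^+ n)) => //.
  by apply: nearW => n; rewrite -ler_norml.
by rewrite -[X in _ --> X]oppr0; exact: cvgN.
Qed.

Local Open Scope ereal_scope.

(** Subtracting from the terms a convergent geometric series that bounds them above leaves a
    series of non-positive terms, which converges in [-oo, 0]. *)
Lemma partial_cvg v : good v -> exists2 l : \bar R, l < +oo & (partial n v)%:E @[n --> \oo] --> l.
Proof.
move=> gv; have v0 := good_neq0 gv.
have [A A0 HA] := hole_val_upper; set B := (h%:R * `|lnv v| + A)%R.
have {}HA k : (lognorm (hole_val k v) <= rho ^+ k * B)%R by exact: HA.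
pose S n := series (geometric (d%:R^-1 * B)%R (rho / d%:R)%R) n.
have Scvg : (S n)%:E @[n --> \oo] --> ((d%:R^-1 * B) / (1 - rho / d%:R))%:E.
  apply: cvg_EFin; first by apply: nearW.
  exact: cvg_geometric_series ratio_lt1.
pose t k := (d%:R^-1 ^+ k.+1 * (rho ^+ k * B - lognorm (hole_val k v)))%:E.
have t0 k : 0 <= t k by rewrite lee_fin mulr_ge0 ?exprn_ge0 ?invr_ge0 ?ler0n ?subr_ge0.
have tcvg := is_cvg_nneseries (fun k _ _ => t0 k).
pose T := \sum_(k <oo) t k.
have T0 : 0 <= T by apply: nneseries_ge0 => k _ _; exact: t0.
exists (((d%:R^-1 * B) / (1 - rho / d%:R))%:E - T).
  apply: (@le_lt_trans _ _ ((d%:R^-1 * B) / (1 - rho / d%:R))%:E); last exact: ltry.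
  by rewrite -[leRHS]adde0 leeD2l// oppe_le0.
have -> : (fun n => (partial n v)%:E) = (fun n => (S n)%:E - \sum_(0 <= k < n) t k).
  apply/funext => n; rewrite sumEFin -EFinB; congr EFin.
  rewrite /S /series /= -sumrB big_mkord; apply: eq_bigr => k _.
  rewrite /geometric /= expr_div_n exprVn exprS; field.
  by rewrite dn_neq0 gt_eqF// d_gt0.
by apply: cvgeB.
Qed.

Lemma escape_rate_limit v : [/\ cvgn (escape_seq N d F v), escape_rate N d F v < +oo &
  good v -> (partial n v)%:E @[n --> \oo] --> escape_rate N d F v].
Proof.
have [gv|] := pselect (good v); last first.
  move=> ng; have [k hk] : exists k, hole_val k v = 0%R.
    apply/not_existsP => H; apply: ng => k; apply/eqP; exact: H.
  have c : escape_seq N d F v n @[n --> \oo] --> -oo.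
    apply: cvg_near_cst; exists k.+1 => // n /= kn; exact: (escape_seq_bad hk).
  by split; [apply/cvg_ex; exists -oo|rewrite /escape_rate (cvg_lim _ c)|move=> /ng].
have v0 := good_neq0 gv; have [l lo cl] := partial_cvg gv.
have c : escape_seq N d F v n @[n --> \oo] --> l.
  have -> : escape_seq N d F v = fun n => (partial n v)%:E + (d%:R ^- n * ln (N (iter n gmap v)))%:E.
    by apply/funext => n; rewrite escape_seq_good.
  rewrite -[l]adde0; apply: cvgeD => //.
    by rewrite fin_num_adde_defl.
  apply: cvg_EFin; first exact: nearW.
  exact: remainder_cvg.
have E : escape_rate N d F v = l by rewrite /escape_rate; exact: (cvg_lim _ c).
by split; [apply/cvg_ex; exists l|rewrite E|rewrite E].
Qed.

Local Close Scope ereal_scope.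

Implicit Types (x : 'R4 R) (K : set ('R4 R)) (f : 'R4 R -> R).

Definition orbit_log k x : R := lognorm (hole_val k (toC2 x)).

Lemma ccont_hole_val k : ccont (fun x => hole_val k (toC2 x)).
Proof. by apply: ccont_meval => j; exact: ccont_iter. Qed.

Lemma measurable_orbit_log k : measurable_fun setT (orbit_log k).
Proof.
apply: measurable_funM; last exact: measurable_cst.
apply: (@measurableT_comp _ _ _ _ _ _ (@ln R)); first exact: measurable_ln.
by apply: continuous_measurable4; apply: ccont_sqn; exact: ccont_hole_val.
Qed.

Lemma lognorm_prod (I : eqType) (s : seq I) (a : I -> C) : (forall i, i \in s -> a i != 0) ->
  lognorm (\prod_(i <- s) a i) = \sum_(i <- s) lognorm (a i).
Proof.
elim: s => [|i s IH] a0; first by rewrite !big_nil lognorm1.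
have a1 j : j \in s -> a j != 0 by move=> js; apply: a0; rewrite in_cons js orbT.
rewrite !big_cons lognormM ?IH//; first by apply: a0; rewrite mem_head.
by rewrite prodf_seq_neq0; apply/allP => j js; apply/implyP => _; exact: a1.
Qed.

Lemma normalized_points : exists (nu : P1 R -> 'C2 R) (m : P1 R -> R),
  forall z, [/\ 0 < m z, unit_vec (nu z) & vec z = (m z)%:C *: nu z].
Proof.
have H (z : P1 R) : exists p : 'C2 R * R, [/\ 0 < p.2, unit_vec p.1 & vec z = p.2%:C *: p.1].
  by have [m [u ?]] := unit_normalize (vec_neq0 z); exists (u, m).
have [p Hp] := choice H; exists (fun z => (p z).1), (fun z => (p z).2); exact: Hp.
Qed.

(** Cauchy-Schwarz, with the constant 2 since u is normalized in the supremum norm. *)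
Lemma lognorm_det2_le u v : unit_vec u -> nsq v = 1 -> lognorm (det2 v u) <= 1.
Proof.
move=> [u0 u1 _] v1; have [->|d0] := eqVneq (det2 v u) 0; first by rewrite lognorm0.
have B : sqn (det2 v u) <= 2.
  have P (a b : C) : sqn (a - b) <= 2 * (sqn a + sqn b).
    case: a b => [p q] [p' q']; rewrite /sqn /= -subr_ge0.
    rewrite (_ : _ - _ = (p + p') ^+ 2 + (q + q') ^+ 2); last by ring.
    by rewrite addr_ge0 ?sqr_ge0.
  apply: (le_trans (P _ _)); rewrite !sqnM -[leRHS]mulr1 ler_wpM2l// -v1 /nsq addrC.
  rewrite [leRHS]addrC; by rewrite lerD// -[leRHS]mul1r ler_wpM2r// sqn_ge0.
rewrite /lognorm ler_pdivrMr// mul1r.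
apply: (@le_trans _ _ (ln (1 + 1))); first by rewrite ler_ln ?posrE ?sqn_gt0// ltr0n.
by apply: (le_trans (le_ln1Dx _)); rewrite ?ltrN10 ?ltr_wpDl// ?ltr01// ler1n.
Qed.

Lemma iter_gmapZ n (a : C) v : iter n gmap (a *: v) = a ^+ (e ^ n) *: iter n gmap v.
Proof.
elim: n => [|n IH]; first by rewrite expn0 expr1.
by rewrite iterS IH gmapZ -exprM mulnC -expnS iterS.
Qed.

(** A compact set of measure 1 that avoids the origin. *)
Definition cube : set ('R4 R) :=
  let I := `[1, 2]%classic : set R in (I `*` I) `*` (I `*` I).

Lemma cube_compact : compact cube.
Proof. by apply: compact_setX; apply: compact_setX; exact: segment_compact. Qed.

Lemma cube_off0 : ~ cube 0.
Proof. by move=> [[/=]]; rewrite in_itv /= ler10. Qed.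

Lemma measurable_cube : measurable cube.
Proof. by apply: measurableX; apply: measurableX; exact: measurable_itv. Qed.

Lemma space_cube : space R cube = 1%E.
Proof.
have I1 : @lebR R `[1, 2]%classic = 1%E.
  by rewrite [LHS]lebR_itv /= lte_fin ltr1n -EFinB; congr EFin; ring.
have P : plane R (`[1, 2]%classic `*` `[1, 2]%classic) = 1%E.
  rewrite /plane /= /square_measure product_measure1E; [|exact: measurable_itv..].
  by apply: etrans (mul1e _); congr (_ * _)%E.
rewrite /space /= /square_measure product_measure1E;
  [|by apply: measurableX; exact: measurable_itv..].
by apply: etrans (mul1e _); congr (_ * _)%E.
Qed.

Lemma ae_exists (P : 'R4 R -> Prop) : {ae space R, forall x, P x} -> exists x, P x.
Proof.
move=> [A [mA A0 PA]]; apply/not_existsP => nP.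
have : (space R cube <= space R A)%E.
  apply: le_measure; rewrite ?inE//; first exact: measurable_cube.
  by move=> x _; apply: PA; exact: nP.
by rewrite A0 space_cube lee_fin ler10.
Qed.

(** The other points lie on countably many lines. *)
Lemma good_ae : {ae space R, forall x, good (toC2 x)}.
Proof.
have H k i : {ae space R, forall x, det2 (toC2 x) (vec (nth point (zs k) i)) != 0}.
  exact: not_on_line (vec_neq0 _).
have : {ae space R, forall x k i, det2 (toC2 x) (vec (nth point (zs k) i)) != 0}.
  by apply/ae_foralln => k; apply/ae_foralln => i; exact: H.
apply: filterS => x Hx k; rewrite /hole_val /hval /gmap.
have [c0 ->] := csE k; rewrite mulf_neq0// prodf_seq_neq0; apply/allP => z zk; apply/implyP => _.
by rewrite -(nth_index point zk); exact: Hx.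
Qed.

(** A point where H does not vanish and which lies in the image of every iterate.  For e > 0
    any point off the holes has preimages; for e = 0 the constant value of Phi serves, and it is
    off the holes since H o Phi has no zero. *)
Lemma preimages_off_holes : exists w, [/\ w != 0, hval w != 0 &
  forall k, exists v (c : C), nsq v = 1 /\ iter k gmap v = c *: w].
Proof.
have [w [w0 hw Hw]] : exists w, [/\ w != 0, hval w != 0 & forall k, exists v (c : C), v != 0 /\ iter k gmap v = c *: w].
  have [e0|e0] := posnP e.
    pose w := gmap (delta_mx 0 0); have w0 : w != 0 by apply: nzG; exact: axis_neq0.
    have gc v : v != 0 -> gmap v = w.
      have g0 y : gmap y = gmap 0 by have := gmapZ 0 y; rewrite e0 expr0 scale1r scale0r.
      by rewrite g0 /w [RHS]g0.
    exists w; split=> //.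
      have [c1 E] := csE 1; have := E (delta_mx 0 0); rewrite /= -/(gmap _) -/w -/(hval w) => ->.
      have : size (zs 1) = 0%N by rewrite size_zs e0 exp0n// muln0.
      by move=> /size0nil ->; rewrite big_nil mulr1.
    case=> [|k]; first by exists w, 1; rewrite scale1r.
    exists (delta_mx 0 0), 1; split; first exact: axis_neq0.
    by rewrite scale1r iterS gc// gmap_neq0// axis_neq0.
  have [x gx] := ae_exists good_ae.
  exists (toC2 x); split; [exact: good_neq0|exact: (gx 0%N)|]; elim=> [|k [v [c [v0 E]]]].
    by exists (toC2 x), 1; rewrite scale1r; split => //; exact: good_neq0.
  have [u [b [u0 bu]]] := preim_exists formG e0 nzG v0.
  exists u, (b ^+ (e ^ k) * c); split => //.
  rewrite iterSr -/gmap [gmap u]bu.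
  by rewrite iter_gmapZ E scalerA.
exists w; split=> // k; have [v [c [v0 E]]] := Hw k.
have n0 := nsq_gt0 v0; have t0 : 0 < Num.sqrt (nsq v) by rewrite sqrtr_gt0.
have tC : (Num.sqrt (nsq v))%:C != 0 :> C by rewrite eq_complex /= eqxx andbT gt_eqF.
have st : sqn (Num.sqrt (nsq v))%:C = nsq v by rewrite /sqn /= expr0n addr0 sqr_sqrtr// ltW.
exists ((Num.sqrt (nsq v))%:C^-1 *: v), ((Num.sqrt (nsq v))%:C^-1 ^+ (e ^ k) * c); split.
  by apply: (mulfI (lt0r_neq0 n0)); rewrite -{1}st -nsqZ scalerA divff// scale1r mulr1.
by rewrite iter_gmapZ E scalerA.
Qed.

Lemma toC2_inj0 x : toC2 x = 0 -> x = 0.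
Proof.
move=> /rowP x0; have := x0 0; have := x0 1; rewrite !mxE /=.
by case: x {x0} => [[a b] [a' b']] /= [-> ->] [-> ->].
Qed.

Lemma lnv_bounded K : compact K -> ~ K 0 -> exists2 b : R, 0 <= b & forall x, K x -> toC2 x != 0 /\ `|lnv (toC2 x)| <= b.
Proof.
move=> cK K0; have nz x : K x -> toC2 x != 0.
  by move=> Kx; apply/eqP => /toC2_inj0 x0; apply: K0; rewrite -x0.
have : compact ((fun x => lnv (toC2 x)) @` K).
  apply: continuous_compact => //; apply: continuous_in_subspaceT => x; rewrite inE => Kx.
  apply: cvgM; last exact: cvg_cst.
  apply: (@continuous_comp _ _ _ (fun x => nsq (toC2 x)) (@ln R)).
    by apply: continuous_nsq => j; exact: ccont_toC2.
  by apply: continuous_ln; apply: nsq_gt0; exact: nz.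
move=> /compact_bounded[M [_ KM]].
exists (Num.max 0 (M + 1)); first by rewrite le_max lexx.
move=> x Kx; split; first exact: nz.
by rewrite le_max; apply/orP; right; apply: (KM (M + 1)); [rewrite ltrDl|exists x].
Qed.

Lemma hole_val_factor_neq0 k v z : hole_val k v != 0 -> z \in zs k -> det2 v (vec z) != 0.
Proof.
have [_ E] := csE k; rewrite /hole_val /hval /gmap E mulf_eq0 negb_or => /andP[_].
by rewrite prodf_seq_neq0 => /allP/(_ z) H /H.
Qed.

Lemma hole_val_log k v : hole_val k v != 0 ->
  lognorm (hole_val k v) = lognorm (cs k) + \sum_(z <- zs k) lognorm (det2 v (vec z)).
Proof.
move=> hk; have [c0 E] := csE k; rewrite {1}/hole_val /hval /gmap E lognormM ?lognorm_prod//.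
  by move=> z; exact: hole_val_factor_neq0.
by rewrite prodf_seq_neq0; apply/allP => z; exact: hole_val_factor_neq0.
Qed.

Section NormalizedSum.
Variables (nu : P1 R -> 'C2 R) (m : P1 R -> R).
Hypothesis num : forall z, [/\ 0 < m z, unit_vec (nu z) & vec z = (m z)%:C *: nu z].

(** The logarithm of the constant factor left when the linear factors of the k-th hole value are
    normalized. *)
Definition norm_const k : R := lognorm (cs k) + \sum_(z <- zs k) ln (m z).

Lemma hole_val_sum k v : hole_val k v != 0 ->
  lognorm (hole_val k v) = norm_const k + \sum_(z <- zs k) lognorm (det2 v (nu z)).
Proof.
move=> hk; rewrite (hole_val_log hk) /norm_const -addrA -big_split /=; congr (_ + _).
apply: eq_big_seq => z zk; have [m0 _ vz] := num z.
have := hole_val_factor_neq0 hk zk; rewrite vz det2Zr mulf_eq0 negb_or => /andP[mz dz].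
by rewrite lognormM// lognorm_real.
Qed.

Lemma natr_pow_le k : (e ^ k)%:R <= rho ^+ k :> R.
Proof.
rewrite natrX lerXn2r ?nnegrE ?ler0n//; first by rewrite (le_trans ler01)// rho_ge1.
by rewrite (le_trans _ rho_e)// lerDl.
Qed.

Lemma rho_pow_ge1 k : 1 <= rho ^+ k.
Proof. by rewrite exprn_ege1// rho_ge1. Qed.

(** Evaluate at a unit vector v with Phi^k v = c w: the hole value is c^h H(w), where log |c|
    is at least - O(rho^k) by orbit_growth, and the normalized factors are bounded above at v. *)
Lemma norm_const_lower : exists2 A : R, 0 <= A & forall k, - (rho ^+ k * A) <= norm_const k.
Proof.
have [w [w0 hw Hw]] := preimages_off_holes.
have [L L0 HL] := orbit_growth.
exists (h%:R * (L + `|lnv w|) + `|lognorm (hval w)| + h%:R).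
  by rewrite !addr_ge0// mulr_ge0// addr_ge0.
move=> k; have [v [c [v1 E]]] := Hw k.
have v0 : v != 0 by apply/eqP => vz; move: v1; rewrite vz nsq0 => /esym/eqP; rewrite oner_eq0.
have c0 : c != 0 by apply: contra_neq (gmap_neq0 k v0) => cz; rewrite E cz scale0r.
have hk : hole_val k v != 0 by rewrite /hole_val E hvalZ mulf_neq0// expf_neq0.
have := hole_val_sum hk; rewrite {1}/hole_val E hvalZ lognormM ?expf_neq0// lognormX// => S.
have lc : - (rho ^+ k * (L + `|lnv w|)) <= lognorm c.
  have := HL k v v0; rewrite E lnvZ// (_ : lnv v = 0); last by rewrite /lnv v1 ln1 mul0r.
  rewrite normr0 add0r ler_norml => /andP[H _].
  rewrite mulrDr opprD lerBlDr (le_trans H)// lerD2l (le_trans (ler_norm _))//.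
  by rewrite ler_peMl// rho_pow_ge1.
have sz : \sum_(z <- zs k) lognorm (det2 v (nu z)) <= rho ^+ k * h%:R.
  apply: (@le_trans _ _ (\sum_(z <- zs k) 1)).
    by apply: ler_sum => z _; apply: lognorm_det2_le => //; have [] := num z.
  by rewrite big_const_seq count_predT size_zs iter_addr_0 natrM mulrC ler_wpM2r// natr_pow_le.
have hl : - (rho ^+ k * `|lognorm (hval w)|) <= lognorm (hval w).
  by rewrite lerNl (le_trans (ler_norm _))// normrN ler_peMl// rho_pow_ge1.
have -> : norm_const k = h%:R * lognorm c + lognorm (hval w) - \sum_(z <- zs k) lognorm (det2 v (nu z)).
  by rewrite S addrK.
set X := h%:R * (L + _).
rewrite [rho ^+ k * _]mulrDr [rho ^+ k * (X + _)]mulrDr !opprD; apply: lerD; last by rewrite lerN2.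
apply: lerD => //; rewrite /X.
by rewrite mulrCA -mulrN ler_wpM2l.
Qed.

Local Open Scope ereal_scope.

Lemma sum_lognorm_bound (r : R) : (0 <= r)%R -> exists2 c : R, (0 <= c)%R & forall k,
  \int[space R]_x (\1_(box r) x * \sum_(z <- zs k) `|lognorm (det2 (toC2 x) (nu z))|)%:E <= (rho ^+ k * c)%:E.
Proof.
move=> r0; have [c Hc] := lognorm_bound r0.
have c0 : (0 <= c)%R.
  have [_ u _] := num point; have := Hc _ u; rewrite -lee_fin; apply: le_trans.
  by apply: integral_ge0 => x _; rewrite lee_fin mulr_ge0.
exists (h%:R * c)%R; first by rewrite mulr_ge0.
move=> k; rewrite (eq_integral (fun x => \sum_(z <- zs k) (\1_(box r) x * `|lognorm (det2 (toC2 x) (nu z))|)%:E)); last first.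
  by move=> x _; rewrite sumEFin mulr_sumr.
rewrite ge0_integral_sum//; last first.
  move=> z; apply/measurable_EFinP; apply: measurable_funM.
    by apply: measurable_indic; exact: box_measurable.
  by apply: measurableT_comp => //; exact: measurable_lognorm.
apply: (@le_trans _ _ (\sum_(z <- zs k) c%:E)).
  by apply: lee_sum => z _; apply: Hc; have [] := num z.
rewrite sumEFin lee_fin big_const_seq count_predT size_zs iter_addr_0 -[(c *+ _)%R]mulr_natl natrM.
by rewrite [leRHS]mulrCA -mulrA ler_wpM2l// ler_wpM2r// natr_pow_le.
Qed.

Lemma measurable_sum_lognorm (B : set ('R4 R)) k : measurable B ->
  measurable_fun setT (fun x => (\1_B x * \sum_(z <- zs k) `|lognorm (det2 (toC2 x) (nu z))|)%:E).
Proof.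
move=> mB; apply/measurable_EFinP; apply: measurable_funM.
  exact: measurable_indic.
apply: measurable_sum => z; apply: measurableT_comp => //; exact: measurable_lognorm.
Qed.

(** The hole values are bounded above on the cube, and the normalized factors are bounded in
    L^1; so the constant is bounded above by its mean over the cube, which has measure 1. *)
Lemma norm_const_upper : exists2 A : R, (0 <= A)%R & forall k, (norm_const k <= rho ^+ k * A)%R.
Proof.
have [b b0 Hb] := lnv_bounded cube_compact cube_off0.
have [A A0 HA] := hole_val_upper.
have [c c0 Hc] := sum_lognorm_bound (ler0n _ 2).
exists (h%:R * b + A + c)%R; first by rewrite !addr_ge0// mulr_ge0.
move=> k; rewrite mulrDr -lerBlDl; set P := (_ - _)%R.
have [P0|P0] := leP P 0%R; first by rewrite (le_trans P0)// mulr_ge0// exprn_ge0// (le_trans ler01)// rho_ge1.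
rewrite -lee_fin; apply: le_trans (Hc k).
have mc := measurable_cube.
have -> : P%:E = \int[space R]_x (P * \1_cube x)%:E.
  rewrite (eq_integral (fun x => P%:E * (\1_cube x)%:E)) => [|x _]; last by rewrite EFinM.
  rewrite ge0_integralZl//; first by rewrite integral_indic// setIT; apply: esym; apply: etrans (mule1 _); congr (_ * _); exact: space_cube.
  - by apply/measurable_EFinP; exact: measurable_indic.
  - by rewrite lee_fin ltW.
apply: ae_ge0_le_integral => //.
- by move=> x _; rewrite lee_fin mulr_ge0// ltW.
- by apply/measurable_EFinP; apply: measurable_funM; [exact: measurable_cst|exact: measurable_indic].
- by move=> x _; rewrite lee_fin mulr_ge0// sumr_ge0.
- by apply: measurable_sum_lognorm; exact: box_measurable.
apply: filterS good_ae => x gx _; rewrite lee_fin.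
have S0 : (0 <= \sum_(z <- zs k) `|lognorm (det2 (toC2 x) (nu z))|)%R by rewrite sumr_ge0.
rewrite [X in (_ * X <= _)%R]indicE; case: (boolP (x \in cube)) => [/set_mem Cx|_]; last first.
  by rewrite mulr0 mulr_ge0.
have [x0 xb] := Hb x Cx.
rewrite indicE mem_set ?mul1r ?mulr1; last first.
  case: x Cx {gx S0 x0 xb} => [[p q] [p' q']] [[/=]]; rewrite !in_itv /= => /andP[p1 p2] /andP[q1 q2] [/=].
  move=> /andP[r1 r2] /andP[s1 s2].
  have n2 (t : R) : (1 <= t -> - 2%:R <= t)%R by move=> t1; rewrite (le_trans _ t1)// lerNl; lra.
  rewrite boxE /square /=; split; split; rewrite /= in_itv /= ?n2//.
have := HA k _ x0 (gx k); rewrite (hole_val_sum (gx k)) => H.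
rewrite /P lerBlDr.
have H2 : (rho ^+ k * (h%:R * `|lnv (toC2 x)| + A) <= rho ^+ k * (h%:R * b + A))%R.
  by rewrite ler_wpM2l ?(le_trans ler01 (rho_pow_ge1 k))// lerD2r ler_wpM2l.
have H3 : (- \sum_(z <- zs k) lognorm (det2 (toC2 x) (nu z)) <= \sum_(z <- zs k) `|lognorm (det2 (toC2 x) (nu z))|)%R.
  by rewrite -sumrN ler_sum// => z _; rewrite -normrN ler_norm.
have := le_trans H H2; rewrite -lerBrDr => H4; apply: (le_trans H4).
by rewrite addrC lerD2r.
Qed.

(** The k-th hole value is a product of h e^k linear forms, and e^k <= rho^k: normalized to
    unit vectors these have uniformly bounded logarithms in L^1, and the normalizing constant is
    O(rho^k) by the two preceding estimates. *)
Lemma orbit_log_bound (r : R) : (0 <= r)%R -> exists2 c : R, (0 <= c)%R & forall k,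
  \int[space R]_x (\1_(box r) x * `|orbit_log k x|)%:E <= (rho ^+ k * c)%:E.
Proof.
move=> r0; have [A1 A10 H1] := norm_const_lower; have [A2 A20 H2] := norm_const_upper.
have [c c0 Hc] := sum_lognorm_bound r0.
have V : space R (box r) \is a fin_num by rewrite ge0_fin_numE// space_box.
pose A := (Num.max A1 A2)%R.
have A3 : (0 <= A)%R by rewrite le_max A10.
have HA k : (`|norm_const k| <= rho ^+ k * A)%R.
  have r1 := le_trans ler01 (rho_pow_ge1 k).
  rewrite ler_norml; apply/andP; split.
    by rewrite (le_trans _ (H1 k))// lerN2 ler_wpM2l// le_max lexx.
  by rewrite (le_trans (H2 k))// ler_wpM2l// le_max lexx orbT.
exists (A * fine (space R (box r)) + c)%R; first by rewrite addr_ge0// mulr_ge0// fine_ge0.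
move=> k; have mb := box_measurable r.
have r1 := le_trans ler01 (rho_pow_ge1 k).
apply: (@le_trans _ _ (\int[space R]_x ((rho ^+ k * A)%:E * (\1_(box r) x)%:E +
    (\1_(box r) x * \sum_(z <- zs k) `|lognorm (det2 (toC2 x) (nu z))|)%:E))).
  apply: ae_ge0_le_integral => //.
  - apply/measurable_EFinP; apply: measurable_funM; first exact: measurable_indic.
    by apply: measurableT_comp => //; exact: measurable_orbit_log.
  - by move=> x _; rewrite adde_ge0 ?mule_ge0 ?lee_fin ?mulr_ge0 ?sumr_ge0.
  - apply: emeasurable_funD; last exact: measurable_sum_lognorm.
    by apply: measurable_funeM; apply/measurable_EFinP; exact: measurable_indic.
  apply: filterS good_ae => x gx _; rewrite -EFinM -EFinD lee_fin [(_ * A * _)%R]mulrC -mulrDr ler_wpM2l//.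
  rewrite /orbit_log (hole_val_sum (gx k)); apply: (le_trans (ler_normD _ _)); apply: lerD => //.
  exact: ler_norm_sum.
rewrite ge0_integralD//; first last.
- exact: measurable_sum_lognorm.
- by move=> x _; rewrite lee_fin mulr_ge0 ?sumr_ge0.
- by apply: measurable_funeM; apply/measurable_EFinP; exact: measurable_indic.
- by move=> x _; rewrite mule_ge0 ?lee_fin ?mulr_ge0.
rewrite ge0_integralZl//; first last.
- by rewrite lee_fin mulr_ge0.
- by apply/measurable_EFinP; exact: measurable_indic.
rewrite integral_indic// setIT mulrDr EFinD mulrA [X in _ <= X + _]EFinM fineK//.
by apply: leeD.
Qed.

End NormalizedSum.

Lemma continuous_NV (V : 'R4 R -> 'C2 R) : (forall j, ccont (fun x => V x 0 j)) ->
  continuous (fun x => N (V x)).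
Proof.
move=> cV; rewrite (_ : (fun x => N (V x)) = (fun y => N (toC2 y)) \o (fun x => ofC2 (V x))); last first.
  by apply/funext => x; rewrite /= toC2K.
move=> x; apply: continuous_comp; last exact: continuous_N.
have [a0 b0] := cV 0; have [a1 b1] := cV 1.
exact: (continuous_pair (continuous_pair a0 b0) (continuous_pair a1 b1)).
Qed.

Local Open Scope ereal_scope.

Lemma measurable_lne : measurable_fun setT (fun r : R => lne r%:E).
Proof.
have E : (fun r : R => lne r%:E) = fun r => if (0 < r)%R then (ln r)%:E else -oo.
  apply/funext => r; case: ltP => r0; first by rewrite lne_EFin.
  by rewrite le0_lneNy.
rewrite E; apply: measurable_fun_ifT => //.
- apply: measurable_fun_ltr => //.
- by apply/measurable_EFinP; exact: measurable_ln.
Qed.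

Lemma measurable_escape_rate : measurable_fun setT (fun x => escape_rate N d F (toC2 x)).
Proof.
apply: (@emeasurable_fun_cvg _ _ _ _ (fun n x => escape_seq N d F (toC2 x) n)).
  move=> n; rewrite /escape_seq; apply: measurable_funeM.
  apply: (measurableT_comp measurable_lne); apply: continuous_measurable4.
  by apply: continuous_NV => j; exact: ccont_iter.
by move=> x _; have [/cvg_ex[l c] _ _] := escape_rate_limit (toC2 x); rewrite /escape_rate (cvg_lim _ c).
Qed.

(** The expansion of the escape rate may be integrated term by term: the terms are bounded in
    L^1 by a convergent geometric series of ratio rho / d, which also bounds the partial sums. *)
Lemma escape_rate_integral K f (M : R) : compact K -> ~ K 0%R -> measurable_fun setT f ->
  (forall x, `|f x| <= M)%R -> vanishes_off K f ->
  [/\ forall k, (space R).-integrable setT (fun x => (orbit_log k x * f x)%:E),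
   (space R).-integrable setT (fun x => escape_rate N d F (toC2 x) * (f x)%:E) &
   (\sum_(k < n) d%:R^-1 ^+ k.+1 * \int[space R]_x (orbit_log k x * f x))%:E @[n --> \oo] -->
     \int[space R]_x (escape_rate N d F (toC2 x) * (f x)%:E)].
Proof.
move=> cK K0 mf fM fK.
have M0 : (0 <= M)%R by rewrite (le_trans _ (fM 0%R)).
have [r [r0 Kr]] := compact_bounded4 cK.
have [nu [m num]] := normalized_points.
have [c c0 Hc] := orbit_log_bound num (ltW r0).
have fB x : (`|f x| <= M * \1_(box r) x)%R.
  by apply: bounded_box => // y yb; apply: fK => /Kr.
have mo k : measurable_fun setT (fun x => (orbit_log k x * f x)%:E).
  by apply/measurable_EFinP; apply: measurable_funM => //; exact: measurable_orbit_log.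
have mo2 k : measurable_fun setT (fun x => (\1_(box r) x * `|orbit_log k x|)%:E).
  apply/measurable_EFinP; apply: measurable_funM.
    by apply: measurable_indic; exact: box_measurable.
  by apply: measurableT_comp => //; exact: measurable_orbit_log.
have ob k : \int[space R]_x `|(orbit_log k x * f x)%:E| <= (rho ^+ k * (M * c))%:E.
  rewrite mulrCA EFinM; apply: le_trans (lee_wpmul2l _ (Hc k)); last by rewrite lee_fin.
  rewrite -ge0_integralZl//.
  apply: ge0_le_integral => //.
  - by apply: measurableT_comp.
  - exact: measurable_funeM.
  by move=> x _; rewrite /= -EFinM lee_fin normrM mulrA [leLHS]mulrC ler_wpM2r.
have io k : (space R).-integrable setT (fun x => (orbit_log k x * f x)%:E).
  by apply/integrableP; split=> //; apply: (le_lt_trans (ob k)); rewrite ltry.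
pose t k x := (d%:R^-1 ^+ k.+1 * `|orbit_log k x * f x|)%:E.
have t0 k x : 0 <= t k x by rewrite lee_fin mulr_ge0// exprn_ge0// invr_ge0.
have mt k : measurable_fun setT (t k).
  apply/measurable_EFinP; apply: measurable_funM; first exact: measurable_cst.
  by apply: measurableT_comp => //; apply/measurable_EFinP; exact: mo.
pose D x := \sum_(k <oo) t k x.
have D0 x : 0 <= D x by apply: nneseries_ge0 => k _ _; exact: t0.
have mD : measurable_fun setT D.
  by apply: ge0_emeasurable_sum => // k x _ _; exact: t0.
have iD : (space R).-integrable setT D.
  apply/integrableP; split => //.
  rewrite (eq_integral D) => [|x _]; last by rewrite gee0_abs.
  rewrite /D integral_nneseries//.
  apply: (@le_lt_trans _ _ (\sum_(k <oo) (d%:R^-1 * (M * c) * (rho / d%:R) ^+ k)%:E)).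
    apply: lee_nneseries => [k _ _|k _]; first by apply: integral_ge0 => x _; exact: t0.
    rewrite (eq_integral (fun x => (d%:R^-1 ^+ k.+1)%:E * `|(orbit_log k x * f x)%:E|)) => [|x _]; last by rewrite -EFinM.
    rewrite ge0_integralZl//; last exact: measurableT_comp.
    apply: (le_trans (lee_wpmul2l _ (ob k))); first by rewrite lee_fin exprn_ge0// invr_ge0.
    rewrite -EFinM lee_fin expr_div_n exprVn exprS invfM.
    by rewrite le_eqVlt; apply/orP; left; apply/eqP; ring.
  have H := @cvg_geometric_series R (d%:R^-1 * (M * c))%R _ ratio_lt1.
  rewrite (_ : \sum_(k <oo) _ = (d%:R^-1 * (M * c) / (1 - rho / d%:R))%:E); first by rewrite ltry.
  apply/cvg_lim => //; apply: cvg_EFin; first by apply: nearW => n; rewrite sumEFin.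
  apply: cvg_trans H; apply: near_eq_cvg; apply: nearW => n.
  by rewrite /= sumEFin /series /=.
have mP n : measurable_fun setT (fun x => (partial n (toC2 x) * f x)%:E).
  apply/measurable_EFinP; apply: measurable_funM => //.
  apply: measurable_sum => k; apply: measurable_funM; first exact: measurable_cst.
  exact: measurable_orbit_log.
have mg : measurable_fun setT (fun x => escape_rate N d F (toC2 x) * (f x)%:E).
  by apply: emeasurable_funM; [exact: measurable_escape_rate|apply/measurable_EFinP].
have ae1 : {ae space R, forall x, setT x ->
    (partial n (toC2 x) * f x)%:E @[n --> \oo] --> escape_rate N d F (toC2 x) * (f x)%:E}.
  apply: filterS good_ae => x gx _; have [_ _ /(_ gx) H] := escape_rate_limit (toC2 x).
  rewrite (_ : (fun n => _) = (fun n => (partial n (toC2 x))%:E * (f x)%:E)) //.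
  by apply: cvgeZr.
have ae2 : {ae space R, forall x n, setT x -> `|(partial n (toC2 x) * f x)%:E| <= D x}.
  apply: aeW => x n _; apply: (@le_trans _ _ (\sum_(0 <= k < n) t k x)); last first.
    exact: nneseries_lim_ge.
  rewrite /= sumEFin lee_fin big_mkord /partial mulr_suml (le_trans (ler_norm_sum _ _ _))//.
  by apply: ler_sum => k _; rewrite -mulrA normrM ger0_norm// exprn_ge0// invr_ge0.
have [jg _ lim] := dominated_convergence measurableT mP mg ae1 iD ae2.
split => //.
rewrite (_ : (fun n => _) = (fun n => \int[space R]_x (partial n (toC2 x) * f x)%:E)) //.
apply/funext => n.
have ik (k : 'I_n) : (space R).-integrable setT (fun x => (d%:R^-1 ^+ k.+1)%:E * (orbit_log k x * f x)%:E).
  exact: integrableZl.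
rewrite -sumEFin (eq_integral (fun x => \sum_(k < n) (d%:R^-1 ^+ k.+1)%:E * (orbit_log k x * f x)%:E)); last first.
  move=> x _; rewrite /partial mulr_suml -sumEFin; apply: eq_bigr => k _.
  by rewrite -[in RHS]EFinM [in RHS]mulrA.
rewrite integral_sum//; apply: eq_bigr => k _; rewrite integralZl// EFinM; congr (_ * _).
by rewrite fineK//; exact: (integrable_fin_num measurableT (io k)).
Qed.

Local Close Scope ereal_scope.

Lemma Rintegral_seq (s : seq (P1 R)) (l : P1 R -> 'R4 R -> R) :
  (forall z, (space R).-integrable setT (EFin \o l z)) ->
  (space R).-integrable setT (EFin \o (fun x => \sum_(z <- s) l z x)) /\
  \int[space R]_x (\sum_(z <- s) l z x) = \sum_(z <- s) \int[space R]_x l z x.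
Proof.
move=> il; elim: s => [|z s [IH1 IH2]].
  rewrite (_ : (fun x => _) = cst 0); last by apply/funext => x; rewrite big_nil.
  by split; [exact: integrable0|rewrite big_nil Rintegral_cst//= mul0r].
have [h1 h2] := Rintegral_lin 1 1 (il z) IH1.
rewrite (_ : (fun x => _) = (fun x => 1 * l z x + 1 * \sum_(z <- s) l z x)); last first.
  by apply/funext => x; rewrite big_cons !mul1r.
by rewrite big_cons h2 IH2 !mul1r.
Qed.

(** Only the linear factors of the hole value are seen: its constant factor contributes an
    additive constant, which disappears against a function of integral zero. *)
Lemma orbit_log_integral k f K : compact K -> continuous f -> vanishes_off K f ->
  \int[space R]_x f x = 0 -> \int[space R]_x (orbit_log k x * f x) =
    \sum_(z <- zs k) \int[space R]_x (lognorm (det2 (toC2 x) (vec z)) * f x).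
Proof.
move=> cK cf fK f0.
have il z := logM_integrable (vec_neq0 z) cK cf fK.
have [is1 <-] := Rintegral_seq (zs k) il.
have jf : (space R).-integrable setT (EFin \o f) by apply: (integrable_cpt cK).
have [h1 h2] := Rintegral_lin 1 (lognorm (cs k)) is1 jf.
rewrite f0 mulr0 addr0 mul1r in h2; rewrite -h2.
rewrite /Rintegral; congr fine; apply: ae_eq_integral => //.
- apply/measurable_EFinP; apply: measurable_funM; first exact: measurable_orbit_log.
  exact: continuous_measurable4.
- exact: measurable_int h1.
apply: filterS good_ae => x gx _; congr EFin.
by rewrite /orbit_log (hole_val_log (gx k)) mulrDl addrC mul1r mulr_suml.
Qed.

End Dynamics.

(** * Integration against a sum of point masses *)

Section AtomicMeasure.
Context d (T : measurableType d) (R : realType).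
Variables (mu : {measure set T -> \bar R}) (zs : nat -> seq T) (a : nat -> {nonneg R}).
Hypothesis mpoint : forall z : T, measurable [set z].
Local Open Scope ereal_scope.
Hypothesis muE : forall A, measurable A ->
  mu A = \sum_(n <oo) (a n)%:num%:E * \sum_(z <- zs n) \d_z A.

Import HBNNSimple.

Definition atoms : set T := \bigcup_n [set` zs n].

Lemma measurable_seq (s : seq T) : measurable [set` s].
Proof.
elim: s => [|z s IH].
  by rewrite (_ : [set` _] = set0)//; apply/seteqP; split.
rewrite (_ : [set` _] = [set z] `|` [set` s]); first exact: measurableU.
apply/seteqP; split => y /=; first by rewrite in_cons => /predU1P.
by case=> [->|ys]; rewrite in_cons ?eqxx ?ys ?orbT.
Qed.

Lemma measurable_subset_atoms U : U `<=` atoms -> measurable U.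
Proof.
move=> UA; rewrite (_ : U = \bigcup_n [set` [seq z <- zs n | `[< U z >]]]).
  by apply: bigcup_measurable => n _; exact: measurable_seq.
apply/seteqP; split => y /=.
  move=> Uy; have [n _ yn] := UA y Uy; exists n => //=.
  by rewrite mem_filter; apply/andP; split => //; exact/asboolP.
by move=> [n _] /=; rewrite mem_filter => /andP[/asboolP].
Qed.

Lemma measurable_atoms : measurable atoms.
Proof. exact: measurable_subset_atoms. Qed.

Lemma null_off_atoms : mu (~` atoms) = 0.
Proof.
rewrite muE; last exact: measurableC measurable_atoms.
rewrite eseries0// => n _ _; rewrite big_seq big1 ?mule0// => z zn.
by rewrite diracE memNset//; apply; exists n.
Qed.

(** Cutting a simple function below g down to the atoms does not change its integral, the
    complement of the atoms being null; and g restricted to the atoms is measurable, since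
    every set of atoms is.  So g itself may be arbitrary. *)
Lemma ge0_integral_atoms (g : T -> \bar R) : (forall x, 0 <= g x) ->
  \int[mu]_x g x = \int[mu]_(x in atoms) g x.
Proof.
move=> g0; have mS := measurable_atoms.
rewrite ge0_integralTE// [RHS]ge0_integralE//; apply/eqP; rewrite eq_le; apply/andP; split.
  apply: ub_ereal_sup => _ [h hg <-].
  rewrite -integralT_nnsfun (ge0_negligible_integral (measurableC mS))//; first last.
  - exact: null_off_atoms.
  - by move=> x _; rewrite lee_fin.
  - exact/measurable_EFinP.
  rewrite setTD setCK integral_mkcond.
  rewrite (eq_integral (fun x => (proj_nnsfun h mS x)%:E)) => [|x _]; last first.
    by rewrite -mrestrict /patch; case: ifP.
  rewrite integralT_nnsfun; apply: ereal_sup_ubound; exists (proj_nnsfun h mS) => //= x.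
  rewrite -[X in X%:E]/(proj_nnsfun h mS x) -mrestrict /patch; case: ifP => // _; exact: hg.
apply: le_ereal_sup => _ [h hg <-]; exists h => // x; apply: (le_trans (hg x)).
by rewrite /patch; case: ifP.
Qed.

Lemma ge0_integral_atomic (g : T -> R) : (forall x, (0 <= g x)%R) ->
  \int[mu]_x (g x)%:E = \sum_(n <oo) ((a n)%:num * \sum_(z <- zs n) g z)%:E.
Proof.
move=> g0; rewrite ge0_integral_atoms => [|x]; last by rewrite lee_fin.
rewrite integral_mkcond.
pose g1 x := ((fun x => (g x)%:E) \_ atoms) x.
have g10 x : 0 <= g1 x by rewrite /g1 /patch; case: ifP; rewrite ?lee_fin.
have mg1 : measurable_fun setT g1.
  move=> _ Y mY; rewrite setTI.
  have mU : measurable (atoms `&` g1 @^-1` Y) by apply: measurable_subset_atoms => x [].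
  have [Y0|Y0] := pselect (Y 0).
    rewrite (_ : _ @^-1` _ = (atoms `&` g1 @^-1` Y) `|` ~` atoms).
      by apply: measurableU => //; exact: measurableC measurable_atoms.
    apply/seteqP; split => x /=.
      by have [Ax|nAx] := pselect (atoms x) => Yx; [left|right].
    by case=> [[]//|nAx]; rewrite /g1 /patch memNset.
  rewrite (_ : _ @^-1` _ = atoms `&` g1 @^-1` Y)//.
  apply/seteqP; split => x /=; last by case.
  by move=> Yx; split => //; apply: contrapT => nAx; apply: Y0; move: Yx; rewrite /g1 /patch memNset.
pose dn n (i : nat) : {measure set T -> \bar R} := dirac (nth point (zs n) i).
pose nu_ n : {measure set T -> \bar R} := mscale (a n) (msum (dn n) (size (zs n))).
transitivity (\int[mseries nu_ 0]_x g1 x).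
  apply: eq_measure_integral => A mA _; rewrite muE// /mseries /=; apply: eq_eseriesr => n _.
  rewrite -[RHS]/(((a n)%:num)%:E * msum (dn n) (size (zs n)) A) /msum /=; congr (_ * _).
  by rewrite (big_nth point) big_mkord.
rewrite ge0_integral_measure_series//; apply: eq_eseriesr => n _.
rewrite ge0_integral_mscale// ge0_integral_measure_sum//; rewrite EFinM; congr (_ * _).
rewrite -sumEFin [RHS](big_nth point) big_mkord; apply: eq_bigr => i _.
rewrite integral_dirac// diracT mul1e /g1 /patch mem_set//.
by exists n => //=; apply: mem_nth.
Qed.

(** Split f into positive and negative parts; the bound on the total mass makes both integrals
    finite. *)
Lemma integral_atomic (f : T -> R) (B c : R) : (forall z, (`|f z| <= B)%R) ->
  (forall n, (\sum_(k < n) (a k)%:num * (size (zs k))%:R <= c)%R) ->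
  (\sum_(k < n) (a k)%:num * \sum_(z <- zs k) f z)%:E @[n --> \oo] --> \int[mu]_x (f x)%:E.
Proof.
move=> fB ac; have B0 : (0 <= B)%R by rewrite (le_trans _ (fB point)).
pose part (g : T -> R) n := (\sum_(k < n) (a k)%:num * \sum_(z <- zs k) g z)%R.
have partE g n : (part g n)%:E = \sum_(0 <= k < n) ((a k)%:num * \sum_(z <- zs k) g z)%:E.
  by rewrite big_mkord sumEFin.
have H g : (forall x, (0 <= g x)%R) -> (forall x, (g x <= B)%R) ->
    (part g n)%:E @[n --> \oo] --> \int[mu]_x (g x)%:E /\ \int[mu]_x (g x)%:E \is a fin_num.
  move=> g0 gB; rewrite ge0_integral_atomic//.
  have t0 k : 0 <= ((a k)%:num * \sum_(z <- zs k) g z)%:E.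
    by rewrite lee_fin mulr_ge0// sumr_ge0.
  split.
    under eq_fun do rewrite partE.
    exact: is_cvg_nneseries.
  rewrite ge0_fin_numE; last exact: nneseries_ge0.
  apply: (@le_lt_trans _ _ (c * B)%:E); last exact: ltry.
  apply: lime_le; first exact: is_cvg_nneseries.
  apply: nearW => n; rewrite big_mkord sumEFin lee_fin.
  apply: (@le_trans _ _ (\sum_(k < n) (a k)%:num * (size (zs k))%:R * B)%R); last first.
    by rewrite -mulr_suml ler_wpM2r.
  apply: ler_sum => k _; rewrite -mulrA ler_wpM2l//.
  apply: (@le_trans _ _ (\sum_(z <- zs k) B)%R); first by apply: ler_sum.
  by rewrite big_const_seq count_predT iter_addr_0 -[(B *+ _)%R]mulr_natl.
pose p x := Num.max (f x) 0%R; pose q x := Num.max (- f x)%R 0%R.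
have pq x : (f x = p x - q x)%R by rewrite /p /q /Num.max; do 2 case: ifP; lra.
have [lp fp] : (part p n)%:E @[n --> \oo] --> \int[mu]_x (p x)%:E /\ \int[mu]_x (p x)%:E \is a fin_num.
  apply: H => x; first by rewrite le_max lexx orbT.
  by rewrite ge_max B0 andbT (le_trans (ler_norm _)).
have [lq fq] : (part q n)%:E @[n --> \oo] --> \int[mu]_x (q x)%:E /\ \int[mu]_x (q x)%:E \is a fin_num.
  apply: H => x; first by rewrite le_max lexx orbT.
  by rewrite ge_max B0 andbT (le_trans (ler_norm _))// normrN.
have -> : \int[mu]_x (f x)%:E = \int[mu]_x (p x)%:E - \int[mu]_x (q x)%:E.
  rewrite integralE; congr (_ - _); apply: eq_integral => x _.
    by rewrite funeposE /p EFin_max.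
  by rewrite funenegE /q EFin_max.
rewrite (_ : (fun n => _) = fun n => (part p n)%:E - (part q n)%:E).
  by apply: cvgeB => //; rewrite fin_num_adde_defr.
apply/funext => n; rewrite -EFinB; congr EFin; rewrite /part -sumrB; apply: eq_bigr => k _.
by rewrite -mulrBr -sumrB; congr (_ * _)%R; apply: eq_bigr => z _; exact: pq.
Qed.

End AtomicMeasure.

Section PointsOfTheLine.
Variable R : realType.

(** The complement of a point is open: its preimage is the set where a linear form does not
    vanish. *)
Lemma measurable_P1_point (p : P1_borel R) : measurable [set p].
Proof.
rewrite -[X in measurable X]setCK; apply: measurableC; apply: sub_gen_smallest.
rewrite /P1_open /=.
have -> : [set x : 'R4 R | toC2 x != 0 /\ (~` [set p]) (proj (toC2 x))] =
    (fun x => sqn (det2 (toC2 x) (vec (p : P1 R)))) @^-1` [set t | t != 0].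
  apply/seteqP; split => x /=.
    move=> [x0 xp]; rewrite sqn_eq0; apply: contra_not_neq xp => d0.
    by have := det2_proj (p : P1 R) x0; rewrite d0 eqxx => /esym/eqP.
  rewrite sqn_eq0 => d0; have x0 : toC2 x != 0.
    by apply: contra_neq d0 => ->; rewrite /det2 !mxE !mulr0 subrr.
  by split => //; have := det2_proj (p : P1 R) x0; rewrite (negbTE d0) => /esym/negbT/eqP.
apply: open_comp; first by move=> x _; exact: continuous_coord_line.
rewrite (_ : [set t | t != 0] = ~` [set 0]); last by apply/seteqP; split => t /= /eqP.
by apply: closed_openC; exact: closed_eq.
Qed.

End PointsOfTheLine.

(** * The current of the escape rate *)

Section FibreIntegralBound.
Variable R : realType.
Local Notation C := R[i].
Implicit Types (v : 'C2 R) (x : 'R4 R) (g : 'R4 R -> R) (K : set ('R4 R)).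

Local Open Scope ereal_scope.

(** For g of integral zero, the integral of log |det2 x v| against g does not change when v
    is rescaled: this gives a bound independent of v. *)
Lemma potential_bounded g K : compact K -> continuous g -> vanishes_off K g ->
  (\int[space R]_x g x = 0)%R -> exists B : R, forall v, v != 0%R ->
  (`|\int[space R]_x (lognorm (det2 (toC2 x) v) * g x)| <= B)%R.
Proof.
move=> cK cg gK g0; have [r [r0 Kr]] := compact_bounded4 cK.
have [M M0 gM] := continuous_cpt_bounded cK cg gK.
have [c Hc] := lognorm_bound (ltW r0).
exists (M * c)%R => v v0; have [m [u [m0 uu vE]]] := unit_normalize v0.
have u0 : u != 0%R by apply: contra_neq v0 => uz; rewrite vE uz scaler0.
have mC : m%:C != 0%R :> C by rewrite eq_complex /= eqxx andbT gt_eqF.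
have iu := logM_integrable u0 cK cg gK; have iv := logM_integrable v0 cK cg gK.
have ig : (space R).-integrable setT (EFin \o g) by apply: (integrable_cpt cK).
have -> : (\int[space R]_x (lognorm (det2 (toC2 x) v) * g x) =
           \int[space R]_x (1 * (lognorm (det2 (toC2 x) u) * g x) + ln m * g x))%R.
  have [h1 _] := Rintegral_lin 1 (ln m) iu ig.
  rewrite /Rintegral; congr fine; apply: ae_eq_integral => //.
  - exact: measurable_int iv.
  - exact: measurable_int h1.
  apply: filterS (not_on_line u0) => x d0 _; congr EFin.
  by rewrite vE det2Zr lognormM// lognorm_real// mulrDl addrC mul1r.
have [_ ->] := Rintegral_lin 1 (ln m) iu ig.
rewrite g0 mulr0 addr0 mul1r.
have f := integrable_fin_num measurableT iu.
rewrite -lee_fin -[X in X <= _]/(`|(\int[space R]_x (lognorm (det2 (toC2 x) u) * g x))%:E|) fineK//.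
apply: (le_trans (le_abse_integral _ measurableT (measurable_int _ iu))).
rewrite EFinM; apply: le_trans (lee_wpmul2l _ (Hc u uu)); last by rewrite lee_fin ltW.
have mlog : measurable_fun setT (fun x => (\1_(box r) x * `|lognorm (det2 (toC2 x) u)|)%:E).
  apply/measurable_EFinP; apply: measurable_funM.
    by apply: measurable_indic; exact: box_measurable.
  by apply: measurableT_comp => //; exact: measurable_lognorm.
rewrite -ge0_integralZl//; last by rewrite lee_fin ltW.
apply: ge0_le_integral => //.
- by apply: measurableT_comp => //; exact: measurable_int iu.
- exact: measurable_funeM.
move=> x _; rewrite /= -EFinM lee_fin normrM mulrA [leLHS]mulrC ler_wpM2r//.
by apply: bounded_box => // y yb; apply: gK => /Kr.
Qed.

End FibreIntegralBound.

Section Conclusion.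
Variables (R : realType) (d : nat) (F : 'lift R) (N : 'C2 R -> R).
Hypotheses (hd : (2 <= d)%N) (hF : is_lift d F) (hdeg : degenerate F)
  (hI : ~ in_I F) (hN : is_norm N).
Local Open Scope ereal_scope.

Lemma escape_rate_loc_integrable : loc_integrable (fun x : 'R4 R => escape_rate N d F (toC2 x)).
Proof.
have [h [e [zs [cs [[ed szs] [formG nzG FE formH _] hed csE _]]]]] := degenerate_data hd hF hdeg hI.
move=> K cK K0; apply/integrable_leb4.
have mK := compact_measurable4 cK.
have m1 : measurable_fun setT (\1_K : 'R4 R -> R) by exact: measurable_indic.
have b1 (x : 'R4 R) : (`|\1_K x : R| <= 1)%R by rewrite indicE; case: (_ \in _); rewrite /= ?normr1 ?normr0.
have v1 : vanishes_off K (\1_K : 'R4 R -> R) by move=> x Kx; rewrite indicE memNset.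
have [_ + _] := escape_rate_integral hd ed hed hN szs formG nzG FE formH csE cK K0 m1 b1 v1.
move=> H; apply/(integrable_mkcond _ mK); apply: eq_integrable H => // x _.
by rewrite /patch indicE; case: (_ \in _); rewrite ?mule1 ?mule0.
Qed.

Lemma size_sum_le (h e : nat) (zs : nat -> seq (P1 R)) (n : nat) : (h + e)%N = d ->
  (forall k, size (zs k) = (h * e ^ k)%N) ->
  (\sum_(k < n) d%:R^-1 ^+ k.+1 * (size (zs k))%:R <= 1 :> R)%R.
Proof.
move=> hed szs; have d0 : d%:R != 0%R :> R by rewrite pnatr_eq0; case: (d) hd.
have -> : (\sum_(k < n) d%:R^-1 ^+ k.+1 * (size (zs k))%:R = 1 - (e%:R / d%:R) ^+ n :> R)%R.
  elim: n => [|n IH]; first by rewrite big_ord0 expr0 subrr.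
  rewrite big_ord_recr /= IH szs natrM natrX.
  have -> : (h%:R = d%:R - e%:R :> R)%R by rewrite -hed natrD addrK.
  rewrite !expr_div_n exprVn !exprS; field.
  by rewrite d0 expf_neq0.
by rewrite gerBl exprn_ge0// divr_ge0.
Qed.

(** Both sides are the sum over k of d^-(k+1) times the sum, over the k-th preimages of the
    holes, of the potentials of lines. *)
Lemma integral_mu (K : set ('R4 R)) (g : 'R4 R -> R) (phi : P1 R -> R) : compact K -> ~ K 0%R ->
  continuous g -> vanishes_off K g -> (\int[space R]_x g x = 0)%R ->
  (forall z, phi z = 4 * \int[space R]_x (lognorm (det2 (toC2 x) (vec z)) * g x))%R ->
  fine (\int[mu d F]_z (phi z)%:E) =
    (4 * fine (\int[@leb4 R]_x (escape_rate N d F (toC2 x) * (g x)%:E)))%R.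
Proof.
move=> cK K0 cg gK g0 phiE.
have [h [e [zs [cs [[ed szs] [formG nzG FE formH _] hed csE muE]]]]] := degenerate_data hd hF hdeg hI.
have [M M0 gM] := continuous_cpt_bounded cK cg gK.
have [_ jg lim] := escape_rate_integral hd ed hed hN szs formG nzG FE formH csE cK K0
  (continuous_measurable4 cg) gM gK.
have [B HB] := potential_bounded cK cg gK g0.
have phiB (z : P1_borel R) : (`|phi z| <= 4 * B)%R.
  by rewrite phiE normrM ger0_norm// ler_wpM2l// HB// vec_neq0.
have a0 k : (0 <= (d%:R^-1 : R) ^+ k.+1)%R by rewrite exprn_ge0// invr_ge0.
pose a k : {nonneg R} := NngNum (a0 k).
have muE' (A : set (P1_borel R)) : measurable A ->
    mu d F A = \sum_(n <oo) (a n)%:num%:E * \sum_(z <- (zs n : seq (P1_borel R))) \d_z A.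
  by move=> _; exact: muE.
have lim2 := integral_atomic (@measurable_P1_point R) muE' phiB (fun n => size_sum_le n hed szs).
rewrite integral_leb4.
have E : \int[mu d F]_z (phi z)%:E = 4%:E * \int[space R]_x (escape_rate N d F (toC2 x) * (g x)%:E).
  apply: (cvg_unique _ lim2) => //.
  rewrite (_ : (fun n => _) = fun n => 4%:E *
    (\sum_(k < n) d%:R^-1 ^+ k.+1 * \int[space R]_x (orbit_log F k x * g x))%:E).
    by apply: cvgeZl.
  apply/funext => n; rewrite -EFinM; congr EFin; rewrite mulr_sumr; apply: eq_bigr => k _.
  rewrite (orbit_log_integral csE k cK cg gK g0) mulrCA; congr (_ * _)%R.
  by rewrite mulr_sumr; apply: eq_bigr => z _; exact: phiE.
by rewrite E fineM//; exact: (integrable_fin_num measurableT jg).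
Qed.

End Conclusion.

Theorem proposition11 (R : realType) (d : nat) (F : 'lift R) (N : 'C2 R -> R)
    (hd : (2 <= d)%N) (hF : is_lift d F) (hdeg : degenerate F)
    (hI : ~ in_I F) (hN : is_norm N) :
  (forall v : 'C2 R, cvgn (escape_seq N d F v) /\
                     (escape_rate N d F v < +oo)%E) /\
  loc_integrable (fun x => escape_rate N d F (toC2 x)) /\
  (forall w : diff_form R, test_form 2 w ->
     pullback (mu d F) w =
     ddc (current_of (fun x => escape_rate N d F (toC2 x))) w).
Proof.
split.
  have [h [e [zs [cs [[ed szs] [formG nzG FE formH _] hed csE _]]]]] := degenerate_data hd hF hdeg hI.
  move=> v.
  by have [] := escape_rate_limit hd ed hed hN formG nzG FE formH v.
split; first exact: escape_rate_loc_integrable.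
move=> w [_ sw [K [cK K0 wK]]].
have {}wK I : cvanishes K (w I) by exact: wK.
have [sre sim] := ddc_smooth sw.
have dK := ddc_vanishes cK wK sw.
have vre : vanishes_off K (fun x => complex.Re (top_coef w x)) by move=> x Kx; rewrite /top_coef dK.
have vim : vanishes_off K (fun x => complex.Im (top_coef w x)) by move=> x Kx; rewrite /top_coef dK.
have := cR_ddc0 cK wK sw; rewrite /cR => -[Ire Iim].
have fE := fibre_integralE cK wK sw.
rewrite /pullback /ddc /current_of /cintegral.
have hre := integral_mu hd hF hdeg hI hN cK K0 (smooth_continuous sre) vre Ire
  (fun z => congr1 (@complex.Re R) (fE z)).
have him := integral_mu hd hF hdeg hI hN cK K0 (smooth_continuous sim) vim Iim
  (fun z => congr1 (@complex.Im R) (fE z)).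
rewrite hre him /top_coef.
by apply: complex_eq; rewrite ?ReM ?ImM /=; ring.
Qed.
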